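(* Let $A$ be a unital associative algebraic algebra over an infinite field $\mathbb{F}$ of characteristic $p\ge 0$. Then the following conditions are equivalent: 1. $A$ is a GI-algebra. 2. The group of units $A^\times$ is solvable, in the case when $p=0$, while $A^\times$ satisfies a group identity of the form $(x,y)^{p^t}=1$ for some natural number $t$, in the case when $p>0$. 3. $A$ satisfies a non-matrix polynomial identity. 4. $A$ is Lie solvable, in the case when $p=0$, while $A$ satisfies a polynomial identity of the form $([x,y]z)^{p^t}=0$ for some natural number $t$, in the case when $p>0$. Furthermore, in this case, $\mathcal{N}(A)=\mathcal{B}(A)$ is a locally nilpotent ideal of $A$, and $A/\mathcal{B}(A)$ is both commutative and reduced.
   Context: $A^\times$ is the group of multiplicative units of $A$, $\mathcal{B}(A)$ is the prime radical of $A$, and $\mathcal{N}(A)$ is the set of all nilpotent elements of $A$. An algebra is algebraic if each of its elements is algebraic over $\mathbb{F}$. $A$ is a GI-algebra if $A^\times$ satisfies a group identity, i.e. there is a nontrivial word $w(x_1,\ldots,x_n)$ in a free group with $w(g_1,\ldots,g_n)=1$ for all $g_1,\ldots,g_n\in A^\times$. For $x,y\in A^\times$, $(x,y)=x^{-1}y^{-1}xy$. For $x,y\in A$, $[x,y]=xy-yx$; $A$ is Lie solvable if it is solvable as a Lie algebra under this bracket. A polynomial identity is non-matrix if it is not satisfied by the algebra $M_2(\mathbb{F})$ of $2\times2$ matrices over $\mathbb{F}$. A (not necessarily unital) algebra is locally nilpotent if every finitely generated (not necessarily unital) subalgebra of it is nilpotent. An algebra is reduced if it has no nonzero nilpotent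 elements. *)

(* Defs.v *)
From HB Require Import structures.
From mathcomp Require Import all_boot all_order all_algebra finmap.
From mathcomp Require Import boolp classical_sets functions cardinality.

Set Implicit Arguments.
Unset Strict Implicit.
Unset Printing Implicit Defensive.

Import GRing.Theory.

Local Open Scope classical_set_scope.
Local Open Scope quotient_scope.
Local Open Scope ring_scope.

(* [pchar F] is the set of primes that vanish in F; it is empty exactly in
   characteristic 0. *)
Definition has_characteristic (F : fieldType) (p : nat) : Prop :=
  if p is 0%N then has_pchar0 F else p \in [pchar F].

Definition algebraic_algebra (F : fieldType) (A : algType F) : Prop :=
  forall a : A, exists2 q : {poly F}, q != 0 & horner_alg a q = 0.

Section UnitGroup.
Variable R : unitRingType.

(* The library's {unit R} is only available for finite R. *)
Record unit_group : Type := UnitGroup {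
  unit_val : R;
  unit_valP : unit_val \is a GRing.unit
}.

HB.instance Definition _ := [isSub for unit_val].
HB.instance Definition _ := [Choice of unit_group by <:].

Implicit Types u v w : unit_group.

Fact unit_inv_subproof u : (unit_val u)^-1 \is a GRing.unit.
Proof. by rewrite unitrV unit_valP. Qed.

Fact unit_mul_subproof u v : unit_val u * unit_val v \is a GRing.unit.
Proof. by rewrite unitrMl unit_valP. Qed.

Definition unit_one : unit_group := UnitGroup (unitr1 R).
Definition unit_inv u : unit_group := UnitGroup (unit_inv_subproof u).
Definition unit_mul u v : unit_group := UnitGroup (unit_mul_subproof u v).

Fact unit_mulgA : associative unit_mul.
Proof. by move=> u v w; apply: val_inj; rewrite /= mulrA. Qed.

Fact unit_mul1g : left_id unit_one unit_mul.
Proof. by move=> u; apply: val_inj; rewrite /= mul1r. Qed.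

Fact unit_mulg1 : right_id unit_one unit_mul.
Proof. by move=> u; apply: val_inj; rewrite /= mulr1. Qed.

Fact unit_mulVg : left_inverse unit_one unit_inv unit_mul.
Proof. by move=> u; apply: val_inj; rewrite /= mulVr ?unit_valP. Qed.

Fact unit_mulgV : right_inverse unit_one unit_inv unit_mul.
Proof. by move=> u; apply: val_inj; rewrite /= divrr ?unit_valP. Qed.

HB.instance Definition _ := isGroup.Build unit_group
  unit_mulgA unit_mul1g unit_mulg1 unit_mulVg unit_mulgV.

End UnitGroup.

Arguments unit_group R%_type.

(* The letter (i, true) stands for the i-th free generator and (i, false) for
   its inverse. The elements of the free group are the reduced words, those
   without adjacent mutually inverse letters; the identity is [::]. *)
Definition reduced_word (n : nat) (w : seq ('I_n * bool)) : bool :=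
  sorted (fun a b => ~~ ((a.1 == b.1) && (a.2 != b.2))) w.

Definition eval_word (G : groupType) (n : nat) (g : 'I_n -> G)
    (w : seq ('I_n * bool)) : G :=
  (\prod_(a <- w) (if a.2 then g a.1 else (g a.1)^-1))%g.

Definition satisfies_group_identity (G : groupType) : Prop :=
  exists (n : nat) (w : seq ('I_n * bool)),
    [/\ reduced_word w, w != [::] & forall g : 'I_n -> G, eval_word g w = 1%g].

Definition GI_algebra (F : fieldType) (A : unitAlgType F) : Prop :=
  satisfies_group_identity (unit_group A).

Definition is_subgroup (G : groupType) (H : set G) : Prop :=
  H 1%g /\ forall x y, H x -> H y -> H (x * y^-1)%g.

Fixpoint derived_group (G : groupType) (k : nat) : set G :=
  if k is k'.+1 then
    smallest (@is_subgroup G)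
      [set z | exists x y : G,
         [/\ derived_group k' x, derived_group k' y & z = [~ x, y]%g]]
  else setT.

Arguments derived_group G k : clear implicits.

Definition solvable_group (G : groupType) : Prop :=
  exists k : nat, derived_group G k = [set 1%g].

Definition is_subspace (F : fieldType) (V : lmodType F) (U : set V) : Prop :=
  U 0 /\ forall (a : F) (u v : V), U u -> U v -> U (a *: u + v).

Definition lie_bracket (R : pzRingType) (x y : R) : R := x * y - y * x.

Fixpoint lie_derived (F : fieldType) (A : algType F) (k : nat) : set A :=
  if k is k'.+1 then
    smallest (@is_subspace F A)
      [set z | exists x y : A,
         [/\ lie_derived k' x, lie_derived k' y & z = lie_bracket x y]]
  else setT.

Arguments lie_derived {F} A k.

Definition lie_solvable (F : fieldType) (A : algType F) : Prop :=
  exists k : nat, lie_derived A k = [set 0].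

(* The free associative algebra F<x_0, x_1, ...>: a polynomial is its finitely
   supported family of coefficients, indexed by the words in the variables. *)
Definition nc_poly (F : fieldType) : Type := {fsfun seq nat -> F with 0}.

Definition nc_eval (F : fieldType) (A : algType F) (a : nat -> A)
    (f : nc_poly F) : A :=
  \sum_(w <- finsupp f) f w *: \prod_(i <- w) a i.

Definition satisfies_identity (F : fieldType) (A : algType F)
    (f : nc_poly F) : Prop :=
  forall a : nat -> A, nc_eval a f = 0.

(* Such an f is automatically nonzero. *)
Definition nonmatrix (F : fieldType) (f : nc_poly F) : Prop :=
  ~ satisfies_identity 'M[F]_2 f.

Definition satisfies_nonmatrix_identity (F : fieldType) (A : algType F) : Prop :=
  exists2 f : nc_poly F, nonmatrix f & satisfies_identity A f.

Definition is_ideal (R : pzRingType) (I : set R) : Prop :=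
  [/\ I 0, forall x y, I x -> I y -> I (x - y)
    & forall a x, I x -> I (a * x) /\ I (x * a)].

(* The hypothesis on products says that the ideal product I J lies in P. *)
Definition is_prime_ideal (R : pzRingType) (P : set R) : Prop :=
  [/\ is_ideal P, P != setT
    & forall I J : set R, is_ideal I -> is_ideal J ->
        (forall x y, I x -> J y -> P (x * y)) -> I `<=` P \/ J `<=` P].

Definition prime_radical (R : pzRingType) : set R :=
  \bigcap_(P in [set P : set R | is_prime_ideal P]) P.

Arguments prime_radical R : clear implicits.

Definition nilpotents (R : pzRingType) : set R :=
  [set x | exists n : nat, x ^+ n = 0].

Arguments nilpotents R : clear implicits.

Definition reduced_ring (R : pzRingType) : Prop := nilpotents R `<=` [set 0].

Definition is_nonunital_subalgebra (F : fieldType) (A : algType F)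
    (B : set A) : Prop :=
  is_subspace B /\ forall x y, B x -> B y -> B (x * y).

Definition nilpotent_subalgebra (F : fieldType) (A : algType F)
    (B : set A) : Prop :=
  exists2 n : nat, (0 < n)%N &
    forall x : 'I_n -> A, (forall i, B (x i)) -> \prod_(i < n) x i = 0.

(* The subalgebra generated by S stays inside B when B is a subalgebra. *)
Definition locally_nilpotent (F : fieldType) (A : algType F)
    (B : set A) : Prop :=
  forall S : set A, finite_set S -> S `<=` B ->
    nilpotent_subalgebra (smallest (@is_nonunital_subalgebra F A) S).

Lemma prime_radical_ideal (R : pzRingType) : is_ideal (prime_radical R).
Proof.
split=> [P [[]] //|x y Bx By P PP|a x Bx].
  by have [[_ PB _] _ _] := PP; apply: PB; [apply: Bx|apply: By].
by split=> P PP; have [[_ _ PM] _ _] := PP; have [] := PM a x (Bx _ PP).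
Qed.

Section PrimeQuotient.
Variable R : nzRingType.

Definition in_prime_radical : {pred R} := fun x => `[< prime_radical R x >].

Fact in_prime_radical_zmod_closed : zmod_closed in_prime_radical.
Proof.
have [B0 BB _] := prime_radical_ideal R.
by split=> [|x y /asboolP Bx /asboolP By]; apply/asboolP => //; apply: BB.
Qed.

HB.instance Definition _ :=
  GRing.isZmodClosed.Build R in_prime_radical in_prime_radical_zmod_closed.

(* The library puts a ring structure on Quotient.quot I only for commutative rings, so
   the product is defined here on a copy of that type. *)
Definition prime_quotient : Type := Quotient.quot in_prime_radical.

HB.instance Definition _ := GRing.Zmodule.on prime_quotient.
HB.instance Definition _ := EqQuotient.on prime_quotient.

Implicit Types (x y : R) (q r s : prime_quotient).

Definition prime_quotient_one : prime_quotient := \pi_prime_quotient 1.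
Definition prime_quotient_mul : prime_quotient -> prime_quotient -> prime_quotient :=
  lift_op2 prime_quotient *%R.

Lemma prime_quotient_eq x y :
  \pi_prime_quotient x = \pi_prime_quotient y <-> prime_radical R (x - y).
Proof.
split=> [/eqP|Bxy]; last apply/eqP.
  by rewrite -Quotient.idealrBE => /asboolP.
by rewrite -Quotient.idealrBE; apply/asboolP.
Qed.

Lemma prime_quotient_mulE x y :
  prime_quotient_mul (\pi_prime_quotient x) (\pi_prime_quotient y)
  = \pi_prime_quotient (x * y).
Proof.
have [_ BB BM] := prime_radical_ideal R.
unlock prime_quotient_mul; apply/prime_quotient_eq.
set x' := repr _; set y' := repr _.
have Bx : prime_radical R (x' - x) by apply/prime_quotient_eq; rewrite reprK.
have By : prime_radical R (y - y').
  by apply/prime_quotient_eq; rewrite reprK.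
have -> : x' * y' - x * y = (x' - x) * y' - x * (y - y').
  by rewrite mulrBl mulrBr opprB addrA subrK.
by apply: BB; [case: (BM y' _ Bx)|case: (BM x _ By)].
Qed.

Fact prime_quotient_addE x y :
  \pi_prime_quotient (x + y) = \pi_prime_quotient x + \pi_prime_quotient y.
Proof. exact: Quotient.pi_add. Qed.

Fact prime_quotient_mulA : associative prime_quotient_mul.
Proof.
move=> q r s; rewrite -[q]reprK -[r]reprK -[s]reprK.
by rewrite !prime_quotient_mulE mulrA.
Qed.

Fact prime_quotient_mul1q : left_id prime_quotient_one prime_quotient_mul.
Proof. by move=> q; rewrite -[q]reprK prime_quotient_mulE mul1r. Qed.

Fact prime_quotient_mulq1 : right_id prime_quotient_one prime_quotient_mul.
Proof. by move=> q; rewrite -[q]reprK prime_quotient_mulE mulr1. Qed.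

Fact prime_quotient_mulDl : left_distributive prime_quotient_mul +%R.
Proof.
move=> q r s; rewrite -[q]reprK -[r]reprK -[s]reprK.
by rewrite -prime_quotient_addE !prime_quotient_mulE mulrDl prime_quotient_addE.
Qed.

Fact prime_quotient_mulDr : right_distributive prime_quotient_mul +%R.
Proof.
move=> q r s; rewrite -[q]reprK -[r]reprK -[s]reprK.
by rewrite -prime_quotient_addE !prime_quotient_mulE mulrDr prime_quotient_addE.
Qed.

HB.instance Definition _ := GRing.Zmodule_isPzRing.Build prime_quotient
  prime_quotient_mulA prime_quotient_mul1q prime_quotient_mulq1
  prime_quotient_mulDl prime_quotient_mulDr.

End PrimeQuotient.

Arguments prime_quotient R%_type.

(* Main.v *)
Require Import Defs.
From HB Require Import structures.
From mathcomp Require Import all_boot all_order all_algebra finmap.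
From mathcomp Require Import boolp classical_sets functions cardinality.
From mathcomp Require Import fingroup perm ring zify.
Import GRing.Theory.

Set Implicit Arguments.
Unset Strict Implicit.
Unset Printing Implicit Defensive.

Local Open Scope classical_set_scope.
Local Open Scope ring_scope.


(** A group identity w on the units is expanded at units 1 + x (in an algebraic algebra
    1 + c x is a unit for almost all scalars c), and every homogeneous part of w is then a
    polynomial identity; one of these parts is non-matrix, because GL_2(F) satisfies no
    group identity. An algebra satisfying a non-matrix identity acts by commuting operators
    on its simple modules, so that ([x,y] z)^m = 0 holds for some m. All the conditions are
    derived from this identity: modulo a prime ideal a commutator generates a nil ideal of
    bounded exponent and so vanishes, which gives the structure of A; in characteristic p
    one takes p^t > m.

    In characteristic 0 the argument follows Kemer. By the Nagata-Higman theorem, in a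
    superalgebra whose even part satisfies ([x,y] z)^m = 0, long products of super-analogues
    of the values of u = [[[a,b],[c,d]],e] vanish. Applied to the Grassmann envelope this
    says that the multilinear map given by a long product of values of u is killed by all
    products of symmetrizations and alternations in the five groups of variables; since a
    multilinear map killed by all symmetrizations and alternations over k-subsets of k^2
    variables is zero, such products vanish in A itself. So the ideal I generated by the
    values of u is nilpotent and A is Lie solvable. Modulo I the commutators of L = [A,A]
    are central, and conjugation by exp x is exp(ad x); this makes the units of A/I
    solvable, while the group 1 + I is nilpotent. *)

(** * Linear algebra over an infinite field, noncommutative polynomials *)

(** Two obstacles shape the proof. A simple module only detects the Jacobson radical, while
    nilpotency is wanted: the modules are therefore taken over A[X], where a left inverse of 1 - cX
    must be the geometric series in cX and so forces c to be nilpotent. On a simple module a maximal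
    commuting set K of endomorphisms takes the place of the density theorem: F being infinite, the
    identity survives the extension by K, and two vectors independent over K would produce all of
    M_2(F).

    In characteristic 0 the Nagata-Higman theorem bounds powers of one element, but the nilpotency
    of I concerns products of unrelated values of u. Such a product is multilinear, and powers of a
    single value of the super-analogue of u encode its symmetrized versions: even Grassmann
    coefficients symmetrize a group of variables, odd ones alternate it. The word u is long enough
    that, whatever the parities, some part of its super-analogue is a commutator of even elements or
    has the form [ab + ba, c] with a, b, c odd, and both kinds lie in nilpotent ideals. *)

Section Subspace.
Variables (F : fieldType) (V : lmodType F) (U : set V).
Hypothesis subU : is_subspace U.

Lemma subspace0 : U 0. Proof. by case: subU. Qed.

Lemma subspaceZ a u : U u -> U (a *: u).
Proof. by case: subU => U0 US Uu; rewrite -[_ *: _]addr0; apply: US. Qed.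

Lemma subspaceD u v : U u -> U v -> U (u + v).
Proof. by case: subU => _ US Uu Uv; rewrite -[u]scale1r; apply: US. Qed.

Lemma subspaceN u : U u -> U (- u).
Proof. by move=> Uu; rewrite -scaleN1r; apply: subspaceZ. Qed.

Lemma subspaceB u v : U u -> U v -> U (u - v).
Proof. by move=> Uu Uv; apply: subspaceD => //; apply: subspaceN. Qed.

Lemma subspace_sum I (r : seq I) (P : pred I) (f : I -> V) :
  (forall i, P i -> U (f i)) -> U (\sum_(i <- r | P i) f i).
Proof. by move=> Uf; apply: big_ind => //; [exact: subspace0|exact: subspaceD]. Qed.

End Subspace.

Lemma subspace_zero (F : fieldType) (V : lmodType F) : is_subspace [set 0 : V].
Proof. by split=> // a u v /= -> ->; rewrite scaler0 addr0. Qed.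

Section InfiniteField.
Variable F : fieldType.
Hypothesis Finf : infinite_set [set: F].

Lemma infinite_fresh (s : seq F) : exists x, x \notin s.
Proof.
apply: contrapT => H; apply: Finf; apply: (@sub_finite_set _ _ [set` s]).
  by move=> x _ /=; apply: contrapT => /negP xs; apply: H; exists x.
exact: finite_seq.
Qed.

Lemma infinite_fresh_uniq (s : seq F) n :
  exists t : n.-tuple F, uniq t /\ forall x, x \in t -> x \notin s.
Proof.
elim: n => [|n [t [ut ts]]]; first by exists [tuple].
have [x] := infinite_fresh (s ++ t); rewrite mem_cat negb_or => /andP[xs xt].
exists (cons_tuple x t); rewrite /= xt ut; split=> // y.
by rewrite inE => /orP[/eqP -> //|/ts].
Qed.

(** Inverting the Vandermonde matrix at [n] distinct points outside [s] writes each coefficient as a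
    linear combination of values. The list [s] leaves room for the finitely many scalars c at which
    1 + c x may fail to be a unit. *)
Lemma polynomial_coef_mem (V : lmodType F) (U : set V) (s : seq F) n
    (g : nat -> V) : is_subspace U ->
  (forall x, x \notin s -> U (\sum_(d < n) x ^+ d *: g d)) ->
  forall d, (d < n)%N -> U (g d).
Proof.
move=> subU Ug d dn; have [t [ut ts]] := infinite_fresh_uniq s n.
pose M := Vandermonde n (\row_j tnth t j).
have Mu : M \in unitmx.
  rewrite unitmxE det_Vandermonde unitfE; apply/prodf_neq0 => i _.
  apply/prodf_neq0 => j ij; rewrite !mxE subr_eq0.
  by rewrite (inj_eq (tuple_uniqP _ ut)) -(inj_eq val_inj) neq_ltn ij orbT.
pose W := invmx M; pose d' := Ordinal dn.
suff -> : g d = \sum_(j < n) W j d' *: \sum_(i < n) tnth t j ^+ i *: g i.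
  apply: subspace_sum => // j _; apply: subspaceZ => //.
  by apply: Ug; apply: ts; apply: mem_tnth.
under eq_bigr do rewrite scaler_sumr.
have E (i : 'I_n) : \sum_(j < n) W j d' *: (tnth t j ^+ i *: g i) = (i == d')%:R *: g i.
  have /matrixP/(_ i d') := mulmxV Mu; rewrite !mxE => <-.
  by rewrite scaler_suml; apply: eq_bigr => j _; rewrite scalerA mulrC !mxE.
rewrite exchange_big /= (eq_bigr _ (fun i _ => E i)) (bigD1 d') //= big1 ?addr0.
  by rewrite eqxx scale1r.
by move=> i /negPf ->; rewrite scale0r.
Qed.

End InfiniteField.

Section ListPolynomials.
Variable F : fieldType.

(** Words may repeat in the list: products and brackets are then plain list operations, and only
    [nc_of_list] collects equal words. *)
Definition list_poly : Type := seq (F * seq nat).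

Definition list_eval (A : algType F) (a : nat -> A) (P : list_poly) : A :=
  \sum_(m <- P) m.1 *: \prod_(i <- m.2) a i.

Definition nc_of_list (P : list_poly) : nc_poly F :=
  [fsfun w in seq_fset tt [seq m.2 | m <- P] => \sum_(m <- P | m.2 == w) m.1].

Lemma nc_of_listE (A : algType F) (a : nat -> A) P :
  nc_eval a (nc_of_list P) = list_eval a P.
Proof.
rewrite /nc_eval /nc_of_list /list_eval.
have := @seq_fsetE tt _ [seq m.2 | m <- P]; move: (seq_fset _ _) => X XE.
set f := (X in finsupp X); have sub : (finsupp f `<=` X)%fset by apply: finsupp_sub.
rewrite (big_fset_incl _ sub); last by move=> w _ /fsfun_dflt ->; rewrite scale0r.
rewrite (eq_big_seq (fun w => \sum_(m <- P | m.2 == w) m.1 *: \prod_(i <- m.2) a i)).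
  rewrite (exchange_big_dep predT) //= big_seq [RHS]big_seq; apply: eq_bigr => m mP.
  rewrite (eq_bigl (pred1 m.2)); last by move=> w; rewrite /= eq_sym.
  by rewrite -big_filter filter_pred1_uniq ?big_seq1 ?fset_uniq // XE map_f.
move=> w wX; rewrite fsfunE wX scaler_suml; apply: eq_bigr => m /eqP <- //.
Qed.

Definition list_of_nc (f : nc_poly F) : list_poly := [seq (f w, w) | w <- finsupp f].

Lemma list_of_ncE (A : algType F) (a : nat -> A) f :
  list_eval a (list_of_nc f) = nc_eval a f.
Proof. by rewrite /list_eval big_map. Qed.

Definition lp_const (c : F) : list_poly := [:: (c, [::])].
Definition lp_var (i : nat) : list_poly := [:: (1, [:: i])].
Definition lp_scale (c : F) (P : list_poly) : list_poly := [seq (c * m.1, m.2) | m <- P].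
Definition lp_mul (P Q : list_poly) : list_poly :=
  [seq (m.1 * m'.1, m.2 ++ m'.2) | m <- P, m' <- Q].
Definition lp_exp (P : list_poly) n := iter n (lp_mul P) (lp_const 1).
Definition lp_bracket (P Q : list_poly) := lp_mul P Q ++ lp_scale (-1) (lp_mul Q P).

Variables (A : algType F) (a : nat -> A).

Lemma list_eval_const c : list_eval a (lp_const c) = c%:A.
Proof. by rewrite /list_eval big_seq1 big_nil. Qed.

Lemma list_eval_var i : list_eval a (lp_var i) = a i.
Proof. by rewrite /list_eval !big_seq1 scale1r. Qed.

Lemma list_eval_cat P Q : list_eval a (P ++ Q) = list_eval a P + list_eval a Q.
Proof. exact: big_cat. Qed.

Lemma list_eval_scale c P : list_eval a (lp_scale c P) = c *: list_eval a P.
Proof.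
by rewrite /list_eval big_map scaler_sumr; apply: eq_bigr => m _; rewrite scalerA.
Qed.

Lemma list_eval_mul P Q : list_eval a (lp_mul P Q) = list_eval a P * list_eval a Q.
Proof.
rewrite /list_eval big_allpairs_dep mulr_suml; apply: eq_bigr => m _.
rewrite mulr_sumr; apply: eq_bigr => m' _ /=.
by rewrite big_cat -scalerAl -scalerAr scalerA.
Qed.

Lemma list_eval_exp P n : list_eval a (lp_exp P n) = list_eval a P ^+ n.
Proof.
by elim: n => [|n IH] /=; rewrite ?list_eval_const ?scale1r // list_eval_mul IH exprS.
Qed.

Lemma list_eval_bracket P Q :
  list_eval a (lp_bracket P Q) = lie_bracket (list_eval a P) (list_eval a Q).
Proof.
by rewrite list_eval_cat list_eval_scale !list_eval_mul scaleN1r.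
Qed.

End ListPolynomials.

Section PolyAlgebra.
Variables (F : fieldType) (A : algType F).

(* {poly A} with scalars in F rather than in A *)
Definition apoly : Type := {poly A}.
HB.instance Definition _ := GRing.NzRing.on apoly.

Definition apoly_scale (c : F) (p : apoly) : apoly := (c%:A : A)%:P * p.

Lemma in_alg_comm_mul (c : F) (x : A) : c%:A * x = x * c%:A.
Proof. by rewrite -scalerAl -scalerAr mul1r mulr1. Qed.

Lemma apolyC_comm (c : F) (p : {poly A}) : (c%:A)%:P * p = p * (c%:A)%:P.
Proof. by apply/polyP => i; rewrite coefCM coefMC in_alg_comm_mul. Qed.

Fact apoly_scaleA c d p : apoly_scale c (apoly_scale d p) = apoly_scale (c * d) p.
Proof. by rewrite /apoly_scale mulrA -polyCM -scalerAl mul1r scalerA. Qed.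
Fact apoly_scale1 : left_id 1 apoly_scale.
Proof. by move=> p; rewrite /apoly_scale scale1r mul1r. Qed.
Fact apoly_scaleDr : right_distributive apoly_scale +%R.
Proof. by move=> c p q; rewrite /apoly_scale mulrDr. Qed.
Fact apoly_scaleDl p : {morph apoly_scale^~ p : c d / c + d}.
Proof. by move=> c d; rewrite /apoly_scale scalerDl polyCD mulrDl. Qed.
HB.instance Definition _ := GRing.Zmodule_isLmodule.Build F apoly
  apoly_scaleA apoly_scale1 apoly_scaleDr apoly_scaleDl.
Fact apoly_scaleAl c (p q : apoly) : c *: (p * q) = (c *: p) * q.
Proof. exact: mulrA. Qed.
HB.instance Definition _ := GRing.Lmodule_isLalgebra.Build F apoly apoly_scaleAl.
Fact apoly_scaleAr c (p q : apoly) : c *: (p * q) = p * (c *: q).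
Proof. by rewrite /GRing.scale /= /apoly_scale mulrA apolyC_comm -mulrA. Qed.
HB.instance Definition _ := GRing.Lalgebra_isAlgebra.Build F apoly apoly_scaleAr.

Lemma coef_apolyZ c (p : apoly) i : (c *: p)`_i = c *: p`_i.
Proof. by rewrite coefCM mulr_algl. Qed.

Lemma horner_apolyZ c (p : apoly) x : (c *: p).[x] = c *: p.[x].
Proof. by rewrite hornerCM mulr_algl. Qed.

End PolyAlgebra.

(** * Extension of identities to commuting coefficients *)

Section Vanishing.
Variables (F : fieldType) (E : algType F).
Hypothesis Finf : infinite_set [set: F].
Implicit Types (P : list_poly F) (u v : nat -> E).

Lemma horner_list_eval u v P (k : E) :
  (forall i, GRing.comm k (u i)) -> (forall i, GRing.comm k (v i)) ->
  (list_eval (fun i => (u i)%:P + (v i)%:P * 'X : apoly E) P).[k]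
  = list_eval (fun i => u i + v i * k) P.
Proof.
move=> ku kv; rewrite /list_eval horner_sum; apply: eq_bigr => m _.
rewrite horner_apolyZ; congr (_ *: _).
have kuv i : GRing.comm k (u i + v i * k).
  by apply: commrD => //; apply: commrM.
elim: m.2 => [|i w IH]; first by rewrite !big_nil hornerC.
rewrite !big_cons hornerM_comm ?IH; last first.
  rewrite /comm_poly IH.
  by elim: (w) => [|j w' IH']; rewrite ?big_nil ?big_cons; [exact: commr1|exact: commrM].
by rewrite hornerD hornerMX !hornerC.
Qed.

(** The polynomial P(u + v X) vanishes at infinitely many scalars, so it is zero and may be
    evaluated at any [k] commuting with u and v. *)
Lemma vanish_comm_extend u v P (k : E) :
  (forall i, GRing.comm k (u i)) -> (forall i, GRing.comm k (v i)) ->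
  (forall c : F, list_eval (fun i => u i + c *: v i) P = 0) ->
  list_eval (fun i => u i + v i * k) P = 0.
Proof.
move=> ku kv H; rewrite -horner_list_eval //; set p := list_eval _ _.
suff -> : p = 0 by rewrite horner0.
have pc (c : F) : p.[c%:A] = 0.
  rewrite horner_list_eval => [|i|i]; rewrite /GRing.comm ?in_alg_comm_mul //.
  by rewrite -[RHS](H c); apply: eq_bigr => m _; congr (_ *: _);
     apply: eq_bigr => i _; rewrite mulr_algr.
apply/polyP => i; rewrite coef0; have [/leq_sizeP/(_ i)->//|isz] := leqP (size p) i.
apply: (@polynomial_coef_mem F Finf E [set 0] [::] (size p) (fun i => p`_i)) => //.
  exact: subspace_zero.
move=> c _ /=; rewrite -[RHS](pc c) horner_coef; apply: eq_bigr => j _.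
by rewrite exprZn expr1n mulr_algr.
Qed.

Definition vanishes (W : set E) P := forall a : nat -> E, (forall i, W (a i)) -> list_eval a P = 0.

Definition comm_span (W K : set E) : set E :=
  [set t | exists2 l : seq (E * E), (forall x, x \in l -> W x.1 /\ K x.2) &
                               t = \sum_(x <- l) x.1 * x.2].

Variables (W K : set E).
Hypotheses (subW : is_subspace W) (KW : forall k x, K k -> W x -> GRing.comm k x)
  (KK : forall k k', K k -> K k' -> GRing.comm k k').

(** Induction frees one coefficient at a time: a scalar multiple of the last summand is absorbed
    into [w], and [vanish_comm_extend] then replaces the scalar by [k n]. *)
Lemma vanish_sums P n (s : nat -> nat -> E) (k : nat -> E) (w : nat -> E) :
  vanishes W P -> (forall i j, W (s i j)) -> (forall j, (j < n)%N -> K (k j)) ->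
  (forall i, W (w i)) ->
  list_eval (fun i => w i + \sum_(j < n) s i j * k j) P = 0.
Proof.
move=> VW Ws; elim: n w => [|n IH] w Kk Ww.
  by under eq_fun do rewrite big_ord0 addr0; apply: VW.
under eq_fun do rewrite big_ord_recr /= addrA.
have Kn := Kk n (ltnSn n).
apply: vanish_comm_extend => [i|i|c]; last 1 first.
- under eq_fun do rewrite addrAC; apply: IH => [j jn|i]; first exact/Kk/leqW.
  by apply: subspaceD => //; apply: subspaceZ.
- apply: commrD; first exact: KW.
  elim/big_ind: _ => [|x y|j _]; [exact: commr0|exact: commrD|].
  by apply: commrM; [exact: KW|apply: KK => //; apply: Kk; apply: leqW].
- exact: KW.
Qed.

Lemma vanishes_comm_span P : vanishes W P -> vanishes (comm_span W K) P.
Proof.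
move=> VW a Ta.
pose l i := s2val (cid2 (Ta i)).
have lWK i x : x \in l i -> W x.1 /\ K x.2 by exact: (s2valP (cid2 (Ta i)) x).
have aE i : a i = \sum_(x <- l i) x.1 * x.2 by exact: (s2valP' (cid2 (Ta i))).
pose N := (\max_(m <- P) \max_(i <- m.2) i.+1)%N.
have PN m i : m \in P -> i \in m.2 -> (i < N)%N.
  move=> mP im; have h : (\max_(i <- m.2) i.+1 <= N)%N := leq_bigmax_seq m mP isT.
  apply: leq_trans h; exact: (leq_bigmax_seq (F := S) i im).
(* All variables are written over one common list of coefficients: L joins the lists of the
   variables below N, and [s i j] is zero unless the j-th entry belongs to variable i. *)
pose L := [seq (i, x) | i <- iota 0 N, x <- l i].
pose d : nat * (E * E) := (0%N, (0, 0)).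
pose s i j := if (nth d L j).1 == i then (nth d L j).2.1 else 0.
rewrite -(@vanish_sums P (size L) s (fun j => (nth d L j).2.2) (fun=> 0)) //.
- rewrite /list_eval big_seq [RHS]big_seq; apply: eq_bigr => m mP; congr (_ *: _).
  rewrite big_seq [RHS]big_seq; apply: eq_bigr => i im; rewrite add0r.
  transitivity (\sum_(x <- L) (if x.1 == i then x.2.1 else 0) * x.2.2); last first.
    by rewrite (big_nth d) big_mkord.
  rewrite big_allpairs_dep /= (bigD1_seq i) ?iota_uniq ?mem_iota ?add0n ?(PN m) //=.
  rewrite aE [X in _ = _ + X]big1 ?addr0 => [|j /negPf ij].
    by apply: eq_bigr => x _; rewrite eqxx.
  by rewrite big1 // => x _; rewrite ij mul0r.
- move=> i j; rewrite /s; have [jL|jL] := ltnP j (size L); last first.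
    by rewrite nth_default // if_same; apply: subspace0.
  case: ifP => _; last exact: subspace0.
  by have /allpairsPdep[i' [x [_ /lWK[Wx _] ->]]] := mem_nth d jL.
- move=> j jL; by have /allpairsPdep[i' [x [_ /lWK[_ Kx] ->]]] := mem_nth d jL.
- by move=> _; apply: subspace0.
Qed.

End Vanishing.

(** * Non-matrix identities and irreducible algebras of operators *)

Record linear_endo (F : fieldType) (V : lmodType F) : Type := LinearEndo {
  endo_fun :> V -> V;
  endo_linear : linear endo_fun
}.

Section EndoApplication.
Variables (F : fieldType) (V : lmodType F) (f : linear_endo V).

Lemma endo_appD x y : f (x + y) = f x + f y.
Proof. by rewrite -[x in LHS]scale1r endo_linear scale1r. Qed.
Lemma endo_app0 : f 0 = 0.
Proof. by apply: (addrI (f 0)); rewrite -endo_appD !addr0. Qed.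
Lemma endo_appZ c x : f (c *: x) = c *: f x.
Proof. by rewrite -[c *: x]addr0 endo_linear endo_app0 addr0. Qed.

End EndoApplication.

(* A nonzero vector is a parameter because algType requires 1 != 0. *)
Definition endo (F : fieldType) (V : lmodType F) (e : V) (e0 : e != 0) : Type :=
  linear_endo V.

Section EndoAlgebra.
Variables (F : fieldType) (V : lmodType F) (e : V) (e0 : e != 0).
Local Notation E := (endo e0).
Implicit Types (f g h : E).

HB.instance Definition _ := gen_eqMixin E.
HB.instance Definition _ := gen_choiceMixin E.

Lemma endoP f g : (forall x, f x = g x) -> f = g.
Proof.
case: f g => f fl [g gl] /= /funext fg; subst g; congr LinearEndo; exact: Prop_irrelevance.
Qed.

Fact endo_zero_linear : linear (fun _ : V => 0 : V).
Proof. by move=> a x y; rewrite scaler0 addr0. Qed.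
Fact endo_one_linear : linear (fun x : V => x).
Proof. by []. Qed.
Fact endo_opp_linear f : linear (fun x => - f x).
Proof. by move=> a x y; rewrite (endo_linear f) opprD scalerN. Qed.
Fact endo_add_linear f g : linear (fun x => f x + g x).
Proof.
by move=> a x y; rewrite (endo_linear f) (endo_linear g) scalerDr addrACA.
Qed.
Fact endo_mul_linear f g : linear (fun x => f (g x)).
Proof. by move=> a x y; rewrite (endo_linear g) (endo_linear f). Qed.
Fact endo_scale_linear (c : F) f : linear (fun x => c *: f x).
Proof.
by move=> a x y; rewrite (endo_linear f) scalerDr !scalerA mulrC.
Qed.

Definition endo_zero : E := LinearEndo endo_zero_linear.
Definition endo_one : E := LinearEndo endo_one_linear.
Definition endo_opp f : E := LinearEndo (endo_opp_linear f).
Definition endo_add f g : E := LinearEndo (endo_add_linear f g).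
Definition endo_mul f g : E := LinearEndo (endo_mul_linear f g).
Definition endo_scale c f : E := LinearEndo (endo_scale_linear c f).

Fact endo_addA : associative endo_add.
Proof. by move=> f g h; apply: endoP => x; apply: addrA. Qed.
Fact endo_addC : commutative endo_add.
Proof. by move=> f g; apply: endoP => x; apply: addrC. Qed.
Fact endo_add0 : left_id endo_zero endo_add.
Proof. by move=> f; apply: endoP => x; apply: add0r. Qed.
Fact endo_addN : left_inverse endo_zero endo_opp endo_add.
Proof. by move=> f; apply: endoP => x; apply: addNr. Qed.
HB.instance Definition _ := GRing.isZmodule.Build E
  endo_addA endo_addC endo_add0 endo_addN.

Fact endo_mulA : associative endo_mul.
Proof. by move=> f g h; apply: endoP. Qed.
Fact endo_mul1 : left_id endo_one endo_mul.
Proof. by move=> f; apply: endoP. Qed.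
Fact endo_1mul : right_id endo_one endo_mul.
Proof. by move=> f; apply: endoP. Qed.
Fact endo_mulDl : left_distributive endo_mul +%R.
Proof. by move=> f g h; apply: endoP. Qed.
Fact endo_mulDr : right_distributive endo_mul +%R.
Proof.
by move=> f g h; apply: endoP => x; apply: endo_appD.
Qed.
Fact endo_one_neq0 : endo_one != 0.
Proof.
apply/eqP => /(congr1 (fun f : E => f e)) /= E0; by move: e0; rewrite E0 eqxx.
Qed.
HB.instance Definition _ := GRing.Zmodule_isNzRing.Build E
  endo_mulA endo_mul1 endo_1mul endo_mulDl endo_mulDr endo_one_neq0.

Fact endo_scaleA c d f : endo_scale c (endo_scale d f) = endo_scale (c * d) f.
Proof. by apply: endoP => x; apply: scalerA. Qed.
Fact endo_scale1 : left_id 1 endo_scale.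
Proof. by move=> f; apply: endoP => x; apply: scale1r. Qed.
Fact endo_scaleDr : right_distributive endo_scale +%R.
Proof. by move=> c f g; apply: endoP => x; apply: scalerDr. Qed.
Fact endo_scaleDl f : {morph endo_scale^~ f : c d / c + d}.
Proof. by move=> c d; apply: endoP => x; apply: scalerDl. Qed.
HB.instance Definition _ := GRing.Zmodule_isLmodule.Build F E
  endo_scaleA endo_scale1 endo_scaleDr endo_scaleDl.
Fact endo_scaleAl c f g : c *: (f * g) = (c *: f) * g.
Proof. by apply: endoP. Qed.
HB.instance Definition _ := GRing.Lmodule_isLalgebra.Build F E endo_scaleAl.
Fact endo_scaleAr c f g : c *: (f * g) = f * (c *: g).
Proof.
by apply: endoP => x /=; rewrite endo_appZ.
Qed.
HB.instance Definition _ := GRing.Lalgebra_isAlgebra.Build F E endo_scaleAr.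

Lemma endo_mulE f g x : (f * g) x = f (g x). Proof. by []. Qed.
Lemma endo_addE f g x : (f + g) x = f x + g x. Proof. by []. Qed.
Lemma endo_scaleE c f x : (c *: f) x = c *: f x. Proof. by []. Qed.
Lemma endo_0E x : (0 : E) x = 0. Proof. by []. Qed.
Lemma endo_1E x : (1 : E) x = x. Proof. by []. Qed.

Lemma endo_sumE I (r : seq I) (P : pred I) (f : I -> E) x :
  (\sum_(i <- r | P i) f i) x = \sum_(i <- r | P i) f i x.
Proof. by elim/big_rec2: _ => // i y1 y2 _ <-. Qed.

End EndoAlgebra.

(** * Irreducible sets of operators satisfying a non-matrix identity *)

Section Irreducible.
Variables (F : fieldType) (V : lmodType F) (e : V) (e0 : e != 0).
Hypothesis Finf : infinite_set [set: F].
Local Notation E := (endo e0).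
Variable S : set E.
Hypotheses (subS : is_subspace S) (S1 : S 1) (SM : forall s t, S s -> S t -> S (s * t)).
Hypothesis Strans : forall v w : V, v != 0 -> exists2 s, S s & s v = w.

Definition commuting_centralizer (K : set E) : Prop :=
  (forall k s, K k -> S s -> GRing.comm k s) /\
  (forall k k', K k -> K k' -> GRing.comm k k').

(** K plays the part of a maximal subfield of the division ring of endomorphisms of a simple module:
    once S is extended by K, the centralizer shrinks to K. *)
Lemma exists_max_commuting : exists2 K, commuting_centralizer K &
  forall f : E, (forall s, S s -> GRing.comm f s) ->
    (forall k, K k -> GRing.comm f k) -> K f.
Proof.
have [F' PF' totF'|K [[KS KK] Kmax]] := @Zorn_bigcup E commuting_centralizer.
  split=> [k s [X FX Xk]|k k' [X FX Xk] [Y FY Yk']].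
    by have [XS _] := PF' _ FX; apply: XS.
  have [XY|YX] := totF' _ _ FX FY.
    by have [_ YY] := PF' _ FY; apply: YY => //; apply: XY.
  by have [_ XX] := PF' _ FX; apply: XX => //; apply: YX.
exists K => // f fS fK; apply: contrapT => nKf.
apply: (Kmax (f |` K)); first split.
- by move=> k Kk; right.
- by move=> /(_ f (or_introl erefl)).
split=> [k s [->|Kk]|k k' [->|Kk] [->|Kk']] //; try by [apply: fS|apply: KS|apply: fK|apply: KK].
by apply: commr_sym; apply: fK.
Qed.

Variable K : set E.
Hypotheses (KS : forall k s, K k -> S s -> GRing.comm k s)
  (KK : forall k k', K k -> K k' -> GRing.comm k k')
  (Kmax : forall f : E, (forall s, S s -> GRing.comm f s) ->
    (forall k, K k -> GRing.comm f k) -> K f).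
Local Notation T := (comm_span S K).

Lemma max_commuting_scalar c : K c%:A.
Proof. by apply: Kmax => f _; rewrite /GRing.comm in_alg_comm_mul. Qed.

Lemma span_subspace : is_subspace T.
Proof.
split; first by exists [::]; rewrite ?big_nil.
move=> c _ _ [l lWK ->] [l' lWK' ->].
exists ([seq (c *: x.1, x.2) | x <- l] ++ l').
  move=> x; rewrite mem_cat => /orP[/mapP[y /lWK[Sy Ky] ->]|/lWK' //].
  by split=> //; apply: subspaceZ.
rewrite big_cat big_map scaler_sumr; congr (_ + _).
by apply: eq_bigr => x _; rewrite scalerAl.
Qed.

Lemma span_mulS s t : S s -> T t -> T (s * t).
Proof.
move=> Ss [l lWK ->]; exists [seq (s * x.1, x.2) | x <- l].
  by move=> x /mapP[y /lWK[Sy Ky] ->]; split=> //; apply: SM.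
by rewrite mulr_sumr big_map; apply: eq_bigr => x _; rewrite mulrA.
Qed.

Lemma span_mem s k : S s -> K k -> T (s * k).
Proof.
move=> Ss Kk; exists [:: (s, k)]; last by rewrite big_seq1.
by move=> x; rewrite inE => /eqP ->.
Qed.

Lemma span_memS s : S s -> T s.
Proof.
by move=> Ss; rewrite -[s]mulr1 -[1]scale1r; apply: span_mem => //; apply: max_commuting_scalar.
Qed.

Lemma max_commuting_span k t : K k -> T t -> GRing.comm k t.
Proof.
move=> Kk [l lWK ->]; rewrite big_seq; elim/big_ind: _.
- exact: commr0.
- exact: commrD.
- by move=> x /lWK[Sx Kx]; apply: commrM; [apply: KS|apply: KK].
Qed.

(** The annihilator condition makes t v |-> t w well defined on V = T v; this map commutes with S
    and K, so it lies in K by maximality. *)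
Lemma intertwiner v w : v != 0 ->
  (forall t, T t -> t v = 0 -> t w = 0) -> exists2 f, K f & f v = w.
Proof.
move=> v0 Tvw.
pose s x := s2val (cid2 (Strans x v0)).
have Ss x : S (s x) by rewrite /s; case: cid2.
have sv x : s x v = x by rewrite /s; case: cid2.
pose f x := s x w.
have fE t : T t -> f (t v) = t w.
  move=> Tt; apply/eqP; rewrite -subr_eq0; apply/eqP.
  rewrite -[_ - _]/((s (t v) - t) w) Tvw //; last by rewrite -[LHS]/(s (t v) v - t v) sv subrr.
  by apply: (subspaceB span_subspace) => //; apply: span_memS.
have flin : linear f.
  move=> a x y; rewrite -{1}(sv x) -{1}(sv y).
  rewrite -[a *: s x v + _]/((a *: s x + s y) v) fE //.
  by apply: span_memS; case: subS => _; apply.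
pose g : E := LinearEndo flin.
exists g; last first.
  rewrite -[RHS]/((1 : E) w) -fE; first by [].
  exact: span_memS.
apply: Kmax => [t St|k Kk]; apply: endoP => x; rewrite !endo_mulE /= -{1}(sv x).
  by rewrite -[t (s x v)]/((t * s x) v) fE //; apply: span_memS; apply: SM.
rewrite -[k (s x v)]/((k * s x) v) fE // (KS Kk (Ss x)).
by apply: span_mem.
Qed.

(** Were v2 outside K v1, [intertwiner] would give elements of T separating v1 from v2, hence a copy
    of all 2 x 2 matrices on their F-span, where P takes the nonzero value P(a). *)
Lemma one_dimensional (P : list_poly F) (a : nat -> 'M[F]_2) v1 v2 :
  vanishes S P -> list_eval a P != 0 -> v1 != 0 -> exists2 k, K k & v2 = k v1.
Proof.
move=> VS Pa v1n; apply: contrapT => nK.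
have v2n : v2 != 0.
  apply/eqP => v2E; apply: nK; exists (0 : E); last by rewrite v2E.
  by rewrite -(scale0r 1); apply: max_commuting_scalar.
have [t1 Tt1 [t10 t1n]] : exists2 t, T t & t v1 = 0 /\ t v2 != 0.
  apply: contrapT => H; have [t Tt tv1|f Kf fv] := @intertwiner v1 v2 v1n.
    by apply: contrapT => /eqP tv2; apply: H; exists t.
  by apply: nK; exists f.
(* Otherwise some f in K sends v2 to v1; as f commutes with s t1 and s t1 v2 = v2, this gives v1 = s
   t1 v1 = 0. *)
have [t2 Tt2 [t20 t2n]] : exists2 t, T t & t v2 = 0 /\ t v1 != 0.
  apply: contrapT => H; have [t Tt tv1|f Kf fv] := @intertwiner v2 v1 v2n.
    by apply: contrapT => /eqP tv2; apply: H; exists t.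
  have [s Ss sE] := @Strans (t1 v2) v2 t1n.
  move: v1n; rewrite -fv -sE -[f _]/((f * (s * t1)) v2).
  rewrite (max_commuting_span Kf (span_mulS Ss Tt1)) -[_ v2]/(s (t1 (f v2))) fv t10.
  by rewrite endo_app0 eqxx.
have pick t v w u : T t -> t w = 0 -> t v != 0 -> exists2 r, T r & r v = u /\ r w = 0.
  move=> Tt tw tv; have [s Ss sE] := @Strans (t v) u tv.
  by exists (s * t); [exact: span_mulS|rewrite !endo_mulE sE tw endo_app0].
have [a1 Ta1 [a11 a12]] := pick _ _ _ v1 Tt2 t20 t2n.
have [a2 Ta2 [a21 a22]] := pick _ _ _ v2 Tt2 t20 t2n.
have [b1 Tb1 [b12 b11]] := pick _ _ _ v1 Tt1 t10 t1n.
have [b2 Tb2 [b22 b21]] := pick _ _ _ v2 Tt1 t10 t1n.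
(* On the span of v1 and v2 the operators a1, a2, b1, b2 are the four matrix units, so [tau X] acts
   there as X. *)
pose tau (X : 'M[F]_2) : E := X 0 0 *: a1 + X 1 0 *: a2 + (X 0 1 *: b1 + X 1 1 *: b2).
have Ttau X : T (tau X).
  by have sT := span_subspace; do 2?apply: subspaceD => //; apply: subspaceZ.
pose vec (c : 'cV[F]_2) := c 0 0 *: v1 + c 1 0 *: v2.
have tauE X c : tau X (vec c) = vec (X *m c).
  rewrite /tau !endo_addE !endo_scaleE /vec !endo_appD !endo_appZ a11 a12 a21 a22 b11 b12 b21 b22.
  rewrite !scaler0 !addr0 !add0r !mxE !big_ord_recl !big_ord0 !addr0 !scalerDl !scalerA.
  rewrite (_ : lift ord0 ord0 = 1); last exact: val_inj.
  exact: addrACA.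
have vec_sum I (r : seq I) (c : I -> 'cV[F]_2) : vec (\sum_(i <- r) c i) = \sum_(i <- r) vec (c i).
  elim/big_rec2: _ => [|i y1 y2 _ <-]; first by rewrite /vec !mxE !scale0r addr0.
  by rewrite /vec !mxE !scalerDl addrACA.
have evalE c : list_eval (fun i => tau (a i)) P (vec c) = vec (list_eval a P *m c).
  rewrite /list_eval endo_sumE mulmx_suml vec_sum; apply: eq_bigr => m _.
  rewrite endo_scaleE -scalemxAl.
  have vecZ b d : vec (b *: d) = b *: vec d by rewrite /vec !mxE scalerDr !scalerA.
  rewrite vecZ; congr (_ *: _); elim: m.2 c => [|i w IH] c.
    by rewrite !big_nil mul1mx.
  by rewrite !big_cons endo_mulE IH tauE mulmxA.
have vec_inj c : vec c = 0 -> c = 0.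
  rewrite /vec => c0.
  have c10 : c 1 0 = 0.
    apply: contrapT => /eqP c1; apply: nK.
    exists ((- (c 1 0)^-1 * c 0 0)%:A); first exact: max_commuting_scalar.
    rewrite endo_scaleE endo_1E -scalerA scaleNr.
    move/eqP: c0; rewrite addrC addr_eq0 => /eqP c0.
    by rewrite -scalerN -c0 scalerA mulVf // scale1r.
  move: c0; rewrite c10 scale0r addr0 => /eqP; rewrite scaler_eq0 (negPf v1n) orbF => /eqP c00.
  apply/matrixP => i j; rewrite !mxE (ord1 j).
  by case: (unliftP 0 i) => [i'|] -> //; rewrite (ord1 i') -c10; congr (c _ _); apply: val_inj.
case/eqP: Pa; apply/matrixP => i j; rewrite mxE.
have /colP/(_ i) : list_eval a P *m delta_mx j 0 = 0 :> 'cV_2.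
  apply: vec_inj; rewrite -evalE (@vanishes_comm_span F E Finf S K) //.
by rewrite -colE !mxE.
Qed.

End Irreducible.

(** On each vector, s and t act as elements of a commutative set K that commutes with both. *)
Theorem irreducible_commute (F : fieldType) (V : lmodType F) (e : V) (e0 : e != 0)
    (S : set (endo e0)) (P : list_poly F) (a : nat -> 'M[F]_2) :
  infinite_set [set: F] -> is_subspace S -> S 1 ->
  (forall s t, S s -> S t -> S (s * t)) ->
  (forall v w : V, v != 0 -> exists2 s, S s & s v = w) ->
  vanishes S P -> list_eval a P != 0 ->
  forall s t, S s -> S t -> s * t = t * s.
Proof.
move=> Finf subS S1 SM Strans VS Pa s t Ss St.
have [K [KS KK] Kmax] := exists_max_commuting S.
apply: endoP => v; have [->|v0] := eqVneq v 0; first by rewrite !endo_app0.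
have kE w := one_dimensional Finf subS S1 SM Strans KS KK Kmax w VS Pa v0.
have [k Kk sv] := kE (s v); have [k' Kk' tv] := kE (t v).
have ks := KS _ _ Kk' Ss; have kt := KS _ _ Kk St.
rewrite !endo_mulE sv tv -[RHS]/((t * k) v) -[LHS]/((s * k') v).
rewrite -ks -kt !endo_mulE sv tv -[LHS]/((k' * k) v) -[RHS]/((k * k') v).
by rewrite (KK _ _ Kk Kk').
Qed.

(** * Nilpotency of commutators and the prime radical *)

Lemma Zorn_nonempty_chain (T : Type) (Q : set (set T)) (L0 : set T) : Q L0 ->
  (forall C : set (set T), C `<=` Q -> total_on C subset -> C !=set0 ->
     Q (\bigcup_(X in C) X)) ->
  exists2 M, Q M & forall N, M `<=` N -> Q N -> N `<=` M.
Proof.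
move=> Q0 chain.
have [C CQ Ct|M [QM Mmax]] := @Zorn_bigcup T (fun X => X = set0 \/ Q X).
  pose C' := [set X | C X /\ Q X].
  have [[X C'X]|C'0] := pselect (C' !=set0); last first.
    left; apply/seteqP; split=> // x [X CX Xx]; case: (CQ _ CX) => [X0|QX].
      by rewrite X0 in Xx.
    by case: C'0; exists X.
  right; rewrite (_ : \bigcup_(X in C) X = \bigcup_(X in C') X).
    apply: chain; [by move=> Y []| |by exists X].
    by move=> Y Z [CY _] [CZ _]; apply: Ct.
  apply/seteqP; split=> x [Y CY Yx]; last by exists Y => //; case: CY.
  exists Y => //; split=> //; case: (CQ _ CY) => // Y0; by rewrite Y0 in Yx.
case: QM => [M0|QM].
  have [[x Lx]|L00] := pselect (L0 !=set0).
    case: (Mmax L0); last by right.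
    by rewrite M0; split=> [//|/(_ _ Lx)].
  exists M; first by rewrite M0 -(_ : L0 = set0) //; apply/eqP; rewrite -[_ == _]negbK; apply/negP => /set0P.
  move=> N MN QN x Nx; case: (Mmax N); last by right.
  by rewrite M0; split=> [//|/(_ _ Nx)].
exists M => // N MN QN x Nx; apply: contrapT => Mx; case: (Mmax N); last by right.
by split=> // /(_ _ Nx).
Qed.

Section QuotientSpace.
Local Open Scope quotient_scope.
Variables (F : fieldType) (V : lmodType F) (U : set V) (subU : is_subspace U).

Definition subspace_pred of is_subspace U : {pred V} := fun x => `[< U x >].

Fact subspace_pred_zmod_closed : zmod_closed (subspace_pred subU).
Proof.
split=> [|x y /asboolP Ux /asboolP Uy]; apply/asboolP; first exact: subspace0.
exact: subspaceB.
Qed.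
HB.instance Definition _ :=
  GRing.isZmodClosed.Build V (subspace_pred subU) subspace_pred_zmod_closed.

Definition quotient_space : Type := Quotient.quot (subspace_pred subU).
HB.instance Definition _ := GRing.Zmodule.on quotient_space.
HB.instance Definition _ := EqQuotient.on quotient_space.
Local Notation Q := quotient_space.

Lemma quotient_space_eq x y : \pi_Q x = \pi_Q y <-> U (x - y).
Proof.
split=> [/eqP|Uxy]; last apply/eqP.
  by rewrite -Quotient.idealrBE => /asboolP.
by rewrite -Quotient.idealrBE; apply/asboolP.
Qed.

Lemma quotient_spaceD x y : \pi_Q (x + y) = \pi_Q x + \pi_Q y.
Proof. exact: Quotient.pi_add. Qed.

Lemma quotient_space_eq0 x : \pi_Q x = 0 <-> U x.
Proof.
have <- : \pi_Q 0 = 0 by apply: (addrI (\pi_Q 0)); rewrite -quotient_spaceD !addr0.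
by rewrite quotient_space_eq subr0.
Qed.

Definition quotient_map (f : V -> V) (q : Q) : Q := \pi_Q (f (generic_quotient.repr q)).

Lemma quotient_mapE (f : V -> V) x : {morph f : x y / x - y} ->
  (forall x, U x -> U (f x)) -> quotient_map f (\pi_Q x) = \pi_Q (f x).
Proof.
move=> fB Uf; apply/quotient_space_eq; rewrite -fB; apply: Uf.
by apply/quotient_space_eq; rewrite reprK.
Qed.

Definition quotient_scale c := quotient_map ( *:%R c).

Lemma quotient_scaleE c x : quotient_scale c (\pi_Q x) = \pi_Q (c *: x).
Proof.
by apply: quotient_mapE => [y z|y Uy]; [exact: scalerBr|exact: subspaceZ].
Qed.

Fact quotient_scaleA c d q : quotient_scale c (quotient_scale d q) = quotient_scale (c * d) q.
Proof. by rewrite -[q]reprK (quotient_scaleE d) !quotient_scaleE scalerA. Qed.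
Fact quotient_scale1 : left_id 1 quotient_scale.
Proof. by move=> q; rewrite -[q]reprK !quotient_scaleE scale1r. Qed.
Fact quotient_scaleDr : right_distributive quotient_scale +%R.
Proof.
move=> c q r; rewrite -[q]reprK -[r]reprK -quotient_spaceD !quotient_scaleE.
by rewrite scalerDr quotient_spaceD.
Qed.
Fact quotient_scaleDl q : {morph quotient_scale^~ q : c d / c + d}.
Proof.
move=> c d; rewrite -[q]reprK !quotient_scaleE -quotient_spaceD.
by rewrite scalerDl.
Qed.
HB.instance Definition _ := GRing.Zmodule_isLmodule.Build F Q
  quotient_scaleA quotient_scale1 quotient_scaleDr quotient_scaleDl.

Lemma quotient_spaceZ c x : \pi_Q (c *: x) = c *: \pi_Q x.
Proof. by rewrite -quotient_scaleE. Qed.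

Lemma quotient_map_linear (f : V -> V) : linear f ->
  (forall x, U x -> U (f x)) -> linear (quotient_map f : Q -> Q).
Proof.
move=> flin Uf c q r; have fB : {morph f : x y / x - y}.
  by move=> x y; rewrite -scaleN1r addrC flin scaleN1r addrC.
rewrite -[q]reprK -[r]reprK -quotient_spaceZ -quotient_spaceD !quotient_mapE //.
by rewrite flin quotient_spaceD quotient_spaceZ.
Qed.

End QuotientSpace.

(** * Nilpotency of [x,y] z through simple modules over the polynomial ring *)

Section Nil.
Local Open Scope quotient_scope.
Variables (F : fieldType) (R : algType F).
Hypothesis Finf : infinite_set [set: F].
Variables (P : list_poly F) (a : nat -> 'M[F]_2).
Hypotheses (RP : forall b : nat -> R, list_eval b P = 0) (Pa : list_eval a P != 0).
Local Notation S := (apoly R).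

Definition left_ideal (L : set S) := is_subspace L /\ forall s x, L x -> L (s * x).

(** S / L is a simple module. The operators of R[X] on it are those of R extended by the powers of
    the central X, so they satisfy P as well; hence x and y commute on S / L, and in particular on
    the class of [p]. *)
Lemma commutator_mul_mem (L : set S) (x y : R) (p : S) : left_ideal L -> ~ L 1 ->
  (forall N, L `<=` N -> left_ideal N -> ~ N 1 -> N `<=` L) ->
  L ((lie_bracket x y)%:P * p).
Proof.
move=> [subL Lmul] L1 Lmax.
pose V := quotient_space subL.
have e0 : \pi_V 1 != 0.
  by apply/eqP => /quotient_space_eq0.
have mlin (s : S) : linear (quotient_map (fun t : S => s * t) : V -> V).
  apply: quotient_map_linear => [c t u|t]; last exact: Lmul.
  by rewrite mulrDr scalerAr.
pose m (s : S) : endo e0 := LinearEndo (mlin s).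
have mE s t : m s (\pi_V t) = \pi_V (s * t).
  by apply: quotient_mapE => [u v|u]; [exact: mulrBr|exact: Lmul].
have mext (f g : endo e0) : (forall t, f (\pi_V t) = g (\pi_V t)) -> f = g.
  by move=> fg; apply: endoP => q; rewrite -[q]reprK.
have mD s t : m (s + t) = m s + m t.
  by apply: mext => u; rewrite endo_addE !mE mulrDl quotient_spaceD.
have mM s t : m (s * t) = m s * m t.
  by apply: mext => u; rewrite endo_mulE !mE mulrA.
have mZ c s : m (c *: s) = c *: m s.
  by apply: mext => u; rewrite endo_scaleE !mE -scalerAl quotient_spaceZ.
have m1 : m 1 = 1 by apply: mext => u; rewrite mE mul1r.
have m0 : m 0 = 0 by rewrite -(scale0r 1) mZ scale0r.
have msum I (r : seq I) (f : I -> S) : m (\sum_(i <- r) f i) = \sum_(i <- r) m (f i).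
  by elim/big_rec2: _ => // i y1 y2 _ <-.
pose W : set (endo e0) := [set m (r%:P : S) | r in [set: R]].
pose K : set (endo e0) := [set m ('X^j : S) | j in [set: nat]].
have subW : is_subspace W.
  split; first by exists 0; rewrite // polyC0 m0.
  move=> c _ _ [r _ <-] [s _ <-]; exists (c *: r + s) => //.
  rewrite polyCD mD -mZ; congr (_ + _); apply: congr1; apply/polyP => i.
  by rewrite coef_apolyZ !coefC; case: ifP; rewrite ?scaler0.
have mXC r j : m (r%:P : S) * m ('X^j : S) = m ('X^j : S) * m (r%:P : S).
  by rewrite -!mM; congr m; apply/polyP => i; rewrite coefMXn coefXnM.
have VW : vanishes W P.
  move=> b Wb; pose r i := s2val (cid2 (Wb i)).
  have bE i : b i = m ((r i)%:P : S) by rewrite /r; case: cid2.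
  have <- : m ((list_eval r P)%:P : S) = list_eval b P.
    rewrite /list_eval rmorph_sum msum; apply: eq_bigr => n _.
    rewrite -[X in m X]/((n.1 *: \prod_(i <- n.2) r i)%:P).
    rewrite (_ : (n.1 *: \prod_(i <- n.2) r i)%:P = n.1 *: ((\prod_(i <- n.2) r i)%:P : S)).
      rewrite mZ; congr (_ *: _); rewrite rmorph_prod.
      by elim: n.2 => [|i w IH]; rewrite ?big_nil ?m1 // !big_cons mM IH bE.
    by apply/polyP => i; rewrite coef_apolyZ !coefC; case: ifP; rewrite ?scaler0.
  by rewrite RP polyC0 m0.
pose SS : set (endo e0) := [set m s | s in [set: S]].
have VS : vanishes SS P.
  have := @vanishes_comm_span F _ Finf W K subW _ _ P VW.
  move=> h b SSb; apply: h => [k z|k k'|i].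
  - by move=> [j _ <-] [r _ <-]; rewrite /GRing.comm mXC.
  - by move=> [j _ <-] [j' _ <-]; rewrite /GRing.comm -!mM -!exprD addnC.
  have [s _ <-] := SSb i; exists [seq (m ((s`_j)%:P : S), m ('X^j : S)) | j <- iota 0 (size s)].
    by move=> z /mapP[j _ ->]; split; [exists s`_j|exists j].
  rewrite big_map -{1}(coefK s) poly_def.
  have -> : iota 0 (size s) = index_iota 0 (size s) by rewrite /index_iota subn0.
  rewrite big_mkord.
  rewrite msum; apply: eq_bigr => j _; rewrite -mM; congr m.
  by rewrite -mul_polyC.
have : m (x%:P : S) * m (y%:P : S) = m (y%:P : S) * m (x%:P : S).
  apply: (irreducible_commute Finf (S := SS) _ _ _ _ VS Pa); try by [exists x%:P|exists y%:P].
  - split; first by exists 0.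
    by move=> c _ _ [s _ <-] [t _ <-]; exists (c *: s + t); rewrite // mD mZ.
  - by exists 1.
  - by move=> _ _ [s _ <-] [t _ <-]; exists (s * t); rewrite // mM.
  move=> v w; rewrite -[v]reprK -[w]reprK; move: (generic_quotient.repr v) (generic_quotient.repr w) => {v w} v w v0.
  have Lv : ~ L v.
    by move=> Lv; case/eqP: v0; apply/quotient_space_eq0.
  (* L + S v strictly contains L, so it contains 1: this is transitivity on the nonzero vectors of S
     / L. *)
  pose N : set S := [set t | exists2 l, L l & exists s, t = l + s * v].
  have LN : L `<=` N by move=> l Ll; exists l; last by exists 0; rewrite mul0r addr0.
  have LIN : left_ideal N.
    split; first split; first by apply: LN; apply: (subspace0 subL).
      move=> c _ _ [l Ll [s ->]] [l' Ll' [s' ->]].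
      exists (c *: l + l'); first by have [_ h] := subL; apply: h.
      by exists (c *: s + s'); rewrite scalerDr mulrDl scalerAl addrACA.
    move=> t _ [l Ll [s ->]]; exists (t * l); first exact: Lmul.
    by exists (t * s); rewrite mulrDr mulrA.
  have [N1|N1] := pselect (N 1); last first.
    case: Lv; apply: (Lmax N) => //; exists 0; first exact: (subspace0 subL).
    by exists 1; rewrite mul1r add0r.
  have [l Ll [s E1]] := N1.
  exists (m (w * s)); first by exists (w * s).
  rewrite mE; apply/quotient_space_eq; rewrite -mulrA.
  have -> : s * v = 1 - l by rewrite E1 addrAC subrr add0r.
  rewrite mulrBr mulr1 addrAC subrr add0r; apply: subspaceN => //; exact: Lmul.
move/(congr1 (fun f : endo e0 => f (\pi_V p))); rewrite -!mM !mE => /quotient_space_eq.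
by rewrite -mulrBl -!polyCM -polyCB.
Qed.

(** A maximal left ideal containing 1 - c X, with c = [x,y] z, would contain c X by
    [commutator_mul_mem], hence 1. So 1 - c X has a left inverse in R[X]; its coefficients are the
    powers of c, and these are eventually zero. *)
Theorem commutator_mul_nilpotent (x y z : R) : exists n, (lie_bracket x y * z) ^+ n = 0.
Proof.
apply: contrapT => nil; set c := lie_bracket x y * z in nil.
pose q : S := 1 - c%:P * 'X.
pose Q (L : set S) := [/\ left_ideal L, L q & ~ L 1].
pose L0 : set S := [set s * q | s in [set: S]].
have [||L [LI Lq L1] Lmax] := @Zorn_nonempty_chain S Q L0.
- split; last 2 first.
  + by exists 1; rewrite // mul1r.
  + move=> [s _ sq]; apply: nil; exists (size s).
    have sE j : s`_j = c ^+ j.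
      move/polyP: sq => sq; elim: j => [|j IH].
        by have := sq 0%N; rewrite mulrBr mulr1 mulrA coefB coefMX coef1 /= subr0.
      have := sq j.+1; rewrite mulrBr mulr1 mulrA coefB coefMX coefMC coef1 /= IH.
      by move/eqP; rewrite subr_eq0 exprSr => /eqP.
    by rewrite -sE nth_default.
  split; first split; first by exists 0; rewrite // mul0r.
    move=> d _ _ [s _ <-] [t _ <-]; exists (d *: s + t) => //.
    by rewrite mulrDl scalerAl.
  by move=> t _ [s _ <-]; exists (t * s); rewrite // mulrA.
- move=> C CQ Ct [X0 CX0]; split; last 2 first.
  + by exists X0 => //; case: (CQ _ CX0).
  + by move=> [X CX X1]; case: (CQ _ CX).
  split; first split.
  + by exists X0 => //; case: (CQ _ CX0) => -[/subspace0].
  + move=> d u v [X CX Xu] [Y CY Yv]; have [XY|YX] := Ct _ _ CX CY.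
      exists Y => //; have [[[_ sY] _] _ _] := CQ _ CY; apply: sY => //; exact: XY.
    by exists X => //; have [[[_ sX] _] _ _] := CQ _ CX; apply: sX => //; apply: YX.
  + move=> s u [X CX Xu]; exists X => //; have [[_ sX] _ _] := CQ _ CX; exact: sX.
have := @commutator_mul_mem L x y (z%:P * 'X) LI L1.
rewrite mulrA -polyCM => h; apply: L1.
rewrite -[1](subrK (c%:P * 'X : S)) -/q.
have [subL _] := LI; apply: subspaceD => //; apply: h => N LN LIN N1.
by apply: Lmax => //; split=> //; apply: LN.
Qed.

End Nil.

Section SequenceAlgebra.
Variables (F : fieldType) (A : algType F).

Definition seq_alg : Type := nat -> A.
HB.instance Definition _ := GRing.Lmodule.copy seq_alg (nat -> A).
HB.instance Definition _ := GRing.NzRing.copy seq_alg (nat -> A).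
Fact seq_alg_scaleAl c (f g : seq_alg) : c *: (f * g) = (c *: f) * g.
Proof. by apply/funext => n; apply: scalerAl. Qed.
HB.instance Definition _ := GRing.Lmodule_isLalgebra.Build F seq_alg seq_alg_scaleAl.
Fact seq_alg_scaleAr c (f g : seq_alg) : c *: (f * g) = f * (c *: g).
Proof. by apply/funext => n; apply: scalerAr. Qed.
HB.instance Definition _ := GRing.Lalgebra_isAlgebra.Build F seq_alg seq_alg_scaleAr.

Lemma list_eval_seq_alg (b : nat -> seq_alg) P n :
  list_eval b P n = list_eval (fun i => b i n) P.
Proof.
rewrite /list_eval; elim: P => [|m P IH]; rewrite ?big_nil // !big_cons.
rewrite -[LHS]/((m.1 *: \prod_(i <- m.2) b i : seq_alg) n + _) IH; congr (_ + _).
rewrite -[LHS]/(m.1 *: (\prod_(i <- m.2) b i : seq_alg) n); congr (_ *: _).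
elim: m.2 => [|i w IHw]; first by rewrite !big_nil.
by rewrite !big_cons -IHw.
Qed.

Lemma seq_alg_exp (f : seq_alg) k n : (f ^+ k) n = f n ^+ k.
Proof. by elim: k => // k IH; rewrite !exprS -IH. Qed.

End SequenceAlgebra.

Definition nil_commutators (F : fieldType) (A : algType F) (m : nat) : Prop :=
  forall x y z : A, (lie_bracket x y * z) ^+ m = 0.

(* Triples with unbounded exponents would give a non-nilpotent element of the algebra of
   sequences, which satisfies the same identities. *)
Theorem nonmatrix_nil_commutators (F : fieldType) (A : algType F) :
  infinite_set [set: F] -> satisfies_nonmatrix_identity A -> exists m, nil_commutators A m.
Proof.
move=> Finf [f fM fA]; apply: contrapT => H.
have ex m : exists x : A * A * A, (lie_bracket x.1.1 x.1.2 * x.2) ^+ m != 0.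
  apply: contrapT => h; apply: H; exists m => x y z; apply: contrapT => /eqP xyz.
  by apply: h; exists (x, y, z).
have [x xP] := choice ex.
have [a fa] : exists a : nat -> 'M[F]_2, list_eval a (list_of_nc f) != 0.
  apply: contrapT => h; apply: fM => a; apply: contrapT => /eqP fa.
  by apply: h; exists a; rewrite list_of_ncE.
have fR (b : nat -> seq_alg A) : list_eval b (list_of_nc f) = 0.
  by apply/funext => n; rewrite list_eval_seq_alg list_of_ncE fA.
have [n cn] := commutator_mul_nilpotent Finf fR fa
  (fun m => (x m).1.1) (fun m => (x m).1.2) (fun m => (x m).2).
have /eqP := xP n; apply.
by move/(congr1 (fun g : seq_alg A => g n)): cn; rewrite seq_alg_exp.
Qed.

(** * Prime ideals avoiding the powers of a finite set *)

Section PrimeIdeals.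
Variable R : nzRingType.

Lemma ideal0 (I : set R) : is_ideal I -> I 0. Proof. by case. Qed.
Lemma idealB (I : set R) x y : is_ideal I -> I x -> I y -> I (x - y).
Proof. by case=> _ + _; apply. Qed.
Lemma idealN (I : set R) x : is_ideal I -> I x -> I (- x).
Proof. by move=> II Ix; rewrite -sub0r; apply: idealB => //; apply: ideal0. Qed.
Lemma idealD (I : set R) x y : is_ideal I -> I x -> I y -> I (x + y).
Proof. by move=> II Ix Iy; rewrite -[y]opprK; apply: idealB => //; apply: idealN. Qed.
Lemma ideal_mull (I : set R) a x : is_ideal I -> I x -> I (a * x).
Proof. by case=> _ _ h Ix; case: (h a x Ix). Qed.
Lemma ideal_mulr (I : set R) a x : is_ideal I -> I x -> I (x * a).
Proof. by case=> _ _ h Ix; case: (h a x Ix). Qed.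
Lemma ideal_smallest (X : set R) : is_ideal (smallest (@is_ideal R) X).
Proof.
split=> [I [II _]|x y Ix Iy I [II XI]|a x Ix]; first exact: ideal0.
  by apply: idealB => //; [apply: Ix|apply: Iy].
by split=> I [II XI]; [apply: ideal_mull|apply: ideal_mulr] => //; apply: Ix.
Qed.

(** The condition spreads from w to the ideal I generated by w, first in the left factor and then in
    the right one, so that I I lies in P. *)
Lemma prime_ideal_semiprime (P : set R) w : is_prime_ideal P ->
  (forall b, P (w * b * w)) -> P w.
Proof.
move=> [PI _ Pprime] Pw; set I := smallest (@is_ideal R) [set w].
have II : is_ideal I by apply: ideal_smallest.
have Iw : I w by move=> J [_]; apply.
have left_mem x : I x -> forall b, P (x * b * w).
  move/(_ [set x | forall b, P (x * b * w)]); apply; split=> [|_ -> //].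
  split=> [b|y z Py Pz b|a y Py]; first by rewrite !mul0r; apply: ideal0.
    by rewrite !mulrBl; apply: idealB.
  split=> b; last by rewrite -(mulrA y).
  by rewrite -!mulrA; apply: ideal_mull => //; rewrite mulrA.
have IIP x y : I x -> I y -> P (x * y).
  move=> Ix Iy; rewrite -[x]mulr1.
  apply: (Iy [set y | forall b, P (x * b * y)] _ 1); split=> [|_ -> b]; last exact: left_mem.
  split=> [b|z z' Py Pz b|a z Pz]; first by rewrite mulr0; apply: ideal0.
    by rewrite mulrBr; apply: idealB.
  by split=> b; [rewrite mulrA -(mulrA x)|rewrite mulrA; apply: ideal_mulr].
by case: (Pprime I I) => // IP; apply: IP.
Qed.

Definition seq_product_in (X : seq R) (P : set R) (n : nat) : Prop :=
  forall w : seq R, all (mem X) w -> size w = n -> P (\prod_(x <- w) x).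

(** Let X^n be the set of products of n entries of X. An ideal P maximal among those containing no
    X^n is prime: P + I and P + J contain some X^n1 and X^n2, and their product lies in P when I J
    does. Unions of chains stay admissible because X^n is finite. *)
Lemma prime_ideal_avoiding (X : seq R) (P0 : set R) : is_ideal P0 ->
  (forall n, ~ seq_product_in X P0 n) ->
  exists2 P, is_prime_ideal P & forall n, ~ seq_product_in X P n.
Proof.
move=> P0I XP0; pose Q (P : set R) := is_ideal P /\ forall n, ~ seq_product_in X P n.
have words n : exists L : seq (seq R), forall w, (w \in L) = all (mem X) w && (size w == n).
  elim: n => [|n [L LP]]; first by exists [:: [::]] => w; rewrite inE; case: w => [|? ?]; rewrite ?andbF.
  exists [seq x :: w | x <- X, w <- L] => -[|x w] /=.
    by apply/negP => /allpairsP[[? ?] []].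
  rewrite eqSS -andbA -LP; apply/allpairsP/andP => [[[y v] /= [yX vL [-> ->]]]//|[xX wL]].
  by exists (x, w).
have [||P [PI XP] Pmax] := @Zorn_nonempty_chain R Q P0; first by split.
- move=> C CQ Ct [Y0 CY0]; split; last first.
  + move=> n Xn; have [L LP] := words n.
    suff [Y CY Yn] : exists2 Y, C Y & forall w, w \in L -> Y (\prod_(x <- w) x).
      have [_ /(_ n)] := CQ _ CY; apply=> w wX /eqP wn; apply: Yn.
      by rewrite LP wX.
    have {Xn} : forall w, w \in L -> (\bigcup_(Y in C) Y) (\prod_(x <- w) x).
      by move=> w; rewrite LP => /andP[wX /eqP]; apply: Xn.
    elim: L {LP} => [|w L IH] Lw; first by exists Y0.
    have [|Y CY YL] := IH; first by move=> v vL; apply: Lw; rewrite inE vL orbT.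
    have [Z CZ Zw] := Lw w (mem_head _ _).
    have [YZ|ZY] := Ct _ _ CY CZ.
      by exists Z => // v; rewrite inE => /orP[/eqP -> //|/YL/YZ].
    by exists Y => // v; rewrite inE => /orP[/eqP -> //|/YL//]; apply: ZY.
  + split=> [|x y [Y CY Yx] [Z CZ Zy]|a x [Y CY Yx]].
    * by exists Y0 => //; case: (CQ _ CY0) => /ideal0.
    * have [YZ|ZY] := Ct _ _ CY CZ; [exists Z|exists Y] => //.
        by apply: idealB => //; [case: (CQ _ CZ)|apply: YZ].
      by apply: idealB => //; [case: (CQ _ CY)|apply: ZY].
    * by split; exists Y => //; [apply: ideal_mull|apply: ideal_mulr] => //; case: (CQ _ CY).
exists P => //; split=> //.
  by apply/eqP => PT; apply: (XP 0%N) => w _ _; rewrite PT.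
move=> I J II JI IJP; apply: contrapT => /not_orP[IP JP].
have escape K : is_ideal K -> ~ K `<=` P ->
    exists n, seq_product_in X [set x | exists2 y, P y & exists2 k, K k & x = y + k] n.
  move=> KI KP; apply: contrapT => nK; apply: KP.
  set M := [set x | _] in nK.
  have MP : M `<=` P; last first.
    move=> k Kk; apply: MP; exists 0; first exact: ideal0.
    by exists k; rewrite // add0r.
  apply: Pmax.
    by move=> x Px; exists x => //; exists 0; [exact: ideal0|rewrite addr0].
  split; last by move=> n Mn; apply: nK; exists n.
  split=> [|_ _ [y Py [k Kk ->]] [y' Py' [k' Kk' ->]]|a _ [y Py [k Kk ->]]].
  - by exists 0; [exact: ideal0|exists 0; [exact: ideal0|rewrite addr0]].
  - exists (y - y'); first exact: idealB.
    by exists (k - k'); [exact: idealB|rewrite opprD addrACA].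
  - split; [exists (a * y); first exact: ideal_mull|exists (y * a); first exact: ideal_mulr].
      by exists (a * k); [exact: ideal_mull|rewrite mulrDr].
    by exists (k * a); [exact: ideal_mulr|rewrite mulrDl].
have [n1 X1] := escape I II IP; have [n2 X2] := escape J JI JP.
apply: (XP (n1 + n2)%N) => w wX sw.
rewrite -(cat_take_drop n1 w) big_cat /=.
have [||y Py [k Ik ->]] := X1 (take n1 w).
- by apply/allP => x /mem_take; apply/allP.
- by rewrite size_takel // sw leq_addr.
have [||y' Py' [k' Jk' ->]] := X2 (drop n1 w).
- by apply/allP => x /mem_drop; apply/allP.
- by rewrite size_drop sw addKn.
rewrite mulrDl; apply: idealD => //; first exact: ideal_mulr.
by rewrite mulrDr; apply: idealD => //; [exact: ideal_mull|exact: IJP].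
Qed.

(** Otherwise some prime ideal contains no set of words of fixed length in X, although it contains X
    itself. *)
Lemma prime_radical_product (X : seq R) : (forall x, x \in X -> prime_radical R x) ->
  exists n, seq_product_in X [set 0] n.
Proof.
move=> XB; apply: contrapT => nX.
have [||P Pprime XP] := @prime_ideal_avoiding X [set 0].
- split=> [//|x y /= -> ->|a x /= ->]; first by rewrite subrr.
  by rewrite mulr0 mul0r.
- by move=> n Xn; apply: nX; exists n.
apply: (XP 1%N) => -[//|x [|//]] /=; rewrite andbT big_seq1 => xX _.
exact: XB.
Qed.

End PrimeIdeals.

Lemma subalgebra_smallest_words (F : fieldType) (A : algType F) (S : set A) (X : seq A) :
  (forall x, S x -> x \in X) -> forall n, seq_product_in X [set 0] n ->
  forall n' (x : 'I_n' -> A), (n <= n')%N ->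
  (forall i, smallest (@is_nonunital_subalgebra F A) S (x i)) -> \prod_(i < n') x i = 0.
Proof.
move=> SX n Xn.
(* W k consists of the combinations of words of length at least k in X; W 1 is a subalgebra
   containing S, and W n' contains all products of n' elements of W 1. *)
pose W k : set A := [set x | exists2 l : list_poly F,
  (forall m, m \in l -> (k <= size m.2)%N /\ (forall i, i \in m.2 -> i < size X)%N) &
  x = list_eval (nth 0 X) l].
have WM k k' x y : W k x -> W k' y -> W (k + k')%N (x * y).
  move=> [l lP ->] [l' lP' ->]; exists (lp_mul l l'); last by rewrite list_eval_mul.
  move=> m /allpairsP[[m1 m2] /= [/lP[s1 i1] /lP'[s2 i2] ->]] /=.
  rewrite size_cat leq_add //; split=> // i; rewrite mem_cat => /orP[/i1|/i2] //.
have W1 : is_nonunital_subalgebra (W 1%N).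
  split; last first.
    move=> x y Wx Wy; have [l lP ->] := WM _ _ _ _ Wx Wy.
    by exists l => // m /lP[sm im]; split=> //; apply: ltnW.
  split; first by exists [::]; rewrite ?/list_eval ?big_nil.
  move=> c _ _ [l lP ->] [l' lP' ->]; exists (lp_scale c l ++ l').
    by move=> m; rewrite mem_cat => /orP[/mapP[m' /lP h ->]|/lP'].
  by rewrite list_eval_cat list_eval_scale.
have SW : S `<=` W 1%N.
  move=> x Sx; exists (lp_var F (index x X)); last by rewrite list_eval_var nth_index // SX.
  move=> m; rewrite inE => /eqP -> /=; split=> // i; rewrite inE => /eqP ->.
  by rewrite index_mem SX.
move=> n' x nn' xS.
have xW : W n' (\prod_(i < n') x i).
  elim: n' x xS {nn'} => [|n' IH] x xS.
    rewrite big_ord0; exists (lp_const 1); last by rewrite list_eval_const scale1r.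
    by move=> m; rewrite inE => /eqP ->.
  rewrite big_ord_recr; have W1x i : W 1%N (x i) by apply: (xS i (W 1%N)).
  have := WM _ _ _ _ (IH (fun i => x (widen_ord (leqnSn n') i)) (fun i => xS _)) (W1x ord_max).
  by rewrite addn1.
have [l lP ->] := xW; rewrite /list_eval big_seq big1 // => m /lP[sm im].
rewrite -(cat_take_drop n m.2) big_cat /= -(big_map (nth 0 X) xpredT id) /= Xn ?mul0r ?scaler0 //.
  apply/allP => _ /mapP[i /mem_take/im iX ->]; exact: mem_nth.
by rewrite size_map size_takel // (leq_trans nn').
Qed.

Section NilCommutatorStructure.
Variables (F : fieldType) (A : algType F) (m : nat).
Hypotheses (Finf : infinite_set [set: F]) (Am : nil_commutators A m).

Lemma ideal_subspace (I : set A) : is_ideal I -> is_subspace I.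
Proof.
move=> II; split; first exact: ideal0.
move=> c x y Ix Iy; apply: idealD => //; rewrite -mulr_algl; exact: ideal_mull.
Qed.

(* Linearizing (r a)^n r in a, and multiplying by (r a)^(n-1) on the left,
   leaves only the term (r a)^(n-1) r b (r a)^(n-1) r modulo P. *)
Lemma prime_ideal_bounded_nil (P : set A) (r : A) n : is_prime_ideal P ->
  (forall a, P ((r * a) ^+ n * r)) -> P r.
Proof.
move=> Pprime; have [PI _ _] := Pprime; elim: n => [|n IH] Pr.
  by rewrite -[r]mul1r -(expr0 (r * 0)).
apply: IH => a; apply: prime_ideal_semiprime => // b.
pose T := r * a; pose p : {poly A} := T%:P + (r * b)%:P * 'X.
have c0 k : (p ^+ k)`_0 = T ^+ k.
  by elim: k => [|k IH]; rewrite ?coef1 // !exprS coef0M IH coefD coefC coefMX addr0.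
have c1 k : (p ^+ k.+1)`_1 = r * (a * (p ^+ k)`_1 + b * T ^+ k).
  rewrite exprS mulrDl coefD coefCM -mulrA coefCM coefXM /= c0.
  by rewrite mulrDr !mulrA.
have Pc : P ((p ^+ n.+1)`_1 * r).
  have [sz|sz] := ltnP 1 (size (p ^+ n.+1)); last first.
    by rewrite nth_default // mul0r; apply: ideal0.
  apply: (@polynomial_coef_mem F Finf A _ [::] (size (p ^+ n.+1))
            (fun i => (p ^+ n.+1)`_i * r)) sz => [|c _]; first exact: ideal_subspace.
  have := Pr (a + c *: b); rewrite (_ : _ * r = \sum_(d < size (p ^+ n.+1)) c ^+ d *: ((p ^+ n.+1)`_d * r)) //.
  under eq_bigr do rewrite scalerAl -mulr_algr.
  rewrite -mulr_suml; congr (_ * _).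
  have -> : (r * (a + c *: b)) ^+ n.+1 = (p ^+ n.+1).[c%:A].
    have pc : p.[c%:A] = r * (a + c *: b).
      by rewrite hornerD hornerMX !hornerC mulr_algr mulrDr scalerAr.
    elim: n.+1 => [|k IHk]; first by rewrite hornerC.
    rewrite !exprS hornerM_comm ?IHk ?pc //.
    by rewrite /comm_poly in_alg_comm_mul.
  by rewrite horner_coef; apply: eq_bigr => d _; rewrite exprZn expr1n.
have [s c1E] : exists s, (p ^+ n)`_1 = r * s.
  by case: n {Pr Pc} => [|n]; [exists 0; rewrite coef1 mulr0|eexists; apply: c1].
have -> : T ^+ n * r * b * (T ^+ n * r)
    = T ^+ n * ((p ^+ n.+1)`_1 * r) - T ^+ n.+1 * r * (s * r).
  rewrite c1 c1E exprSr (_ : T ^+ n * T = T ^+ n * r * a) ?mulrA //.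
  move: (T ^+ n) => u; rewrite !(mulrDr, mulrDl) !mulrA addrAC subrr add0r //.
by apply: idealB => //; [apply: ideal_mull|apply: ideal_mulr => //; apply: Pr].
Qed.

Lemma commutator_prime_radical x y : prime_radical A (lie_bracket x y).
Proof.
move=> P Pprime; apply: (prime_ideal_bounded_nil (n := m) Pprime) => a.
by rewrite Am mul0r; case: Pprime => /ideal0.
Qed.

(** Commutators vanish modulo P, so x^n b x^n becomes x^(2n) b there, and semiprimeness lowers the
    exponent from n + 1 to n whenever n > 0. *)
Lemma nilpotent_prime_radical x : nilpotents A x -> prime_radical A x.
Proof.
move=> [n xn] P Pprime; have [PI _ _] := Pprime.
have : P (x ^+ n) by rewrite xn; apply: ideal0.
elim: n {xn} => [|n IH] Px; first by rewrite -[x]mulr1 -(expr0 x); apply: ideal_mull.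
have [n0|n0] := posnP n; first by rewrite -[x]expr1 n0 in Px *.
apply: IH; apply: (prime_ideal_semiprime Pprime) => b.
have -> : x ^+ n * b * x ^+ n = x ^+ n * lie_bracket b (x ^+ n) + x ^+ n * x ^+ n * b.
  by rewrite mulrBr !mulrA subrK.
apply: idealD => //; first by apply: ideal_mull => //; exact: (commutator_prime_radical b (x ^+ n) Pprime).
apply: ideal_mulr => //; rewrite -exprD -(subnK (_ : n.+1 <= n + n)%N).
  by rewrite exprD; apply: ideal_mull.
by rewrite -addn1 leq_add2l.
Qed.

Lemma nilpotents_prime_radical : nilpotents A = prime_radical A.
Proof.
apply/seteqP; split; first exact: nilpotent_prime_radical.
move=> x Bx; have [|n Xn] := @prime_radical_product A [:: x].
  by move=> y; rewrite inE => /eqP ->.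
exists n; have := Xn (nseq n x); rewrite size_nseq => /(_ _ erefl) <-; last first.
  by apply/allP => y /nseqP[-> _]; apply: mem_head.
by rewrite big_nseq iter_mulr_1.
Qed.

Theorem prime_radical_structure :
  [/\ nilpotents A = prime_radical A, is_ideal (prime_radical A),
      locally_nilpotent (prime_radical A),
      forall q r : prime_quotient A, q * r = r * q & reduced_ring (prime_quotient A)].
Proof.
split.
- exact: nilpotents_prime_radical.
- exact: prime_radical_ideal.
- move=> S /finite_seqP[X ->] SB; have [n Xn] := @prime_radical_product A X SB.
  exists n.+1 => // x xS; apply: (subalgebra_smallest_words _ Xn (leqnSn n) xS).
  by [].
- move=> q r; rewrite -[q]reprK -[r]reprK.
  rewrite -[_ * _ in LHS]/(prime_quotient_mul _ _) -[_ * _ in RHS]/(prime_quotient_mul _ _).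
  rewrite !prime_quotient_mulE; apply/prime_quotient_eq; exact: commutator_prime_radical.
move=> q [n]; rewrite -[q]reprK; move: (generic_quotient.repr q) => {q} x.
have piX k : \pi_(prime_quotient A)%qT x ^+ k = \pi_(prime_quotient A)%qT (x ^+ k).
  elim: k => [|k IH]; first by rewrite !expr0.
  by rewrite !exprS IH; apply: prime_quotient_mulE.
have pi0 y : \pi_(prime_quotient A)%qT y = 0 <-> prime_radical A y.
  have <- : \pi_(prime_quotient A)%qT 0 = 0.
    by apply: (addrI (\pi_(prime_quotient A)%qT 0)); rewrite -prime_quotient_addE !addr0.
  by rewrite prime_quotient_eq subr0.
rewrite piX => /pi0 Bx; apply/pi0; move: Bx; rewrite -nilpotents_prime_radical => -[k].
by rewrite -exprM => xk; exists (n * k)%N.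
Qed.

End NilCommutatorStructure.

(** * From group identities to polynomial identities *)

Section Taylor.
Variables (F : fieldType) (A : algType F).

Definition poly_scalar (q : {poly F}) : {poly A} := map_poly (in_alg A) q.

Lemma poly_scalarM q r : poly_scalar (q * r) = poly_scalar q * poly_scalar r.
Proof. exact: rmorphM. Qed.

Lemma poly_scalar_comm q (p : {poly A}) : poly_scalar q * p = p * poly_scalar q.
Proof.
elim/poly_ind: q => [|q c IH]; rewrite /poly_scalar ?rmorph0 ?mul0r ?mulr0 //.
rewrite rmorphD rmorphM /= map_polyX map_polyC /= mulrDl mulrDr apolyC_comm.
by rewrite -mulrA -commr_polyX mulrA -/(poly_scalar q) IH mulrA.
Qed.

Definition eq_upto D (p q : {poly A}) := forall j, (j < D)%N -> p`_j = q`_j.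

Lemma eq_uptoM D p p' q q' : eq_upto D p q -> eq_upto D p' q' -> eq_upto D (p * p') (q * q').
Proof.
move=> pq pq' j jD; rewrite !coefM; apply: eq_bigr => i _; rewrite pq ?pq' //.
  by apply: leq_ltn_trans jD; apply: leq_subr.
exact: leq_ltn_trans (leq_ord i) jD.
Qed.

(** A polynomial with constant term 1 is invertible as a power series; it is cancelled here
    coefficient by coefficient. *)
Lemma eq_upto_cancel D (q : {poly F}) (p : {poly A}) : q`_0 = 1 ->
  eq_upto D (poly_scalar q * p) (poly_scalar q) -> eq_upto D p 1.
Proof.
move=> q0 H; suff h k j : (j < k)%N -> (j < D)%N -> (p - 1)`_j = 0.
  by move=> j jD; apply/eqP; rewrite -subr_eq0 -coefB (h j.+1).
elim: k j => // k IH j; rewrite ltnS => jk jD.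
have : (poly_scalar q * (p - 1))`_j = 0 by rewrite mulrBr mulr1 coefB H // subrr.
rewrite coefM big_ord_recl subn0 coef_map /= q0 scale1r mul1r big1 ?addr0 // => i _.
have ij : (j - lift ord0 i < j)%N by rewrite ltn_subrL /= (leq_ltn_trans _ (ltn_ord i)).
by rewrite IH ?mulr0 // ?(leq_trans ij jk) // (ltn_trans ij jD).
Qed.

Variables (n : nat) (x : 'I_n -> A) (q : 'I_n -> {poly F}) (Q : 'I_n -> {poly A}).
Hypotheses (q0 : forall i, (q i)`_0 = 1)
  (xQ : forall i, (1 + (x i)%:P * 'X) * Q i = poly_scalar (q i)).
Implicit Types (w : seq ('I_n * bool)) (a : 'I_n * bool).

(** The generator x_i stands for 1 + x_i X, whose inverse is the power series Q_i / q_i: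
    [letter_res] keeps the numerator, [letter_den] the denominator, and [letter_trunc] the terms of
    degree below D. *)
Definition letter_res a := if a.2 then 1 + (x a.1)%:P * 'X else Q a.1.
Definition letter_den a := if a.2 then 1 else q a.1.
Definition letter_trunc D a : {poly A} :=
  if a.2 then 1 + (x a.1)%:P * 'X else \sum_(j < D) (- ((x a.1)%:P * 'X)) ^+ j.

Lemma letter_resE D a : eq_upto D (letter_res a) (poly_scalar (letter_den a) * letter_trunc D a).
Proof.
rewrite /letter_res /letter_den /letter_trunc; case: a.2.
  by move=> j _; rewrite /poly_scalar rmorph1 mul1r.
set b := _ * 'X; set T := \sum_(_ < _) _; set i := a.1.
have Tb : T * (1 + b) = 1 - (- b) ^+ D.
  have -> : 1 + b = - (- b - 1) by rewrite opprB opprK.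
  have TC : GRing.comm T (- b - 1).
    apply: commr_sym; rewrite /T; elim/big_ind: _ => [|y z|k _]; [exact: commr0|exact: commrD|].
    apply: commrX; apply: commr_sym; apply: commrB; [by []|exact: commr1].
  by rewrite mulrN TC -subrX1 opprB.
have Qi : Q i - poly_scalar (q i) * T = (- b) ^+ D * Q i.
  by rewrite poly_scalar_comm -xQ mulrA Tb mulrBl mul1r opprB addrCA subrr addr0.
move=> j jD; apply/eqP; rewrite -subr_eq0 -coefB Qi -mulNr exprMn_comm; last exact: commr_polyX.
by rewrite -mulrA coefM big1 // => k _; rewrite coefXnM (leq_ltn_trans (leq_subr _ _) jD) mulr0.
Qed.

Lemma word_resE D w : eq_upto D (\prod_(a <- w) letter_res a)
  (poly_scalar (\prod_(a <- w) letter_den a) * \prod_(a <- w) letter_trunc D a).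
Proof.
elim: w => [|a w IH]; first by rewrite !big_nil mulr1 /poly_scalar rmorph1.
rewrite !big_cons poly_scalarM.
move: (poly_scalar (\prod_(b <- w) letter_den b)) (poly_scalar_comm (\prod_(b <- w) letter_den b)) IH (@letter_resE D a).
move=> s sC IH aE; rewrite -mulrA [s * _]mulrA sC -[letter_trunc D a * s * _]mulrA mulrA.
exact: eq_uptoM.
Qed.

Lemma word_den0 w : (\prod_(a <- w) letter_den a)`_0 = 1.
Proof.
elim: w => [|a w IH]; first by rewrite big_nil coef1.
rewrite big_cons coef0M IH /letter_den; case: a.2; rewrite ?coef1 ?mulr1 //=.
Qed.

(** Both sides say that w(1 + x X) is the power series 1, on the left with denominators cleared. The
    equivalence is applied from left to right in A and from right to left in M_2(F). *)
Lemma word_res_eq w :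
  \prod_(a <- w) letter_res a = poly_scalar (\prod_(a <- w) letter_den a) <->
  (forall d, (0 < d)%N -> (\prod_(a <- w) letter_trunc d.+1 a)`_d = 0).
Proof.
split=> [wE d d0|H].
  have := @eq_upto_cancel d.+1 _ _ (word_den0 w).
  by move=> -> //; rewrite ?coef1 ?eqn0Ngt ?d0 // => j jd; rewrite -(@word_resE d.+1 w j jd) wE.
have T1 D : eq_upto D (\prod_(a <- w) letter_trunc D a) 1.
  move=> j jD; have E : eq_upto j.+1 (\prod_(a <- w) letter_trunc D a) (\prod_(a <- w) letter_trunc j.+1 a).
    elim: (w) => [|a v IH]; rewrite ?big_nil // !big_cons; apply: eq_uptoM => // k kj.
    rewrite /letter_trunc; case: a.2 => //; rewrite -(subnK jD) addnC big_split_ord /= coefD.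
    rewrite [X in _ + X](_ : _ = 0) ?addr0 // coef_sum big1 // => l _.
    rewrite -mulNr exprMn_comm; last exact: commr_polyX.
    by rewrite coefMXn ltn_addr.
  rewrite E //; case: (posnP j) => [->|j0]; last by rewrite H // coef1 eqn0Ngt j0.
  elim: (w) => [|a v IH]; rewrite ?big_nil // big_cons coef0M IH coef1 mulr1 /letter_trunc.
  by case: a.2; rewrite ?big_ord1 ?expr0 ?coefD ?coefMX ?coef1 //= addr0.
apply/polyP => j; rewrite (@word_resE j.+1) //.
have := @eq_uptoM j.+1 (poly_scalar (\prod_(a <- w) letter_den a)) _ _ _ (fun _ _ => erefl) (T1 j.+1).
by move=> -> //; rewrite mulr1.
Qed.

End Taylor.

Section TaylorPolynomials.
Variables (F : fieldType) (n : nat).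

Definition letter_list D (a : 'I_n * bool) : list_poly F :=
  if a.2 then [:: (1, [::]); (1, [:: nat_of_ord a.1])]
  else [seq ((-1) ^+ j, nseq j (nat_of_ord a.1)) | j <- iota 0 D].

(* The degree d part of w(1 + x_0, 1 + x_1, ...), as a formal power series. *)
Definition taylor_poly (w : seq ('I_n * bool)) d : list_poly F :=
  [seq m <- foldr (fun a P => lp_mul (letter_list d.+1 a) P) (lp_const 1) w | size m.2 == d].

(** Substituting x_i X makes the exponent of X count the letters of a word, so that the part of
    degree d becomes a coefficient. *)
Lemma taylor_polyE (A : algType F) (x : nat -> A) (w : seq ('I_n * bool)) d :
  list_eval x (taylor_poly w d)
  = (\prod_(a <- w) letter_trunc (fun i : 'I_n => x i) d.+1 a)`_d.
Proof.
have coefE P : (list_eval (fun i => (x i)%:P * 'X : apoly A) P)`_d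
    = list_eval x [seq m <- P | size m.2 == d].
  rewrite /list_eval coef_sum big_filter [RHS]big_mkcond; apply: eq_bigr => m _.
  rewrite coef_apolyZ (_ : \prod_(i <- m.2) _ = (\prod_(i <- m.2) x i)%:P * 'X^(size m.2)).
    by rewrite coefCM coefXn eq_sym; case: eqP => _; rewrite ?mulr1 // mulr0 scaler0.
  elim: m.2 => [|i v IH]; first by rewrite !big_nil mulr1.
  rewrite !big_cons IH polyCM exprS -!mulrA; congr (_ * _).
  by rewrite !mulrA; congr (_ * _); rewrite commr_polyX.
have sgn j (p : apoly A) : (-1) ^+ j *: p = (-1) ^+ j * p.
  by elim: j => [|j IH]; rewrite ?scale1r ?mul1r // !exprS -scalerA IH scaleN1r mulN1r mulNr.
rewrite -coefE; set P := foldr _ _ _.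
suff -> : list_eval (fun i => (x i)%:P * 'X : apoly A) P
  = \prod_(a <- w) letter_trunc (fun i : 'I_n => x i) d.+1 a by [].
rewrite /P; elim: w {P} => [|a w IH] /=.
  by rewrite big_nil list_eval_const scale1r.
rewrite big_cons list_eval_mul IH; congr (_ * _); rewrite /letter_list /letter_trunc.
case: a.2; first by rewrite /list_eval big_cons !big_seq1 big_nil !scale1r.
rewrite /list_eval big_map (_ : iota 0 _ = index_iota 0 d.+1) ?big_mkord; last by rewrite /index_iota subn0.
apply: eq_bigr => j _ /=; rewrite big_nseq iter_mulr_1 sgn.
by apply: esym; apply: exprNn.
Qed.

End TaylorPolynomials.

(** * Resolvents of algebraic elements *)

Section Resolvent.
Variables (F : fieldType) (A : algType F).

(** With b = - a X, the equation p(a) = 0 becomes sum_j c_j X^(n-j) b^j = 0. Subtracting it from q =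
    sum_j c_j X^(n-j) leaves terms c_j X^(n-j) (1 - b^j), all divisible by 1 - b = 1 + a X. Division
    by the leading coefficient of p gives q constant term 1. *)
Lemma algebraic_resolvent (a : A) (p : {poly F}) : p != 0 -> horner_alg a p = 0 ->
  exists (q : {poly F}) (Q : {poly A}), [/\ q`_0 = 1, (1 + a%:P * 'X) * Q = poly_scalar A q
    & Q * (1 + a%:P * 'X) = poly_scalar A q].
Proof.
move=> p0 pa; pose n := (size p).-1; pose X : apoly A := 'X.
pose C (y : A) : apoly A := y%:P; pose b : apoly A := - (C a * X).
have CM y z : C (y * z) = C y * C z by apply: polyCM.
have XC y : X * C y = C y * X by rewrite [RHS]commr_polyX.
have CZ d y : C (d *: y) = d *: C y.
  by apply/polyP => k; rewrite coef_apolyZ !coefC; case: ifP; rewrite ?scaler0.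
have l0 : lead_coef p != 0 by rewrite lead_coef_eq0.
pose c j := (-1) ^+ (n - j) * (p`_j / lead_coef p).
have bX k : b * X ^+ k = X ^+ k * b by rewrite [LHS]commr_polyXn.
have sumX : \sum_(j < n.+1) c j *: (X ^+ (n - j) * b ^+ j) = 0.
  transitivity (((-1) ^+ n / lead_coef p) *: (X ^+ n * C (horner_alg a p))); last first.
    by rewrite pa /C polyC0 mulr0 scaler0.
  have -> : horner_alg a p = \sum_(j < n.+1) p`_j *: a ^+ j.
    rewrite /horner_alg /horner_morph (@horner_coef_wide _ n.+1); last by rewrite size_map_poly leqSpred.
    by apply: eq_bigr => j _; rewrite coef_map mulr_algl.
  rewrite /C rmorph_sum mulr_sumr scaler_sumr; apply: eq_bigr => j _ /=.
  rewrite -/(C _) CZ -scalerAr scalerA /c.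
  have jn : (j <= n)%N by rewrite -ltnS.
  have -> : b ^+ j = (-1) ^+ j *: (C (a ^+ j) * X ^+ j).
    elim: (nat_of_ord j) => [|k IH]; first by rewrite !expr0 mulr1 scale1r.
    rewrite [b ^+ _]exprS IH -scalerAr [(-1) ^+ k.+1]exprSr -scalerA scaleN1r /b; congr (_ *: _).
    rewrite mulNr; congr (- _); rewrite [a ^+ k.+1]exprS [X ^+ k.+1]exprS CM -!mulrA; congr (_ * _).
    by rewrite !mulrA XC.
  rewrite -scalerAr scalerA mulrAC -exprD subnK // mulrA; congr (_ *: _); first by rewrite mulrAC.
  have XnC k y : X ^+ k * C y = C y * X ^+ k by rewrite [RHS]commr_polyXn.
  by rewrite mulrA !XnC -mulrA -exprD subnK.
pose q := \sum_(j < n.+1) c j *: 'X^(n - j).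
have qE : poly_scalar A q = \sum_(j < n.+1) c j *: X ^+ (n - j).
  rewrite /poly_scalar rmorph_sum; apply: eq_bigr => j _.
  by rewrite /= map_polyZ map_polyXn -mul_polyC.
pose Q : apoly A := \sum_(j < n.+1) c j *: (X ^+ (n - j) * \sum_(i < j) b ^+ i).
have bE : 1 + a%:P * 'X = 1 - b :> apoly A by rewrite /b opprK.
have bQ : (1 - b) * Q = poly_scalar A q.
  rewrite qE; apply/eqP; rewrite -subr_eq0 -oppr_eq0 opprB; apply/eqP; rewrite -[RHS]sumX.
  rewrite mulr_sumr -sumrB; apply: eq_bigr => j _; rewrite -scalerAr -scalerBr; congr (_ *: _).
  have E m : (1 - b) * X ^+ m = X ^+ m * (1 - b) by rewrite mulrBl mulrBr mul1r mulr1 bX.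
  have E2 : (1 - b) * (\sum_(i < j) b ^+ i) = 1 - b ^+ j.
    by apply: oppr_inj; rewrite -mulNr !opprB subrX1.
  by rewrite mulrA E -mulrA E2 mulrBr mulr1 opprB addrCA subrr addr0.
exists q, Q; split; last 2 first.
- by rewrite -bQ -bE.
- have bQC : GRing.comm b Q.
    apply: commr_sum => j _; rewrite /GRing.comm -scalerAr -scalerAl; congr (_ *: _).
    apply: commrM; first exact: bX.
    by apply: commr_sum => k _; apply: commrX.
  rewrite -bQ -bE bE; apply: commrB; first exact: commr1.
  exact: commr_sym.
rewrite coef_sum (bigD1 ord_max) //= subnn expr0 coefZ coef1 mulr1 /c subnn expr0 mul1r.
rewrite divff // big1 ?addr0 // => j; rewrite -val_eqE /= => jn.
by rewrite coefZ coefXn eq_sym subn_eq0 leqNgt ltn_neqAle jn -ltnS ltn_ord mulr0.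
Qed.

End Resolvent.

Section PolynomialRoots.
Variable F : fieldType.

Lemma poly_root_list (q : {poly F}) : q != 0 -> exists s : seq F, forall x, x \notin s -> q.[x] != 0.
Proof.
move sz : (size q) => n; elim: n q sz => [|n IH] q sz q0.
  by move/eqP: sz; rewrite size_poly_eq0 (negPf q0).
have [[x /eqP qx]|nr] := pselect (exists x, q.[x] = 0); last first.
  by exists [::] => x _; apply/eqP => qx; apply: nr; exists x.
have /factor_theorem[r qE] : root q x by [].
have r0 : r != 0 by apply: contraNneq q0 => r0; rewrite qE r0 mul0r.
have [|s sP] := IH r _ r0.
  by move: sz; rewrite qE size_Mmonic ?monicXsubC // size_XsubC addn2 /= => -[].
exists (x :: s) => y; rewrite inE negb_or => /andP[yx ys].
by rewrite qE hornerM mulf_neq0 ?sP // hornerXsubC subr_eq0.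
Qed.

Lemma poly_eq_infinite (q r : {poly F}) : infinite_set [set: F] ->
  (forall x, q.[x] = r.[x]) -> q = r.
Proof.
move=> Finf qr; apply/eqP; rewrite -subr_eq0; apply/negP => /negP /poly_root_list[s sP].
have [x xs] := infinite_fresh Finf s.
by have := sP x xs; rewrite hornerD hornerN qr subrr eqxx.
Qed.

End PolynomialRoots.

Lemma horner_central (F : fieldType) (A : algType F) (c : F) I (r : seq I) (p : I -> {poly A}) :
  (\prod_(i <- r) p i).[c%:A] = \prod_(i <- r) (p i).[c%:A].
Proof.
elim: r => [|i r IH]; first by rewrite !big_nil hornerC.
by rewrite !big_cons hornerM_comm ?IH // /comm_poly in_alg_comm_mul.
Qed.

Section GroupIdentity.
Variables (F : fieldType) (n : nat) (w : seq ('I_n * bool)).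
Hypothesis Finf : infinite_set [set: F].

(** If c is a root of no q_i, then 1 + c x_i is a unit with inverse Q_i(c) / q_i(c), and w = 1 on
    these units says that the two sides of [word_res_eq] agree at c. Infinitely many such c make
    them equal. *)
Lemma taylor_poly_identity (A : unitAlgType F) : algebraic_algebra A ->
  (forall g : 'I_n -> unit_group A, eval_word g w = 1%g) ->
  forall d (x : nat -> A), (0 < d)%N -> list_eval x (taylor_poly F w d) = 0.
Proof.
move=> Aalg wA d x d0.
have /choice[q /choice[Q qQ]] : forall i : 'I_n, exists (q : {poly F}) (Q : {poly A}),
    [/\ q`_0 = 1, (1 + (x i)%:P * 'X) * Q = poly_scalar A q
      & Q * (1 + (x i)%:P * 'X) = poly_scalar A q].
  by move=> i; have [p p0 px] := Aalg (x i); apply: algebraic_resolvent p0 px.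
have q0 i : (q i)`_0 = 1 by case: (qQ i).
have xQ (i : 'I_n) : (1 + (x i)%:P * 'X) * Q i = poly_scalar A (q i) by case: (qQ i).
rewrite taylor_polyE; move: d d0; apply/(word_res_eq q0 xQ).
set L := \prod_(a <- w) _; set R := \prod_(a <- w) _.
have qn0 : \prod_i q i != 0.
  by apply/prodf_neq0 => i _; apply/eqP => qi; move/eqP: (q0 i); rewrite qi coef0 eq_sym oner_eq0.
have [s sP] := poly_root_list qn0.
suff : forall k, (L - poly_scalar A R)`_k = 0.
  by move=> h; apply/eqP; rewrite -subr_eq0; apply/eqP/polyP => k; rewrite h coef0.
move=> k; set D := L - _; have [/leq_sizeP/(_ k)->//|kD] := leqP (size D) k.
apply: (@polynomial_coef_mem F Finf A [set 0] s (size D) (fun i => D`_i)) => //.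
  exact: subspace_zero.
move=> c /sP qc /=.
have qci i : (q i).[c] != 0.
  by move: qc; rewrite horner_prod => /prodf_neq0/(_ i isT).
have scE (r : {poly F}) : (poly_scalar A r).[c%:A] = r.[c]%:A.
  by rewrite /poly_scalar -[c%:A]/(in_alg A c) horner_map.
have gQ (i : 'I_n) : (1 + c *: x i) * (Q i).[c%:A] = (q i).[c]%:A.
  have := congr1 (fun p => p.[c%:A]) (xQ i); rewrite /= scE => <-.
  rewrite hornerM_comm; last by rewrite /comm_poly in_alg_comm_mul.
  by rewrite hornerD hornerMX !hornerC mulr_algr.
have Qg (i : 'I_n) : (Q i).[c%:A] * (1 + c *: x i) = (q i).[c]%:A.
  case: (qQ i) => _ _ /(congr1 (fun p => p.[c%:A])); rewrite /= scE => <-.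
  rewrite hornerM_comm; last by rewrite /comm_poly in_alg_comm_mul.
  by rewrite hornerD hornerMX !hornerC mulr_algr.
have gu (i : 'I_n) : 1 + c *: x i \is a GRing.unit.
  apply/unitrP; exists ((q i).[c]^-1 *: (Q i).[c%:A]).
  by rewrite -scalerAl -scalerAr gQ Qg scalerA mulVf // scale1r.
pose g i := UnitGroup (gu i).
rewrite -[RHS](_ : D.[c%:A] = 0).
  by rewrite horner_coef; apply: eq_bigr => j _; rewrite exprZn expr1n mulr_algr.
rewrite hornerD hornerN scE /L horner_central.
rewrite (_ : \prod_(a <- w) _ = R.[c]%:A * unit_val (eval_word g w)).
  by rewrite wA mulr1 subrr.
rewrite /R /eval_word; elim: w => [|a v IH].
  by rewrite !big_nil hornerC scale1r mulr1.
rewrite !big_cons IH hornerM /=.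
rewrite /letter_res /letter_den; case: a.2.
  rewrite hornerD hornerMX !hornerC mul1r mulr_algr /= mulrA.
  by rewrite -in_alg_comm_mul -mulrA.
have -> : (Q a.1).[c%:A] = (q a.1).[c] *: (unit_val (g a.1))^-1.
  by apply: (mulrI (gu a.1)); rewrite gQ -scalerAr mulrV.
by rewrite -scalerA -!scalerAl !mul1r; congr (_ *: _); rewrite -scalerAr.
Qed.

End GroupIdentity.

(** * Reduced words do not vanish identically on GL_2 *)

Section GL2.
Variable F : fieldType.

Lemma mx2_eq (M N : 'M[F]_2) :
  M 0 0 = N 0 0 -> M 0 1 = N 0 1 -> M 1 0 = N 1 0 -> M 1 1 = N 1 1 -> M = N.
Proof.
move=> h00 h01 h10 h11; apply/matrixP => i j.
have two (k : 'I_2) : k = 0 \/ k = 1.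
  by case: k => -[|[|//]] ?; [left|right]; apply: val_inj.
by case: (two i) => ->; case: (two j) => ->.
Qed.

Definition upper_mx (c : F) : 'M[F]_2 := 1 + c *: delta_mx 0 1.
Definition lower_mx (c : F) : 'M[F]_2 := 1 + c *: delta_mx 1 0.

Lemma upper_mxM c d : upper_mx c * upper_mx d = upper_mx (c + d).
Proof.
rewrite -!mulmxE /upper_mx; apply: mx2_eq; rewrite !mxE !big_ord_recl !big_ord0 !mxE /=; ring.
Qed.

Lemma lower_mxM c d : lower_mx c * lower_mx d = lower_mx (c + d).
Proof.
rewrite -!mulmxE /lower_mx; apply: mx2_eq; rewrite !mxE !big_ord_recl !big_ord0 !mxE /=; ring.
Qed.

Lemma upper_mx0 : upper_mx 0 = 1. Proof. by rewrite /upper_mx scale0r addr0. Qed.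
Lemma lower_mx0 : lower_mx 0 = 1. Proof. by rewrite /lower_mx scale0r addr0. Qed.

Definition vec2 (a b : F) : 'cV[F]_2 := \col_i (if i == 0 then a else b).

Lemma upper_vec2 c a b : upper_mx c *m vec2 a b = vec2 (a + c * b) b.
Proof.
apply/colP => i; rewrite /upper_mx mulmxDl mul1mx -scalemxAl !mxE !big_ord_recl big_ord0 !mxE /=.
by case: (unliftP 0 i) => [j|] -> /=; rewrite ?(ord1 j) !(mul0r, mul1r, mulr0, add0r, addr0).
Qed.

Lemma lower_vec2 c a b : lower_mx c *m vec2 a b = vec2 a (b + c * a).
Proof.
apply/colP => i; rewrite /lower_mx mulmxDl mul1mx -scalemxAl !mxE !big_ord_recl big_ord0 !mxE /=.
by case: (unliftP 0 i) => [j|] -> /=; rewrite ?(ord1 j) !(mul0r, mul1r, mulr0, add0r, addr0).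
Qed.

(** The two products are mutually inverse of determinant 1, and g + g^-1 = tr(g) for such
    matrices. *)
Lemma upper_lower_trace a t b :
  upper_mx a * lower_mx t * upper_mx (- b) + upper_mx b * lower_mx (- t) * upper_mx (- a)
  = (2 + (a - b) * t) *: 1.
Proof.
rewrite -!mulmxE /upper_mx /lower_mx.
by apply: mx2_eq; rewrite !mxE !big_ord_recl !big_ord0 !mxE !big_ord_recl !big_ord0 !mxE /=; ring.
Qed.

End GL2.

Lemma mul_linear_polys (R : nzRingType) (a b : R) :
  (1 + a%:P * 'X) * (1 + b%:P * 'X) = 1 + (a + b)%:P * 'X + (a * b)%:P * ('X * 'X) :> {poly R}.
Proof.
rewrite mulrDl mul1r mulrDr mulr1 polyCD polyCM mulrDl -!addrA; congr (_ + _).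
rewrite addrCA; congr (_ + (_ + _)); rewrite -!mulrA; congr (_ * _).
by rewrite !mulrA; congr (_ * _); rewrite [RHS]commr_polyX.
Qed.

Section PolyScalar.
Variables (F : fieldType) (A : algType F).
Implicit Types q r : {poly F}.

Lemma poly_scalarD q r : poly_scalar A (q + r) = poly_scalar A q + poly_scalar A r.
Proof. exact: rmorphD. Qed.
Lemma poly_scalar1 : poly_scalar A 1 = 1. Proof. exact: rmorph1. Qed.
Lemma poly_scalarC c : poly_scalar A c%:P = (c%:A)%:P. Proof. exact: map_polyC. Qed.
Lemma poly_scalarX : poly_scalar A 'X = 'X. Proof. exact: map_polyX. Qed.

End PolyScalar.

Section GL2Words.
Variables (F : fieldType) (n : nat) (z : 'I_n -> bool -> F).
Hypotheses (Finf : infinite_set [set: F]) (z0 : forall i b, z i b != 0)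
  (zinj : forall i b j c, z i b = z j c -> i = j /\ b = c).
Implicit Types (a : 'I_n * bool) (w : seq ('I_n * bool)).

(* The generator x_i is sent to upper(c_i t) lower(t) upper(-d_i t) with
   c_i = z i true and d_i = z i false. In a reduced word the upper factors between
   two consecutive lower ones never cancel, so the degree in t grows. *)
Definition letter_mx (t : F) a : 'M[F]_2 :=
  upper_mx (z a.1 a.2 * t) * lower_mx ((-1) ^+ (~~ a.2) * t) * upper_mx (- (z a.1 (~~ a.2) * t)).

Fixpoint word_vec w : {poly F} * {poly F} :=
  if w is a :: w' then
    let: (P, Q) := word_vec w' in
    let P1 := P - z a.1 (~~ a.2) *: 'X * Q in
    let Q1 := Q + (-1) ^+ (~~ a.2) *: 'X * P1 in
    (P1 + z a.1 a.2 *: 'X * Q1, Q1)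
  else (0, 1).

Lemma word_vec_cons a w : word_vec (a :: w) =
  let: (P, Q) := word_vec w in
  let P1 := P - z a.1 (~~ a.2) *: 'X * Q in
  let Q1 := Q + (-1) ^+ (~~ a.2) *: 'X * P1 in
  (P1 + z a.1 a.2 *: 'X * Q1, Q1).
Proof. by []. Qed.

Lemma word_vecE t w :
  (\prod_(a <- w) letter_mx t a) *m vec2 0 1 = vec2 (word_vec w).1.[t] (word_vec w).2.[t].
Proof.
elim: w => [|a w IH]; first by rewrite big_nil mul1mx /= horner0 hornerC.
rewrite big_cons /= -mulmxE -mulmxA IH; case: (word_vec w) => P Q /=.
rewrite /letter_mx -!mulmxA upper_vec2 lower_vec2 upper_vec2 /=.
by rewrite !hornerE mulNr.
Qed.

Lemma sizeXM (c : F) (Q : {poly F}) : c != 0 -> Q != 0 -> size (c *: 'X * Q) = (size Q).+1.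
Proof. by move=> c0 Q0; rewrite -scalerAl size_scale // mulrC size_mulX. Qed.

(** Between two lower factors the upper ones combine into a single one whose parameter is t times a
    difference of two values of [z], nonzero since [z] is injective and the word reduced. The first
    entry thus gets one degree more than the second, and the following lower factor raises the
    second above it. *)
Lemma word_vec_size a w : reduced_word (a :: w) ->
  let: (P, Q) := word_vec (a :: w) in
  (0 < size (P - z a.1 a.2 *: 'X * Q)%R < size Q)%N.
Proof.
have step b (P1 Q : {poly F}) (c : F) : c != 0 -> (size P1 < size Q)%N ->
    let P' := P1 + c *: 'X * Q in let Q' := Q + (-1) ^+ (~~ b) *: 'X * P' in
    (0 < size P' < size Q')%N.
  move=> c0 PQ /=; have Q0 : Q != 0 by rewrite -size_poly_gt0 (leq_ltn_trans _ PQ).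
  have sP : size (P1 + c *: 'X * Q) = (size Q).+1.
    by rewrite addrC size_polyDl; rewrite sizeXM //; apply: ltnW.
  have P0 : P1 + c *: 'X * Q != 0 by rewrite -size_poly_gt0 sP.
  rewrite sP /= addrC size_polyDl; rewrite sizeXM ?signr_eq0 // sP ltnS //.
elim: w a => [|b w IH] a.
  move=> _ /=; rewrite addrK; have := step a.2 0 1 (- z a.1 (~~ a.2)).
  by rewrite oppr_eq0 size_poly0 size_poly1 scaleNr !mulNr; apply.
move=> red; have /andP[ab bw] : ~~ ((a.1 == b.1) && (a.2 != b.2)) && reduced_word (b :: w) by [].
have := IH b bw; rewrite [word_vec [:: a, b & w]]word_vec_cons; case: (word_vec (b :: w)) => P Q /andP[_ PQ] /=.
rewrite addrK.
have := step a.2 _ Q (z b.1 b.2 - z a.1 (~~ a.2)) _ PQ.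
rewrite scalerBl mulrBl addrA subrK; apply.
rewrite subr_eq0; apply/eqP => /zinj[i1 i2]; move: ab.
by rewrite i1 eqxx i2; case: a.2.
Qed.

Lemma word_mx_neq1 w : reduced_word w -> w != [::] ->
  exists t, \prod_(a <- w) letter_mx t a != 1.
Proof.
case: w => // a w red _; apply: contrapT => H.
have := word_vec_size red; case E: (word_vec (a :: w)) => [P Q] /andP[P0 PQ].
suff Q1 : Q = 1 by move: (leq_ltn_trans P0 PQ); rewrite Q1 size_poly1.
apply: (poly_eq_infinite Finf) => t; rewrite hornerC.
have -> : Q = (word_vec (a :: w)).2 by rewrite E.
have := word_vecE t (a :: w); rewrite (_ : \prod_(_ <- _) _ = 1); last first.
  by apply: contrapT => /eqP h; apply: H; exists t.
by rewrite mul1mx => /colP/(_ 1); rewrite !mxE.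
Qed.

Lemma letter_mx_inv t i : letter_mx t (i, true) * letter_mx t (i, false) = 1.
Proof.
rewrite /letter_mx /= expr0 expr1 mul1r mulN1r.
by rewrite -!mulrA [upper_mx (- _) * _]mulrA upper_mxM addNr upper_mx0 mul1r
   [lower_mx _ * _]mulrA lower_mxM addrN lower_mx0 mul1r upper_mxM addrN upper_mx0.
Qed.

Lemma letter_mx_sum t i : exists s : F, letter_mx t (i, true) + letter_mx t (i, false) = s *: 1.
Proof.
rewrite /letter_mx /= expr0 expr1 mul1r mulN1r; eexists.
exact: upper_lower_trace.
Qed.

(** Take letter matrices g_i at a parameter t where w(g) is not 1. As g_i + g_i^-1 is scalar, (1 +
    (g_i - 1) X)(1 + (g_i^-1 - 1) X) is a scalar polynomial q_i, and q_i(1) = 1. If all Taylor parts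
    vanished, [word_res_eq] evaluated at X = 1 would give w(g) = 1. *)
Lemma taylor_not_identity w : reduced_word w -> w != [::] ->
  exists d (x : nat -> 'M[F]_2), (0 < d)%N /\ list_eval x (taylor_poly F w d) != 0.
Proof.
move=> red w0; have [t] := word_mx_neq1 red w0; apply: contraNP => H.
pose g i := letter_mx t (i, true); pose h i := letter_mx t (i, false).
pose x i : 'M[F]_2 := if insub i is Some j then g j - 1 else 0.
have xE (i : 'I_n) : x i = g i - 1 by rewrite /x valK.
have [s sE] := choice (letter_mx_sum t).
pose q i : {poly F} := 1 + (s i - 2)%:P * 'X + (2 - s i)%:P * 'X^2.
pose Q i : {poly 'M[F]_2} := 1 + (h i - 1)%:P * 'X.
have q0 i : (q i)`_0 = 1 by rewrite !coefD !coefMX !coefCM coefXn coef1 /= mulr0 !addr0.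
have xQ (i : 'I_n) : (1 + (x i)%:P * 'X) * Q i = poly_scalar 'M[F]_2 (q i).
  rewrite /Q xE /q !poly_scalarD !poly_scalarM poly_scalar1 !poly_scalarC !poly_scalarX.
  have hE : h i = (s i)%:A - g i by rewrite -sE addrC addKr.
  rewrite mul_linear_polys; congr (1 + _%:P * _ + _%:P * _).
    by rewrite hE scalerBl scaler_nat addrACA [g i + _]addrC subrK -opprD.
  rewrite mulrBl mulrBr mul1r mulr1 letter_mx_inv hE scalerBl scaler_nat.
  rewrite opprB addrA opprB addrAC; rewrite !addrA.
  by rewrite subrK addrAC.
have /(word_res_eq q0 xQ) : forall d, (0 < d)%N ->
    (\prod_(a <- w) letter_trunc (fun i : 'I_n => x i) d.+1 a)`_d = 0.
  move=> d d0; rewrite -taylor_polyE; apply: contrapT => /eqP xd.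
  by apply: H; exists d, x.
move/(congr1 (fun p : {poly 'M[F]_2} => p.[(1 : F)%:A])).
rewrite horner_central -[(1 : F)%:A]/(in_alg 'M[F]_2 1) /poly_scalar horner_map horner_prod.
rewrite [in RHS]big1 => [|a _]; last first.
  rewrite /letter_den; case: a.2; rewrite ?hornerC //.
  by rewrite /q !hornerD !hornerCM hornerX hornerXn hornerC expr1n !mulr1 -addrA -[2 - _]opprB subrr addr0.
move=> E; apply/eqP; rewrite -[RHS](scale1r (1 : 'M[F]_2)); apply: etrans E; apply: eq_bigr => -[i b] _; rewrite /letter_res /=.
rewrite scale1r; case: b; rewrite hornerD hornerMX !hornerC mulr1 ?xE addrC subrK //.
Qed.

End GL2Words.

Theorem GI_nonmatrix (F : fieldType) (A : unitAlgType F) :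
  infinite_set [set: F] -> algebraic_algebra A -> GI_algebra A ->
  satisfies_nonmatrix_identity A.
Proof.
move=> Finf Aalg [n [w [red w0 wA]]].
(* Two distinct nonzero scalars for each generator. *)
have [t [ut tz]] := infinite_fresh_uniq Finf [:: 0] (n + n).
pose z (i : 'I_n) b := tnth t (if b then lshift n i else rshift n i).
have [|i b j c|d [x [d0 xd]]] := @taylor_not_identity F n z Finf _ _ w red w0.
- move=> i b; have := tz (z i b) (mem_tnth _ _).
  by rewrite inE.
- move=> /(tuple_uniqP _ ut); case: b c => -[] /eqP.
  + by rewrite (inj_eq (@lshift_inj _ _)) => /eqP.
  + by rewrite eq_lrshift.
  + by rewrite eq_rlshift.
  + by rewrite (inj_eq (@rshift_inj _ _)) => /eqP.
exists (nc_of_list (taylor_poly F w d)).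
  by move=> h; case/eqP: xd; rewrite -nc_of_listE h.
by move=> a; rewrite nc_of_listE; apply: taylor_poly_identity.
Qed.

(** * Identities in the group of units and in the Lie algebra *)

Section Words.
Variable n : nat.
Implicit Types w : seq ('I_n * bool).

Definition inv_word w := rev [seq (a.1, ~~ a.2) | a <- w].

Lemma eval_word_cat (G : groupType) (g : 'I_n -> G) w1 w2 :
  eval_word g (w1 ++ w2) = (eval_word g w1 * eval_word g w2)%g.
Proof. exact: big_cat. Qed.

Lemma eval_inv_word (G : groupType) (g : 'I_n -> G) w :
  eval_word g (inv_word w) = ((eval_word g w)^-1)%g.
Proof.
rewrite /inv_word /eval_word; elim: w => [|a w IH]; first by rewrite !big_nil invg1.
rewrite /= rev_cons -cats1 big_cat /= IH !big_cons big_nil mulg1 invgM; congr (_ * _)%g.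
by case: a.2; rewrite //= invgK.
Qed.

Lemma reduced_inv_word w : reduced_word w -> reduced_word (inv_word w).
Proof.
rewrite /reduced_word /inv_word rev_sorted sorted_map; apply: sub_sorted => a b /=.
by rewrite eq_sym; case: a.2; case: b.2.
Qed.

Lemma reduced_cat w1 w2 w3 : reduced_word w1 -> w2 != [::] -> reduced_word (w2 ++ w3) ->
  (forall a b, a \in w1 -> b \in w2 -> a.1 != b.1) -> reduced_word (w1 ++ w2 ++ w3).
Proof.
case: w1 => // a1 w1; case: w2 => // a2 w2 r1 _ r2 H.
rewrite /reduced_word /= cat_path; apply/andP; split; first exact: r1.
apply/andP; split; last exact: r2.
by rewrite negb_and (H (last a1 w1) a2) // ?mem_last // mem_head.
Qed.

End Words.

Fixpoint derived_arity k : nat := if k is k'.+1 then derived_arity k' + derived_arity k' else 1.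

Definition shift_word n n' (f : 'I_n -> 'I_n') (w : seq ('I_n * bool)) := [seq (f a.1, a.2) | a <- w].

(** The two copies use disjoint generators, so no letters cancel in the commutator. *)
Fixpoint derived_word k : seq ('I_(derived_arity k) * bool) :=
  if k is k'.+1 then
    let u := shift_word (@lshift _ (derived_arity k')) (derived_word k') in
    let v := shift_word (@rshift (derived_arity k') _) (derived_word k') in
    inv_word u ++ inv_word v ++ u ++ v
  else [:: (ord0, true)].

Lemma reduced_shift n n' (f : 'I_n -> 'I_n') w : injective f ->
  reduced_word w -> reduced_word (shift_word f w).
Proof.
move=> finj; rewrite /reduced_word sorted_map; apply: sub_sorted => a b /=.
by rewrite (inj_eq finj).
Qed.

Lemma inv_word_eq0 n (w : seq ('I_n * bool)) : (inv_word w == [::]) = (w == [::]).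
Proof. by rewrite -!size_eq0 size_rev size_map. Qed.

Lemma mem_inv_word n (w : seq ('I_n * bool)) a : a \in inv_word w -> (a.1, ~~ a.2) \in w.
Proof. by rewrite mem_rev => /mapP[[i b] bw ->]; rewrite /= negbK. Qed.

Lemma derived_word_reduced k : reduced_word (derived_word k) /\ derived_word k != [::].
Proof.
elim: k => [|k [red n0]] /=; first by split.
set u := shift_word _ _; set v := shift_word _ _.
have ru : reduced_word u by apply: reduced_shift => //; apply: lshift_inj.
have rv : reduced_word v by apply: reduced_shift => //; apply: rshift_inj.
have u0 : u != [::] by rewrite -size_eq0 size_map size_eq0.
have v0 : v != [::] by rewrite -size_eq0 size_map size_eq0.
have uv a b : a \in u -> b \in v -> a.1 != b.1.
  by move=> /mapP[a' _ ->] /mapP[b' _ ->] /=; rewrite eq_lrshift.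
split; last by rewrite -size_eq0 !size_cat !addn_eq0 !size_eq0 inv_word_eq0 (negPf u0).
apply: reduced_cat; rewrite ?inv_word_eq0 ?reduced_inv_word //; last first.
  by move=> a b /mem_inv_word ua /mem_inv_word vb; apply: (uv _ _ ua vb).
apply: reduced_cat; rewrite ?reduced_inv_word //; last first.
  by move=> a b /mem_inv_word va ub; rewrite eq_sym; apply: (uv _ _ ub va).
by rewrite -[v]cats0; apply: reduced_cat; rewrite ?cats0.
Qed.

Lemma eval_shift_word (G : groupType) n n' (f : 'I_n -> 'I_n') (g : 'I_n' -> G) w :
  eval_word g (shift_word f w) = eval_word (fun i => g (f i)) w.
Proof. by rewrite /eval_word big_map. Qed.

Lemma derived_word_mem (G : groupType) k (g : 'I_(derived_arity k) -> G) :
  derived_group G k (eval_word g (derived_word k)).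
Proof.
elim: k g => [//|k IH] g H [_]; apply.
exists (eval_word (fun i => g (lshift _ i)) (derived_word k)).
exists (eval_word (fun i => g (rshift _ i)) (derived_word k)).
split; [exact: IH|exact: IH|].
rewrite /= !eval_word_cat !eval_inv_word !eval_shift_word commgEl conjgE !mulgA.
by [].
Qed.

Lemma solvable_GI (G : groupType) : solvable_group G -> satisfies_group_identity G.
Proof.
move=> [k Gk]; have [red w0] := derived_word_reduced k.
exists (derived_arity k), (derived_word k); split=> // g.
by have := derived_word_mem g; rewrite Gk.
Qed.

Lemma commutator_power_GI (G : groupType) m : (0 < m)%N ->
  (forall x y : G, ([~ x, y] ^+ m = 1)%g) -> satisfies_group_identity G.
Proof.
move=> m0 Gm; pose i0 : 'I_2 := ord0; pose i1 : 'I_2 := ord_max.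
pose c := [:: (i0, false); (i1, false); (i0, true); (i1, true)].
exists 2%N, (flatten (nseq m c)); split.
- case: m m0 {Gm} => // m _; rewrite /reduced_word /=; elim: m => //= m IH.
- by case: m m0 {Gm}.
- move=> g; rewrite -[RHS](Gm (g i0) (g i1)) {m0 Gm}; elim: m => [|m IH].
    by rewrite expg0 /eval_word big_nil.
  rewrite /= expgS /eval_word !big_cons -[\big[_/_]_(_ <- _) _]/(eval_word g _) IH !mulgA /=.
  by rewrite commgEl conjgE !mulgA.
Qed.

(** * The polynomials ([x,y] z)^m and the derived Lie polynomials *)

Section NonmatrixIdentities.
Variable F : fieldType.

Lemma e01_e10 : lie_bracket (delta_mx 0 1) (delta_mx 1 0) = delta_mx 0 0 - delta_mx 1 1 :> 'M[F]_2.
Proof. by rewrite /lie_bracket -!mulmxE !mul_delta_mx. Qed.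

Definition commutator_power_poly m : list_poly F :=
  lp_exp (lp_mul (lp_bracket (lp_var F 0) (lp_var F 1)) (lp_var F 2)) m.

Lemma commutator_power_polyE (A : algType F) (a : nat -> A) m :
  list_eval a (commutator_power_poly m) = (lie_bracket (a 0%N) (a 1%N) * a 2%N) ^+ m.
Proof. by rewrite list_eval_exp list_eval_mul list_eval_bracket !list_eval_var. Qed.

Definition lp_rename (r : nat -> nat) (P : list_poly F) : list_poly F :=
  [seq (m.1, map r m.2) | m <- P].

Lemma list_eval_rename (A : algType F) (a : nat -> A) r P :
  list_eval a (lp_rename r P) = list_eval (fun i => a (r i)) P.
Proof. by rewrite /list_eval big_map; apply: eq_bigr => m _; rewrite big_map. Qed.

Fixpoint lie_derived_poly k : list_poly F :=
  if k is k'.+1 then lp_bracket (lp_rename (fun i => i.*2) (lie_derived_poly k'))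
                                (lp_rename (fun i => i.*2.+1) (lie_derived_poly k'))
  else lp_var F 0.

Lemma lie_derived_polyE (A : algType F) (a : nat -> A) k :
  lie_derived A k (list_eval a (lie_derived_poly k)).
Proof.
elim: k a => // k IH a U [_]; apply; rewrite list_eval_bracket !list_eval_rename.
exists (list_eval (fun i => a i.*2) (lie_derived_poly k)).
exists (list_eval (fun i => a i.*2.+1) (lie_derived_poly k)).
by split; [exact: IH|exact: IH|].
Qed.

(** [h,e] = 2e, [f,h] = 2f and [e,f] = h with 2 invertible, so each of e, f, h reappears, up to a
    nonzero scalar, at every depth; the variables of even and odd index are assigned
    independently. *)
Lemma lie_derived_poly_sl2 k : has_pchar0 F ->
  forall T : 'M[F]_2, T \in [:: delta_mx 0 1; delta_mx 1 0; delta_mx 0 0 - delta_mx 1 1] ->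
  exists c (a : nat -> 'M[F]_2), c != 0 /\ list_eval a (lie_derived_poly k) = c *: T.
Proof.
move=> char0; have two0 : 2%:R != 0 :> F by have /pcharf0P h := char0; rewrite h.
elim: k => [|k IH] T TT.
  by exists 1, (fun=> T); rewrite oner_eq0 list_eval_var scale1r.
have comb T1 T2 d : d != 0 -> lie_bracket T1 T2 = d *: T ->
    T1 \in [:: delta_mx 0 1; delta_mx 1 0; delta_mx 0 0 - delta_mx 1 1] ->
    T2 \in [:: delta_mx 0 1; delta_mx 1 0; delta_mx 0 0 - delta_mx 1 1] ->
    exists c (a : nat -> 'M[F]_2), c != 0 /\ list_eval a (lie_derived_poly k.+1) = c *: T.
  move=> d0 dT /IH[c1 [a1 [c10 a1E]]] /IH[c2 [a2 [c20 a2E]]].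
  exists (c1 * c2 * d), (fun i => if odd i then a2 i./2 else a1 i./2).
  rewrite !mulf_neq0 //; split=> //.
  rewrite list_eval_bracket !list_eval_rename.
  have -> : (fun i => if odd i.*2 then a2 i.*2./2 else a1 i.*2./2) = a1.
    by apply/funext => i; rewrite odd_double doubleK.
  have -> : (fun i => if odd i.*2.+1 then a2 i.*2.+1./2 else a1 i.*2.+1./2) = a2.
    by apply/funext => i /=; rewrite odd_double /= uphalf_double.
  rewrite a1E a2E -scalerA -dT /lie_bracket -!scalerAl -!scalerAr scalerBr !scalerA.
  by rewrite [c2 * c1]mulrC.
move: TT; rewrite !inE => /or3P[] /eqP TE; subst T.
- apply: (comb (delta_mx 0 0 - delta_mx 1 1) (delta_mx 0 1) 2%:R); rewrite ?inE ?eqxx ?orbT //.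
  by rewrite /lie_bracket -!mulmxE; apply: mx2_eq; rewrite !mxE !big_ord_recl !big_ord0 !mxE /=; ring.
- apply: (comb (delta_mx 1 0) (delta_mx 0 0 - delta_mx 1 1) 2%:R); rewrite ?inE ?eqxx ?orbT //.
  by rewrite /lie_bracket -!mulmxE; apply: mx2_eq; rewrite !mxE !big_ord_recl !big_ord0 !mxE /=; ring.
- apply: (comb (delta_mx 0 1) (delta_mx 1 0) 1); rewrite ?inE ?eqxx ?orbT ?oner_eq0 //.
  by rewrite e01_e10 scale1r.
Qed.

Lemma lie_solvable_nonmatrix (A : algType F) : has_pchar0 F ->
  lie_solvable A -> satisfies_nonmatrix_identity A.
Proof.
move=> char0 [k Ak]; exists (nc_of_list (lie_derived_poly k)).
  move=> h; have [c [a [c0]]] := @lie_derived_poly_sl2 k char0 (delta_mx 0 1) (mem_head _ _).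
  rewrite -nc_of_listE h => /esym/eqP; rewrite scaler_eq0 (negPf c0) /= => /eqP/matrixP/(_ 0 1).
  by rewrite !mxE !eqxx => /eqP; rewrite oner_eq0.
by move=> a; rewrite nc_of_listE; have := lie_derived_polyE a k; rewrite Ak.
Qed.

End NonmatrixIdentities.

Section PositiveCharacteristic.
Variables (F : fieldType) (p : nat).
Hypothesis charF : p \in [pchar F].

Lemma exponent_bound m : exists t, (m <= p ^ t)%N.
Proof. by exists m; apply: ltnW; apply: ltn_expl; apply: prime_gt1; apply: pcharf_prime charF. Qed.

Lemma nil_commutators_power (A : algType F) m : nil_commutators A m ->
  exists t, forall x y z : A, (lie_bracket x y * z) ^+ (p ^ t)%N = 0.
Proof.
move=> Am; have [t mt] := exponent_bound m; exists t => x y z.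
by rewrite -(subnK mt) exprD Am mulr0.
Qed.

Lemma nil_commutators_group_power (A : unitAlgType F) m : nil_commutators A m ->
  exists t, forall x y : unit_group A, ([~ x, y] ^+ (p ^ t) = 1)%g.
Proof.
(* For u = a^-1 b^-1 [a,b] it is u^(m+1) that has ([a,b] a^-1 b^-1)^m as a factor, hence the bound m
   + 1. *)
move=> Am; have [t mt] := exponent_bound m.+1; exists t => x y; apply: val_inj.
have valX (g : unit_group A) k : \val (g ^+ k)%g = (\val g) ^+ k.
  by elim: k => [|k IH]; rewrite ?expg0 // expgS exprS -IH.
rewrite valX; set a := \val x; set b := \val y.
have au : a \is a GRing.unit by apply: unit_valP.
have bu : b \is a GRing.unit by apply: unit_valP.
have -> : \val [~ x, y]%g = 1 + a^-1 * b^-1 * lie_bracket a b.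
  rewrite commgEl conjgE /= -/a -/b /lie_bracket mulrBr !mulrA.
  by rewrite divrK // mulVr // addrC subrK.
set u := a^-1 * b^-1 * _.
have charA : p \in [pchar A] by apply: (rmorph_pchar (in_alg A)).
have frob k : (1 + u) ^+ (p ^ k) = 1 + u ^+ (p ^ k).
  elim: k => [|k IH]; first by rewrite !expr1.
  rewrite expnSr !exprM IH -!(pFrobenius_autE charA) pFrobenius_autD_comm ?pFrobenius_aut1 //.
  exact: commr_sym (commr1 _).
rewrite frob -(subnK mt) exprD.
have -> : u ^+ m.+1 = a^-1 * b^-1 * (lie_bracket a b * (a^-1 * b^-1)) ^+ m * lie_bracket a b.
  rewrite /u; elim: (m) => [|k IH]; first by rewrite expr1 expr0 mulr1.
  by rewrite exprS IH [in RHS]exprS !mulrA.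
by rewrite Am mulr0 mul0r mulr0 addr0.
Qed.

End PositiveCharacteristic.

(** * The Nagata-Higman theorem *)

Section NagataHigman.
Variables (F : fieldType) (E : algType F).
Hypotheses (Finf : infinite_set [set: F]) (char0 : has_pchar0 F).
Variable N : set E.
Hypotheses (subN : is_subspace N) (NM : forall x y, N x -> N y -> N (x * y)).

Definition absorbing (I : set E) : Prop :=
  [/\ is_subspace I, I `<=` N, forall x i, N x -> I i -> I (x * i) &
      forall x i, N x -> I i -> I (i * x)].

Lemma subspace_power_linearize (I : set E) n x y : is_subspace I ->
  (forall c : F, I ((x + c *: y) ^+ n.+1)) -> I (\sum_(i < n.+1) x ^+ i * y * x ^+ (n - i)).
Proof.
move=> subI H; pose p : {poly E} := x%:P + y%:P * 'X.
have c0 k : (p ^+ k)`_0 = x ^+ k.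
  by elim: k => [|k IH]; rewrite ?coef1 // !exprS coef0M IH coefD coefC coefMX addr0.
have c1 k : (p ^+ k.+1)`_1 = \sum_(i < k.+1) x ^+ i * y * x ^+ (k - i).
  elim: k => [|k IH]; first by rewrite big_ord1 expr1 mul1r mulr1 coefD coefC coefMX coefC /= add0r.
  rewrite exprS mulrDl coefD coefCM -mulrA coefCM coefXM /= c0 IH.
  rewrite [RHS]big_ord_recl expr0 mul1r subn0 addrC; congr (_ + _).
  by rewrite mulr_sumr; apply: eq_bigr => i _; rewrite !mulrA -exprS.
rewrite -c1; have [sz|sz] := ltnP 1 (size (p ^+ n.+1)); last first.
  by rewrite nth_default //; apply: subspace0.
apply: (@polynomial_coef_mem F Finf E I [::] _ (fun i => (p ^+ n.+1)`_i) subI _ 1%N sz) => c _.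
have pc : p.[c%:A] = x + c *: y by rewrite hornerD hornerMX !hornerC mulr_algr.
have -> : \sum_(d < size (p ^+ n.+1)) c ^+ d *: (p ^+ n.+1)`_d = (p ^+ n.+1).[c%:A].
  by rewrite horner_coef; apply: eq_bigr => d _; rewrite exprZn expr1n mulr_algr.
have -> : (p ^+ n.+1).[c%:A] = (x + c *: y) ^+ n.+1; last exact: H.
elim: n.+1 => [|k IHk]; first by rewrite hornerC.
by rewrite !exprS hornerM_comm ?IHk ?pc // /comm_poly in_alg_comm_mul.
Qed.

Lemma N_exp x n : N x -> N (x ^+ n.+1).
Proof. by move=> Nx; elim: n => // n IH; rewrite exprS; apply: NM. Qed.

Lemma absorbing_expr (I : set E) i x n : absorbing I -> N x -> I i -> I (i * x ^+ n).
Proof.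
move=> [_ _ _ Ir] Nx Ii; case: n => [|n]; first by rewrite mulr1.
by apply: Ir => //; apply: N_exp.
Qed.

Lemma absorbing_exprl (I : set E) i x n : absorbing I -> N x -> I i -> I (x ^+ n * i).
Proof.
move=> [_ _ Il _] Nx Ii; case: n => [|n]; first by rewrite mul1r.
by apply: Il => //; apply: N_exp.
Qed.

(* Sum x^i z y^j x^(n-i) y^(n-j) over i and j: summing over i first gives an element of I,
   and summing over j first leaves only the terms with i = n. *)
Lemma higman_identity (I : set E) n x y z : absorbing I ->
  (forall x, N x -> I (x ^+ n.+1)) -> N x -> N y -> N z -> I (x ^+ n * z * y ^+ n).
Proof.
move=> II NI Nx Ny Nz; have [subI IN Il Ir] := II.
have lin u v : N u -> N v -> I (\sum_(i < n.+1) u ^+ i * v * u ^+ (n - i)).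
  move=> Nu Nv; apply: subspace_power_linearize => // c; apply: NI.
  by apply: subspaceD => //; apply: subspaceZ.
pose T i j := x ^+ i * z * y ^+ j * x ^+ (n - i) * y ^+ (n - j).
have S1 : I (\sum_(i < n.+1) \sum_(j < n.+1) T i j).
  rewrite exchange_big; apply: subspace_sum => // j _; rewrite /T -mulr_suml.
  apply: absorbing_expr => //; under eq_bigr do rewrite -(mulrA (x ^+ _) z).
  apply: lin => //; case: (nat_of_ord j) => [|k]; first by rewrite mulr1.
  by apply: NM => //; apply: N_exp.
have S2 : I (\sum_(j < n.+1) T n j).
  move: S1; rewrite big_ord_recr /= => S1; rewrite -[X in I X](addKr (\sum_(i < n) \sum_(j < n.+1) T i j)).
  apply: subspaceD => //; apply: subspaceN => //; apply: subspace_sum => // i _.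
  rewrite (eq_bigr (fun j : 'I_n.+1 => x ^+ i * (z * (y ^+ j * x ^+ (n - i) * y ^+ (n - j))))).
    rewrite -mulr_sumr; apply: absorbing_exprl => //; rewrite -mulr_sumr; apply: Il => //.
    by apply: lin => //; rewrite -(subnSK (ltn_ord i)); apply: N_exp.
  by move=> j _; rewrite /T !mulrA.
have n0 : n.+1%:R != 0 :> F by have /pcharf0P -> := char0.
rewrite -[_ * _](scalerK n0) scaler_nat; apply: subspaceZ => //.
rewrite (_ : _ *+ n.+1 = \sum_(j < n.+1) T n j) //.
rewrite (eq_bigr (fun=> x ^+ n * z * y ^+ n)) ?sumr_const ?card_ord // => j _.
by rewrite /T subnn mulr1 -mulrA -exprD subnKC // -ltnS.
Qed.

Fixpoint higman_bound n : nat := if n is n'.+1 then (higman_bound n' + (higman_bound n').+1)%N else 1.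

(** In the induction step the exponent is n + 2; let J be the ideal generated by I and all x^(n+1).
    Then J N J lies in I by [higman_identity], and words of length [higman_bound n] lie in J by
    induction. Two such words separated by one letter lie in I, whence the recursion of
    [higman_bound]. *)
Theorem nagata_higman n (I : set E) : absorbing I -> (forall x, N x -> I (x ^+ n.+1)) ->
  forall w : seq E, (forall x, x \in w -> N x) -> (higman_bound n <= size w)%N ->
  I (\prod_(x <- w) x).
Proof.
elim: n I => [|n IH] I II NI.
  case=> // x w xw _; rewrite big_cons; elim: w x xw => [|y w IHw] x xw.
    by rewrite big_nil mulr1 -[x]expr1; apply: NI; apply: xw; apply: mem_head.
  rewrite big_cons; have [_ _ Il _] := II; apply: Il; first by apply: xw; apply: mem_head.
  by apply: IHw => t tw; apply: xw; rewrite inE tw orbT.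
have [subI IN Il Ir] := II.
pose G : set E := I `|` [set t | exists2 x, N x & t = x ^+ n.+1].
pose J : set E := smallest absorbing G.
have NN : absorbing N by split=> // x i Nx Ni; apply: NM.
have GN : G `<=` N by move=> t [/IN //|[x Nx ->]]; apply: N_exp.
have JJ : absorbing J.
  split; first split.
  - by move=> K [[/subspace0]].
  - move=> c u v Ju Jv K KG; have [[[_ h] _ _ _] _] := KG; apply: h; [exact: Ju|exact: Jv].
  - by apply: smallest_sub.
  - by move=> x i Nx Ji K KG; have [[_ _ h _] _] := KG; apply: h => //; apply: Ji.
  - by move=> x i Nx Ji K KG; have [[_ _ _ h] _] := KG; apply: h => //; apply: Ji.
have [subJ JN _ _] := JJ.
have J1 t : J t -> forall z y, N z -> N y -> I (t * z * y ^+ n.+1).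
  move=> Jt; pose K : set E := [set t | N t /\ forall z y, N z -> N y -> I (t * z * y ^+ n.+1)].
  suff /(_ t Jt)[] : J `<=` K by [].
  apply: smallest_sub; last first.
    move=> u Gu; split; first exact: GN.
    move=> z y Nz Ny; case: Gu => [Iu|[x Nx ->]]; last exact: higman_identity.
    by apply: absorbing_expr => //; apply: Ir.
  split; first split.
  - by split; [exact: subspace0|move=> z y _ _; rewrite !mul0r; apply: subspace0].
  - move=> c u v [Nu Ku] [Nv Kv]; split; first by case: subN => _; apply.
    move=> z y Nz Ny; rewrite !mulrDl -!scalerAl.
    by apply: subspaceD => //; [apply: subspaceZ => //; apply: Ku|apply: Kv].
  - by move=> u [].
  - move=> x u Nx [Nu Ku]; split; first exact: NM.
    by move=> z y Nz Ny; rewrite -!mulrA; apply: Il => //; rewrite mulrA; apply: Ku.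
  - move=> x u Nx [Nu Ku]; split; first exact: NM.
    by move=> z y Nz Ny; rewrite -(mulrA u); apply: Ku => //; apply: NM.
have J2 s : J s -> forall t z, J t -> N z -> I (t * z * s).
  move=> Js; pose K : set E := [set s | N s /\ forall t z, J t -> N z -> I (t * z * s)].
  suff /(_ s Js)[] : J `<=` K by [].
  apply: smallest_sub; last first.
    move=> u Gu; split; first exact: GN.
    move=> t z Jt Nz; case: Gu => [Iu|[x Nx ->]]; last exact: J1.
    by apply: Il => //; apply: NM => //; apply: JN.
  split; first split.
  - by split; [exact: subspace0|move=> t z _ _; rewrite mulr0; apply: subspace0].
  - move=> c u v [Nu Ku] [Nv Kv]; split; first by case: subN => _; apply.
    move=> t z Jt Nz; rewrite mulrDr -scalerAr.
    by apply: subspaceD => //; [apply: subspaceZ => //; apply: Ku|apply: Kv].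
  - by move=> u [].
  - move=> x u Nx [Nu Ku]; split; first exact: NM.
    by move=> t z Jt Nz; rewrite mulrA -(mulrA t); apply: Ku => //; apply: NM.
  - move=> x u Nx [Nu Ku]; split; first exact: NM.
    by move=> t z Jt Nz; rewrite mulrA; apply: Ir => //; apply: Ku.
have JH x : N x -> J (x ^+ n.+1) by move=> Nx K [_]; apply; right; exists x.
move=> w Nw /= sw; set k := higman_bound n in sw.
rewrite -(cat_take_drop k w) big_cat /=.
case E2 : (drop k w) => [|z w2].
  by move: (size_drop k w); rewrite E2 /= => /esym/eqP; rewrite subn_eq0 leqNgt (leq_trans _ sw) // addnS ltnS leq_addr.
have wd y : y \in z :: w2 -> N y by rewrite -E2 => /mem_drop/Nw.
rewrite big_cons mulrA; apply: J2.
- apply: IH => //; first by move=> y yw; apply: wd; rewrite inE yw orbT.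
  have := size_drop k w; rewrite E2 /= => h.
  by rewrite -ltnS h ltn_subRL (leq_trans _ sw) // addnS.
- apply: IH => //; first by move=> y /mem_take/Nw.
  by rewrite size_takel // (leq_trans _ sw) // leq_addr.
- by apply: wd; apply: mem_head.
Qed.

End NagataHigman.

(** * Superalgebras with nil even commutators *)

Section GradedPair.
Variables (F : fieldType) (E : algType F) (m : nat).
Hypotheses (Finf : infinite_set [set: F]) (char0 : has_pchar0 F).
(* B false and B true play the role of the even and odd parts of a superalgebra. *)
Variable B : bool -> set E.
Hypotheses (subB : forall b, is_subspace (B b)) (B1 : B false 1)
  (BM : forall b c x y, B b x -> B c y -> B (b (+) c) (x * y))
  (nilB : forall x y z, B false x -> B false y -> B false z -> (lie_bracket x y * z) ^+ m = 0).

Definition homogeneous (x : E) := exists b, B b x.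

Lemma homogeneousM x y : homogeneous x -> homogeneous y -> homogeneous (x * y).
Proof. by move=> [b Bx] [c By]; exists (b (+) c); apply: BM. Qed.

Lemma homogeneous1 : homogeneous 1. Proof. by exists false. Qed.

(** Within the span of the homogeneous elements, this says that the k-th power of the ideal
    generated by d is zero. *)
Definition nil_ideal (d : E) (k : nat) := forall w : seq E,
  (forall x, x \in w -> homogeneous x) -> (k <= size w)%N -> \prod_(x <- w) (d * x) = 0.

Lemma nil_ideal_leq d k k' : (k <= k')%N -> nil_ideal d k -> nil_ideal d k'.
Proof. by move=> kk' dk w wh sw; apply: dk => //; apply: leq_trans sw. Qed.

(** The n-th power of the ideal generated by D, with words kept as lists so that the letters from D
    can be counted. *)
Definition word_ideal (D : seq E) (n : nat) : set E :=
  [set e | exists2 ws : seq (seq E),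
     (forall w, w \in ws -> (forall x, x \in w -> homogeneous x) /\ (n <= count (mem D) w)%N) &
     e = \sum_(w <- ws) \prod_(x <- w) x].

Section WordIdeal.
Variable D : seq E.

Lemma word_idealD n x y : word_ideal D n x -> word_ideal D n y -> word_ideal D n (x + y).
Proof.
move=> [ws wsP ->] [ws' wsP' ->]; exists (ws ++ ws'); last by rewrite big_cat.
by move=> w; rewrite mem_cat => /orP[/wsP|/wsP'].
Qed.

Lemma word_idealM n n' x y : word_ideal D n x -> word_ideal D n' y -> word_ideal D (n + n') (x * y).
Proof.
move=> [ws wsP ->] [ws' wsP' ->]; exists [seq w ++ w' | w <- ws, w' <- ws'].
  move=> _ /allpairsP[[w w'] /= [/wsP[wh wn] /wsP'[wh' wn'] ->]]; split.
    by move=> x0; rewrite mem_cat => /orP[/wh|/wh'].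
  by rewrite count_cat leq_add.
rewrite big_allpairs_dep mulr_suml; apply: eq_bigr => w _.
by rewrite mulr_sumr; apply: eq_bigr => w' _; rewrite big_cat.
Qed.

Lemma word_ideal_hom x : homogeneous x -> word_ideal D 0 x.
Proof.
move=> xh; exists [:: [:: x]]; last by rewrite !big_seq1.
by move=> w; rewrite inE => /eqP ->; split=> // y; rewrite inE => /eqP ->.
Qed.

Lemma word_ideal_mem x : homogeneous x -> x \in D -> word_ideal D 1 x.
Proof.
move=> xh xD; exists [:: [:: x]]; last by rewrite !big_seq1.
move=> w; rewrite inE => /eqP ->; split; first by move=> y; rewrite inE => /eqP ->.
by rewrite /= xD.
Qed.

Lemma word_idealZ n c x : word_ideal D n x -> word_ideal D n (c *: x).
Proof.
move=> Jx; rewrite -mulr_algl -[n]add0n; apply: word_idealM => //.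
by apply: word_ideal_hom; exists false; apply: subspaceZ.
Qed.

Lemma word_idealB n x y : word_ideal D n x -> word_ideal D n y -> word_ideal D n (x - y).
Proof. by move=> Jx Jy; apply: word_idealD => //; rewrite -scaleN1r; apply: word_idealZ. Qed.

Lemma word_idealMl n x y : homogeneous x -> word_ideal D n y -> word_ideal D n (x * y).
Proof. by move=> xh Jy; rewrite -[n]add0n; apply: word_idealM => //; apply: word_ideal_hom. Qed.

Lemma word_idealMr n x y : homogeneous y -> word_ideal D n x -> word_ideal D n (x * y).
Proof. by move=> xh Jy; rewrite -[n]addn0; apply: word_idealM => //; apply: word_ideal_hom. Qed.

Lemma word_ideal_exp n x k : word_ideal D n x -> word_ideal D (k * n) (x ^+ k).
Proof.
move=> Jx; elim: k => [|k IH]; first by apply: word_ideal_hom; exact: homogeneous1.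
by rewrite exprS mulSn; apply: word_idealM.
Qed.

Lemma word_split d (w : seq E) : (forall x, x \in w -> homogeneous x) ->
  exists u ys, [/\ homogeneous u, \prod_(x <- w) x = u * \prod_(y <- ys) (d * y),
    forall y, y \in ys -> homogeneous y & size ys = count_mem d w].
Proof.
elim: w => [|x w IH] wh.
  by exists 1, [::]; rewrite !big_nil mulr1; split=> //; exact: homogeneous1.
have xh : homogeneous x by apply: wh; apply: mem_head.
have [|u [ys [uh E1 ysh sz]]] := IH; first by move=> y yw; apply: wh; rewrite inE yw orbT.
rewrite big_cons E1 /=; have [xd|xd] := eqVneq x d; last first.
  by exists (x * u), ys; rewrite mulrA; split=> //; apply: homogeneousM.
exists 1, (u :: ys); rewrite big_cons mul1r xd !mulrA; split=> //; first exact: homogeneous1.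
  by move=> y; rewrite inE => /orP[/eqP -> //|/ysh].
by rewrite /= sz.
Qed.

Lemma count_mem_pigeonhole k (w : seq E) : (0 < k)%N -> (size D * k <= count (mem D) w)%N ->
  D = [::] \/ exists2 d, d \in D & (k <= count_mem d w)%N.
Proof.
move=> k0; elim: D => [|d D' IH] h; first by left.
right; have [kd|kd] := leqP k (count_mem d w); first by exists d; rewrite ?mem_head.
have [|D0|[d' d'D kd']] := IH.
- have : (count (mem (d :: D')) w <= count_mem d w + count (mem D') w)%N.
    rewrite -count_predUI; apply: leq_trans (leq_addr _ _); apply: sub_count => x /=.
    by rewrite inE.
  move: h kd; rewrite [size _]/= mulSn.
  move: (count _ w) (count_mem d w) (count _ w) => n1 n2 n3 h1 h2 h3; lia.
- move: h; rewrite D0 /= mul1n => h; exists d; first exact: mem_head.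
  by apply: leq_trans h _; apply: sub_count => x /=; rewrite inE.
- by exists d'; rewrite // inE d'D orbT.
Qed.

Lemma word_ideal_eq0 k x : (0 < k)%N -> D != [::] ->
  (forall d, d \in D -> nil_ideal d k) -> word_ideal D (size D * k) x -> x = 0.
Proof.
move=> k0 D0 Dk [ws wsP ->]; rewrite big_seq big1 // => w /wsP[wh wn].
have [D00|[d dD dw]] := count_mem_pigeonhole k0 wn; first by rewrite D00 in D0.
have [u [ys [_ -> ysh sz]]] := word_split d wh.
by rewrite (Dk d dD) ?mulr0 // sz.
Qed.

End WordIdeal.

(* The occurrences of d in a word are sorted by the parity of the prefix before them;
   consecutive ones in the same class are separated by elements y with d * y even. *)
Lemma parity_split b d (w : seq E) : B b d -> (forall x, x \in w -> homogeneous x) ->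
  exists n : bool -> nat, (n false + n true = size w)%N /\
  forall c, (0 < n c)%N -> exists u ys v, [/\ B c u, forall y, y \in ys -> B b y,
    size ys = (n c).-1 & \prod_(x <- w) (d * x) = u * \prod_(y <- ys) (d * y) * (d * v)].
Proof.
move=> Bd; elim: w => [|x w IH] wh; first by exists (fun=> 0%N); split.
have [e Bx] : homogeneous x by apply: wh; apply: mem_head.
have [|n [nw H]] := IH; first by move=> y yw; apply: wh; rewrite inE yw orbT.
have BX := BM Bd Bx.
exists (fun c => (~~ c) + n (c (+) (b (+) e)))%N; split.
  by rewrite /= -nw; case: (b (+) e) => /=; lia.
move=> c; set f := c (+) (b (+) e); case: (posnP (n f)) => nf.
  rewrite nf addn0; case: c @f nf => // f nf _; exists 1, [::], (x * \prod_(x <- w) (d * x)).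
  by rewrite big_nil !mul1r big_cons mulrA; split.
have [u [ys [v [Bu Bys sz E1]]]] := H f nf; move=> _.
have fe : b (+) e (+) f = c by rewrite /f addbC addbK.
rewrite big_cons E1; case: c @f nf Bu sz fe => f nf Bu sz fe.
  exists (d * x * u), ys, v; split=> //; first by rewrite -fe; apply: BM.
  by rewrite !mulrA.
exists 1, (x * u :: ys), v; split=> //.
- move=> y; rewrite inE => /orP[/eqP ->|/Bys //].
  have -> : b = e (+) f by move: fe; case: (b); case: (e); case: (f).
  exact: BM.
- by rewrite /= sz prednK.
- by rewrite big_cons mul1r !mulrA.
Qed.

(** Of 2k + 1 occurrences of d, at least k + 1 fall in one class of [parity_split]; they enclose k
    factors y of the parity of d. *)
Lemma nil_ideal_parity b d k : B b d ->
  (forall ys : seq E, (forall y, y \in ys -> B b y) -> (k <= size ys)%N ->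
     \prod_(y <- ys) (d * y) = 0) -> nil_ideal d k.*2.+1.
Proof.
move=> Bd H w wh sw; have [n [nw nP]] := parity_split Bd wh.
have [c nc] : exists c, (k < n c)%N.
  have [h|h] := ltnP k (n false); first by exists false.
  by exists true; move: sw; rewrite -nw -addnn; lia.
have [|u [ys [v [_ Bys sz ->]]]] := nP c; first exact: leq_ltn_trans nc.
by rewrite H ?mulr0 ?mul0r // sz; lia.
Qed.

(** If y and y' have the parity of d, so has y d y'; hence the elements d y form a non-unital
    algebra, nil of index n + 1. *)
Lemma nil_ideal_nagata_higman b d n : B b d ->
  (forall y, B b y -> (d * y) ^+ n.+1 = 0) -> nil_ideal d (higman_bound n).*2.+1.
Proof.
move=> Bd dn; apply: (nil_ideal_parity Bd) => ys Bys sz.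
pose N : set E := [set x | exists2 y, B b y & x = d * y].
have subN : is_subspace N.
  split; first by exists 0; rewrite ?mulr0 //; apply: subspace0.
  move=> c _ _ [y By ->] [z Bz ->]; exists (c *: y + z); last by rewrite mulrDr scalerAr.
  by apply: subspaceD => //; apply: subspaceZ.
have NM x y : N x -> N y -> N (x * y).
  move=> [y1 By1 ->] [y2 By2 ->]; exists (y1 * (d * y2)); last by rewrite !mulrA.
  by have := BM By1 (BM Bd By2); rewrite addbb addbF.
have := @nagata_higman F E Finf char0 N subN NM n [set 0] _ _ (map ( *%R d) ys).
rewrite big_map size_map; apply=> //.
- split; first exact: subspace_zero.
  + by move=> x /= ->; apply: subspace0.
  + by move=> x i _ /= ->; rewrite mulr0.
  + by move=> x i _ /= ->; rewrite mul0r.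
- by move=> x [y By ->]; apply: dn.
- by move=> x /mapP[y yys ->]; exists y => //; apply: Bys.
Qed.

Definition even_bound := (higman_bound m).*2.+1.
(** The factor 4 counts the even commutators t1, ..., t4 in [odd_square_nil]; the doubling is there
    because it is (d y)^2 that lies in their ideal. *)
Definition odd_bound := (higman_bound (4 * even_bound).*2).*2.+1.

Lemma bracket_even x y : B false x -> B false y -> B false (lie_bracket x y).
Proof. by move=> Bx By; apply: subspaceB => //; apply: (BM (b := false) (c := false)). Qed.

Lemma even_commutator_nil x y : B false x -> B false y -> nil_ideal (lie_bracket x y) even_bound.
Proof.
move=> Bx By; apply: (nil_ideal_nagata_higman (b := false)); first exact: bracket_even.
by move=> z Bz; rewrite exprSr nilB // mul0r.
Qed.

Lemma bracketMr (s x y : E) : lie_bracket s (x * y) = lie_bracket s x * y + x * lie_bracket s y.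
Proof. by rewrite /lie_bracket mulrBl mulrBr !mulrA addrA subrK. Qed.

(* With D = [a^2, -] the elements D(c y), D(D(y) c), a D(y) = [a^2, a y] and
   D(y) a = [a^2, y a] are all commutators of even elements. *)
Lemma odd_square_nil a c : B true a -> B true c -> nil_ideal (lie_bracket (a * a) c) odd_bound.
Proof.
move=> Ba Bc; set s := a * a; set d := lie_bracket s c.
have Bs : B false s by apply: (BM Ba Ba).
have Bodd x : B true x -> B true (lie_bracket s x).
  by move=> Bx; apply: subspaceB => //; [apply: (BM Bs Bx)|apply: (BM Bx Bs)].
have Bd : B true d by apply: Bodd.
apply: (nil_ideal_nagata_higman Bd) => y By.
pose t1 := lie_bracket s (c * y); pose t2 := lie_bracket s (lie_bracket s y * c).
pose t3 := lie_bracket s (a * y); pose t4 := lie_bracket s (y * a).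
have B1' : B false (c * y) by apply: (BM Bc By).
have B2' : B false (lie_bracket s y * c) by apply: (BM (Bodd _ By) Bc).
have B3' : B false (a * y) by apply: (BM Ba By).
have B4' : B false (y * a) by apply: (BM By Ba).
pose D := [:: t1; t2; t3; t4].
have Dnil t : t \in D -> nil_ideal t even_bound.
  by rewrite !inE => /or4P[] /eqP ->; apply: even_commutator_nil.
have Dmem t : t \in D -> word_ideal D 1 t.
  move=> tD; apply: word_ideal_mem => //; exists false.
  by move: tD; rewrite !inE => /or4P[] /eqP ->; apply: bracket_even.
have h1 z : B true z -> homogeneous z by exists true.
have dyd : d * y * d = t1 * d - c * (t2 - (a * t3 - t4 * a) * c).
  have e1 : d * y = t1 - c * lie_bracket s y by rewrite /t1 bracketMr addrK.
  have e2 : lie_bracket s y * d = t2 - lie_bracket s (lie_bracket s y) * c.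
    by rewrite /t2 bracketMr addrAC subrr add0r.
  have e3 : lie_bracket s (lie_bracket s y) = a * t3 - t4 * a.
    by rewrite /t3 /t4 /lie_bracket /s !mulrBr !mulrBl !mulrA.
  by rewrite e1 mulrBl -mulrA e2 e3.
have J1 : word_ideal D 1 (d * y * (d * y)).
  rewrite mulrA dyd; apply: word_idealMr; first exact: h1.
  apply: word_idealB; first by apply: word_idealMr; [exact: h1|apply: Dmem; rewrite !inE eqxx].
  apply: word_idealMl; first exact: h1.
  apply: word_idealB; first by apply: Dmem; rewrite !inE eqxx orbT.
  apply: word_idealMr; first exact: h1.
  apply: word_idealB.
    by apply: word_idealMl; [exact: h1|apply: Dmem; rewrite !inE eqxx !orbT].
  by apply: word_idealMr; [exact: h1|apply: Dmem; rewrite !inE eqxx !orbT].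
rewrite exprSr -mul2n exprM expr2.
have -> : (d * y * (d * y)) ^+ (4 * even_bound) = 0; last by rewrite mul0r.
apply: (word_ideal_eq0 (k := even_bound) (D := D)) => //.
by rewrite -[X in word_ideal _ X]muln1; apply: word_ideal_exp.
Qed.

Definition super_bracket (b c : bool) (x y : E) := x * y - (-1) ^+ (b && c) *: (y * x).

Lemma super_bracket_mem b c x y : B b x -> B c y -> B (b (+) c) (super_bracket b c x y).
Proof.
move=> Bx By; apply: subspaceB => //; first exact: BM.
by apply: subspaceZ => //; rewrite addbC; apply: BM.
Qed.

Lemma super_bracket_lie b x y : super_bracket b false x y = lie_bracket x y.
Proof. by rewrite /super_bracket andbF expr0 scale1r. Qed.

Lemma super_bracket_word_idealr b c x y D : B b x -> word_ideal D 1 y -> word_ideal D 1 (super_bracket b c x y).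
Proof.
move=> Bx Jy; apply: word_idealB; first by apply: word_idealMl => //; exists b.
by apply: word_idealZ; apply: word_idealMr => //; exists b.
Qed.

Lemma super_bracket_word_ideall b c x y D : B c y -> word_ideal D 1 x -> word_ideal D 1 (super_bracket b c x y).
Proof.
move=> By Jx; apply: word_idealB; first by apply: word_idealMr => //; exists c.
by apply: word_idealZ; apply: word_idealMl => //; exists c.
Qed.

(** Three generators are what the polarization of [a^2, c] in [nil_generated_odd] requires. *)
Definition nil_generated (x : E) := exists D : seq E,
  [/\ D != [::], (size D <= 3)%N, (forall d, d \in D -> homogeneous d /\ nil_ideal d odd_bound)
    & word_ideal D 1 x].

Lemma even_odd_bound : (even_bound <= odd_bound)%N.
Proof.
rewrite /odd_bound /even_bound; set k := (4 * _).*2; have mk : (m <= k)%N.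
  have h n : (n <= higman_bound n)%N by elim: n => //= n; lia.
  by have := h m; rewrite /k; lia.
rewrite ltnS leq_double; elim: k mk => [|k IH]; first by rewrite leqn0 => /eqP ->.
by rewrite leq_eqVlt => /orP[/eqP -> //|]; rewrite ltnS => /IH /=; lia.
Qed.

Lemma nil_generated_even x y : B false x -> B false y -> nil_generated (lie_bracket x y).
Proof.
move=> Bx By; have h : homogeneous (lie_bracket x y) by exists false; apply: bracket_even.
exists [:: lie_bracket x y]; split=> //; last by apply: word_ideal_mem; rewrite ?mem_head.
move=> d; rewrite inE => /eqP ->; split=> //.
by apply: nil_ideal_leq even_odd_bound _; apply: even_commutator_nil.
Qed.

Lemma nil_generated_odd a b c : B true a -> B true b -> B true c ->
  nil_generated (lie_bracket (super_bracket true true a b) c).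
Proof.
move=> Ba Bb Bc; pose d x := lie_bracket (x * x) c.
have Bab : B true (a + b) by apply: subspaceD.
have dh x : B true x -> homogeneous (d x).
  move=> Bx; exists true; have Bxx := BM Bx Bx.
  by apply: subspaceB => //; [apply: (BM Bxx Bc)|apply: (BM Bc Bxx)].
exists [:: d (a + b); d a; d b]; split=> //.
  by move=> x; rewrite !inE => /or3P[] /eqP ->; split; try exact: dh; apply: odd_square_nil.
have -> : lie_bracket (super_bracket true true a b) c = d (a + b) - d a - d b.
  have bD x y : lie_bracket (x + y) c = lie_bracket x c + lie_bracket y c.
    by rewrite /lie_bracket mulrDl mulrDr opprD addrACA.
  have -> : super_bracket true true a b = a * b + b * a.
    by rewrite /super_bracket expr1 scaleN1r opprK.
  rewrite /d (_ : (a + b) * (a + b) = a * a + (a * b + b * a) + b * b).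
    by move: (a * b + b * a) => P; rewrite !bD [RHS]addrAC addrK addrAC subrr add0r.
  by rewrite mulrDl !mulrDr !addrA.
apply: word_idealB; first apply: word_idealB.
- by apply: word_ideal_mem; [exact: dh|rewrite mem_head].
- by apply: word_ideal_mem; [exact: dh|rewrite !inE eqxx orbT].
- by apply: word_ideal_mem; [exact: dh|rewrite !inE eqxx !orbT].
Qed.

Definition super_word (p : 'I_5 -> bool) (x : 'I_5 -> E) : E :=
  let p01 := p 0 (+) p 1 in let p23 := p 2%:R (+) p 3%:R in
  super_bracket (p01 (+) p23) (p 4%:R)
    (super_bracket p01 p23 (super_bracket (p 0) (p 1) (x 0) (x 1))
                           (super_bracket (p 2%:R) (p 3%:R) (x 2%:R) (x 3%:R)))
    (x 4%:R).

Lemma nil_generated_bracketl b c x y : B c y -> nil_generated x -> nil_generated (super_bracket b c x y).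
Proof.
move=> By [D [D0 D3 Dn Jx]]; exists D; split=> //.
exact: super_bracket_word_ideall.
Qed.

Lemma nil_generated_bracketr b c x y : B b x -> nil_generated y -> nil_generated (super_bracket b c x y).
Proof.
move=> By [D [D0 D3 Dn Jx]]; exists D; split=> //.
exact: super_bracket_word_idealr.
Qed.

Lemma nil_generatedZ c x : nil_generated x -> nil_generated (c *: x).
Proof.
by move=> [D [D0 D3 Dn Jx]]; exists D; split=> //; apply: word_idealZ.
Qed.

(** An inner bracket with two even entries is an even commutator. One with two odd entries is an
    even anticommutator; the other inner bracket is then even as well, or odd and
    [nil_generated_odd] applies. If both are mixed, they are odd with an even anticommutator, whose
    bracket with the last entry is again of one of these two kinds. *)
Lemma super_word_nil_generated p x : (forall i, B (p i) (x i)) -> nil_generated (super_word p x).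
Proof.
move=> Bx; rewrite /super_word.
move: (Bx 0) (Bx 1) (Bx 2%:R) (Bx 3%:R) (Bx 4%:R).
move: (x 0) (x 1) (x 2%:R) (x 3%:R) (x 4%:R) => a b c d e.
move: (p 0) (p 1) (p 2%:R) (p 3%:R) (p 4%:R) => pa pb pc pd pe Ba Bb Bc Bd Be.
have BP := super_bracket_mem Ba Bb; have BQ := super_bracket_mem Bc Bd.
have [Eab|nab] := boolP (~~ pa && ~~ pb).
  case/andP: Eab => /negPf pa0 /negPf pb0; subst pa pb.
  rewrite super_bracket_lie; apply: (nil_generated_bracketl _ Be).
  by apply: (nil_generated_bracketl _ BQ); apply: nil_generated_even.
have [Ecd|ncd] := boolP (~~ pc && ~~ pd).
  case/andP: Ecd => /negPf pc0 /negPf pd0; subst pc pd.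
  rewrite super_bracket_lie; apply: (nil_generated_bracketl _ Be).
  by apply: (nil_generated_bracketr _ BP); apply: nil_generated_even.
have [Eab|nab'] := boolP (pa && pb).
  case/andP: Eab => pa1 pb1; rewrite pa1 pb1 in Ba Bb BP *; apply: (nil_generated_bracketl _ Be) => /=.
  have [Ecd|ncd'] := boolP (pc && pd).
    case/andP: Ecd => pc1 pd1; rewrite pc1 pd1 in Bc Bd BQ * => /=; rewrite super_bracket_lie.
    exact: nil_generated_even.
  have pq : pc (+) pd = true by case: (pc) (pd) ncd ncd' => -[].
  rewrite pq in BQ *; rewrite /super_bracket /= expr0 scale1r -/(lie_bracket _ _).
  exact: nil_generated_odd.
have pq : pa (+) pb = true by case: (pa) (pb) nab nab' => -[].
rewrite pq in BP *; have [Ecd|ncd'] := boolP (pc && pd).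
  case/andP: Ecd => pc1 pd1; rewrite pc1 pd1 in Bc Bd BQ *; apply: (nil_generated_bracketl _ Be) => /=.
  rewrite super_bracket_lie /lie_bracket -opprB -scaleN1r; apply: nil_generatedZ.
  exact: nil_generated_odd.
have pq' : pc (+) pd = true by case: (pc) (pd) ncd ncd' => -[].
rewrite pq' in BQ *; case: pe Be => /= Be.
  by rewrite {1}/super_bracket /= expr0 scale1r -/(lie_bracket _ _); apply: nil_generated_odd.
rewrite super_bracket_lie; apply: nil_generated_even => //.
exact: (super_bracket_mem BP BQ).
Qed.

Lemma word_ideal_prod D n (q : 'I_n -> nat) (f : 'I_n -> E) :
  (forall i, word_ideal D (q i) (f i)) -> word_ideal D (\sum_i q i) (\prod_i f i).
Proof.
move=> H; apply: (big_rec2 (fun k x => word_ideal D k x)) => [|i k x _].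
  exact: word_ideal_hom homogeneous1.
exact: word_idealM.
Qed.

Theorem super_word_product p x n (Q : {set 'I_n}) (y : 'I_n -> E) :
  (forall i, B (p i) (x i)) -> (forall j, homogeneous (y j)) -> (3 * odd_bound <= #|Q|)%N ->
  \prod_(j < n) (if j \in Q then super_word p x else y j) = 0.
Proof.
move=> Bx yh Qn; have [D [D0 D3 Dn Jx]] := super_word_nil_generated Bx.
apply: (word_ideal_eq0 (k := odd_bound) (D := D)) => //.
  by move=> d /Dn[].
have : word_ideal D (\sum_j (j \in Q)) (\prod_(j < n) (if j \in Q then super_word p x else y j)).
  by apply: word_ideal_prod => j; case: (j \in Q) => //; apply: word_ideal_hom.
have -> : (\sum_j (j \in Q))%N = #|Q|.
  by rewrite -sum1_card [RHS]big_mkcond; apply: eq_bigr => j _; case: (j \in Q).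
move=> [ws wsP ->]; exists ws => // w /wsP[wh wn]; split=> //.
apply: leq_trans wn; apply: leq_trans Qn; by rewrite leq_mul2r D3 orbT.
Qed.

End GradedPair.

(** * Symmetrizations and alternations *)

Section PermSums.
Variables (F : fieldType) (T : finType) (X : Type) (V : lmodType F).
Hypothesis char0 : has_pchar0 F.
Local Notation fn := ((T -> X) -> V).
Implicit Types (v w : fn) (P Q R S : {set T}).

Definition perm_sum (e : bool) P v : fn := fun x =>
  \sum_(s : {perm T} | perm_on P s) (-1) ^+ (e && odd_perm s) *: v (fun t => x (s t)).

Definition invariant v P := forall (s : {perm T}) x, perm_on P s -> v (fun t => x (s t)) = v x.

Lemma natr_neq0 n : n.+1%:R != 0 :> F.
Proof. by have /pcharf0P -> := char0. Qed.

Lemma mulrn_eq0 (u : V) n : (0 < n)%N -> u *+ n = 0 -> u = 0.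
Proof.
case: n => // n _; rewrite -scaler_nat => /eqP.
by rewrite scaler_eq0 (negPf (natr_neq0 n)) => /eqP.
Qed.

Lemma exists_subset P k : (k <= #|P|)%N -> exists2 S : {set T}, S \subset P & #|S| = k.
Proof.
move=> /card_geqP[s [us sz sP]]; exists [set:: s].
  by apply/fintype.subsetP => t; rewrite inE => /sP.
by rewrite cardsE (card_uniqP us).
Qed.

Lemma invariant_sym_eq0 v P k : invariant v P -> (k <= #|P|)%N ->
  (forall S x, S \subset P -> #|S| = k -> perm_sum false S v x = 0) -> forall x, v x = 0.
Proof.
move=> vP kP H x; have [S SP Sk] := exists_subset kP.
have := H S x SP Sk; rewrite /perm_sum (eq_bigr (fun=> v x)) => [|s sS]; last first.
  by rewrite expr0 scale1r; apply: vP; apply: fintype.subset_trans sS SP.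
rewrite sumr_const; apply: mulrn_eq0; apply/card_gt0P; exists 1%g.
exact: perm_on1.
Qed.

Lemma perm_onJ P (s r : {perm T}) : perm_on P s -> perm_on (r @^-1: P) (r * s * r^-1)%g.
Proof.
move=> sP; apply/fintype.subsetP => t; rewrite !inE !permM; apply: contraNT => rt.
by rewrite (out_perm sP rt) permK.
Qed.

Lemma perm_sum_translate e P v (r : {perm T}) x :
  perm_sum e P (fun y => v (fun t => y (r t))) x
  = perm_sum e (r @^-1: P) v (fun t => x (r t)).
Proof.
rewrite /perm_sum [RHS](reindex_inj (inj_comp (@mulIg _ (r^-1)%g) (@mulgI _ r))) /=.
apply: eq_big => [s|s sP].
  apply/idP/idP => sP; first exact: perm_onJ.
  apply/fintype.subsetP => t; rewrite inE => st.
  have := fintype.subsetP sP (r^-1 t)%g; rewrite !inE !permM permKV; apply.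
  by rewrite (inj_eq perm_inj).
rewrite !odd_permM odd_permV addbAC addbb addFb; congr (_ *: v _).
by apply/funext => t; rewrite !permM permKV.
Qed.

Lemma perm_sumD e P v w x : perm_sum e P (fun y => v y + w y) x = perm_sum e P v x + perm_sum e P w x.
Proof. by rewrite -big_split; apply: eq_bigr => s _; rewrite scalerDr. Qed.

(** Coset decomposition: a permutation of p and S sending q to p is the transposition (p q) followed
    by a permutation of S, with opposite sign when q differs from p. *)
Lemma perm_sum_add1 S p v x : p \notin S ->
  perm_sum true (p |: S) v x
  = perm_sum true S (fun y => v y - \sum_(q in S) v (fun t => y (tperm p q t))) x.
Proof.
move=> pS; rewrite /perm_sum.
rewrite (partition_big (fun s : {perm T} => s^-1 p)%g (mem (p |: S))) /=; last first.
  by move=> s sP; rewrite (perm_closed _ (perm_onV sP)) finset.setU11.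
have fiber q : q \in p |: S ->
    \sum_(s : {perm T} | perm_on (p |: S) s && ((s^-1 p)%g == q))
       (-1) ^+ odd_perm s *: v (fun t => x (s t))
  = \sum_(s : {perm T} | perm_on S s)
       (-1) ^+ (odd_perm s (+) (p != q)) *: v (fun t => x (s (tperm p q t))).
  move=> qP; rewrite (reindex_inj (mulgI (tperm p q))) /=; apply: eq_big => [s|s _].
    rewrite invgM permM tpermV; apply/andP/idP => [[sP /eqP sp]|sS].
      have sp' : (s p = p)%g.
        move: sp => /(congr1 (tperm p q)); rewrite tpermK tpermR => sp.
        by rewrite -{1}sp permKV.
      apply/fintype.subsetP => t; rewrite inE => st; have tp : t != p by apply: contraNneq st => ->; rewrite sp'.
      have sP' : perm_on (p |: S) s.
        have -> : s = (tperm p q * (tperm p q * s))%g by rewrite mulgA tperm2 mul1g.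
        apply: perm_onM => //; apply/fintype.subsetP => u; rewrite inE; case: tpermP => [->|->|]; rewrite ?eqxx //.
        by move=> _; apply: finset.setU11.
      by have := fintype.subsetP sP' t; rewrite !inE st (negPf tp) /=; apply.
    split.
      apply: perm_onM; last by apply: fintype.subset_trans sS (finset.subsetUr _ _).
      apply/fintype.subsetP => u; rewrite inE; case: tpermP => [->|->|]; rewrite ?eqxx //.
      by move=> _; apply: finset.setU11.
    have -> : (s^-1 p = p)%g by apply: (perm_inj (s := s)); rewrite permKV (out_perm sS).
    by rewrite tpermL.
  rewrite odd_permM odd_tperm addbC; congr (_ *: v _).
  by apply/funext => t; rewrite permM.
rewrite (eq_bigr _ fiber) big_setU1 //= eqxx.
rewrite (eq_bigr (fun s : {perm T} => (-1) ^+ odd_perm s *: v (fun t => x (s t)))); last first.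
  by move=> s _; rewrite addbF; congr (_ *: v _); apply/funext => t; rewrite tperm1 perm1.
rewrite exchange_big -big_split /=; apply: eq_bigr => s _.
rewrite scalerBr; congr (_ + _); rewrite scaler_sumr -sumrN; apply: eq_bigr => q qS.
rewrite (_ : p != q); last by apply: contraNneq pS => ->.
by rewrite addbT signrN scaleNr.
Qed.

(** The alternation as a product of Jucys-Murphy factors 1 - sum_q (p q), which can be peeled off
    one variable at a time. *)
Fixpoint alternate (ps : seq T) v : fn :=
  if ps is p :: ps' then alternate ps' (fun y => v y - \sum_(q <- ps') v (fun t => y (tperm p q t)))
  else v.

Lemma alternateE ps v x : uniq ps -> alternate ps v x = perm_sum true [set:: ps] v x.
Proof.
elim: ps v x => [|p ps IH] v x /= => [_|/andP[pps ups]].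
  rewrite /perm_sum (big_pred1 1%g) => [|s]; last first.
    apply/idP/eqP => [s0|->]; last exact: perm_on1.
    by apply/permP => t; rewrite perm1 (out_perm s0) // inE.
  by rewrite odd_perm1 scale1r; congr v; apply/funext => t; rewrite perm1.
rewrite set_cons perm_sum_add1 ?inE // IH //; congr (perm_sum _ _ _ _).
apply/funext => y; congr (_ - _); rewrite big_uniq //.
by apply: eq_bigl => q; rewrite inE.
Qed.

Lemma alternateD ps v w x : alternate ps (fun y => v y + w y) x = alternate ps v x + alternate ps w x.
Proof.
elim: ps v w x => //= p ps IH v w x; rewrite -IH; congr (alternate _ _ _).
by apply/funext => y; rewrite big_split /= opprD addrACA.
Qed.

Lemma alternateZ ps c v x : alternate ps (fun y => c *: v y) x = c *: alternate ps v x.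
Proof.
elim: ps v x => //= p ps IH v x; rewrite -IH; congr (alternate _ _ _).
by apply/funext => y; rewrite -scaler_sumr scalerBr.
Qed.

Lemma alternate_sum ps I (r : seq I) (v : I -> fn) x :
  alternate ps (fun y => \sum_(i <- r) v i y) x = \sum_(i <- r) alternate ps (v i) x.
Proof.
elim: r => [|i r IH]; last first.
  by rewrite big_cons -IH -alternateD; congr (alternate _ _ _); apply/funext => y; rewrite big_cons.
rewrite big_nil -[RHS](scale0r (alternate ps (fun=> 0) x)) -alternateZ.
by congr (alternate _ _ _); apply/funext => y; rewrite big_nil scale0r.
Qed.

(** When v is symmetric over P, the relation says that its symmetrization over P and one further
    variable j is zero. *)
Fixpoint block_relations R v (bs : seq {set T}) : Prop :=
  if bs is P :: bs' then
    [/\ P \subset R, (0 < #|P|)%N,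
        forall j x, j \in R :\: P -> v x + \sum_(i in P) v (fun t => x (tperm i j t)) = 0
      & block_relations (R :\: P) v bs']
  else True.

Fixpoint transversal_of (bs : seq {set T}) (ps : seq T) : Prop :=
  match bs, ps with
  | [::], [::] => True
  | P :: bs', p :: ps' => p \in P /\ transversal_of bs' ps'
  | _, _ => False
  end.

Lemma transversal_mem R v bs ps : block_relations R v bs -> transversal_of bs ps ->
  uniq ps /\ {subset ps <= R}.
Proof.
elim: bs R ps => [|P bs IH] R [|p ps] //= [PR P0 _ rel] [pP tr].
have [ups psR] := IH _ _ rel tr; split.
  by rewrite ups andbT; apply/negP => /psR; rewrite inE pP.
move=> t; rewrite inE => /orP[/eqP ->|/psR]; first exact: (fintype.subsetP PR).
by rewrite inE => /andP[].
Qed.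

(* Summing over p in P turns the sum of the v o (p q) into - v, by the block relation. *)
Lemma alternate_transversal_eq0 R v bs : block_relations R v bs ->
  (forall ps, transversal_of bs ps -> forall x, alternate ps v x = 0) -> forall x, v x = 0.
Proof.
elim: bs R => [|P bs IH] R /=; first by move=> _ /(_ [::] I).
move=> [PR P0 Prel rel] H; apply: (IH _ rel) => ps tr x.
have [ups psR] := transversal_mem rel tr.
have : \sum_(p in P) alternate (p :: ps) v x = 0 by rewrite big1 // => p pP; apply: H.
rewrite /= -big_enum -alternate_sum /=.
have -> : (fun y => \sum_(p <- enum P) (v y - \sum_(q <- ps) v (fun t => y (tperm p q t))))
    = (fun y => (#|P| + size ps)%:R *: v y).
  apply/funext => y; rewrite big_enum sumrB sumr_const exchange_big /= big_seq.
  rewrite (eq_bigr (fun=> - v y)) => [|q /psR qR]; last first.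
    by have /eqP := Prel q y qR; rewrite addrC addr_eq0 => /eqP.
  by rewrite -big_seq big_const_seq count_predT iter_addr_0 mulNrn opprK scaler_nat mulrnDr.
rewrite alternateZ => /eqP; rewrite scaler_eq0 => /orP[|/eqP //].
by move/card_gt0P: P0 => [p pP]; rewrite (cardsD1 p) pP addSn (negPf (natr_neq0 _)).
Qed.

(* Blocks are chosen greedily: P is a largest set such that some nonzero v in W is invariant
   under the permutations of P. *)
Lemma exists_blocks k s R (W : fn -> Prop) v0 x0 : (s * k <= #|R|)%N -> (0 < k)%N ->
  (forall v w, W v -> W w -> W (fun x => v x + w x)) ->
  (forall c v, W v -> W (fun x => c *: v x)) ->
  (forall v (r : {perm T}), perm_on R r -> W v -> W (fun x => v (fun t => x (r t)))) ->
  (forall v P, W v -> P \subset R -> invariant v P -> (k <= #|P|)%N -> forall x, v x = 0) ->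
  W v0 -> v0 x0 != 0 ->
  exists v bs, [/\ W v, exists x, v x != 0, size bs = s & block_relations R v bs].
Proof.
move=> + k0; elim: s R W v0 x0 => [|s IH] R W v0 x0 sR WD WZ WP Wk Wv0 vx0.
  by exists v0, [::]; split=> //; exists x0.
pose ok P := (P \subset R) && `[< exists2 v, W v & invariant v P /\ exists x, v x != 0 >].
have ok0 : ok finset.set0.
  rewrite /ok finset.sub0set; apply/asboolP; exists v0 => //; split; last by exists x0.
  move=> s' x s0; congr v0; apply/funext => t.
  by rewrite (out_perm s0) // inE.
have [P /andP[PR /asboolP[v Wv [vP [x vx]]]] Pmax] := arg_maxnP (fun P => #|P|) ok0.
have Pk : (#|P| < k)%N.
  by rewrite ltnNge; apply/negP => /(Wk v P Wv PR vP)/(_ x) vx0'; rewrite vx0' eqxx in vx.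
have Rk : (k <= #|R|)%N by apply: leq_trans sR; rewrite mulSn leq_addr.
have RP : #|R :\: P| = (#|R| - #|P|)%N by rewrite cardsD (finset.setIidPr PR).
pose W' w := W w /\ invariant w P.
have PRdisj r : perm_on (R :\: P) r -> forall i, i \in P -> r i = i.
  by move=> rRP i iP; rewrite (out_perm rRP) // inE iP.
have [|||||||v' [bs [[Wv' v'P] vx' szb rel]]] := IH (R :\: P) W' v x.
- by rewrite RP; move: sR; rewrite mulSn; lia.
- move=> v1 w1 [Wv1 v1P] [Ww1 w1P]; split; first exact: WD.
  by move=> r y rP; rewrite v1P // w1P.
- by move=> c v1 [Wv1 v1P]; split=> [|r y rP]; [exact: WZ|rewrite v1P].
- move=> v1 r rRP [Wv1 v1P]; split.
    by apply: WP => //; apply: fintype.subset_trans rRP (finset.subsetDl _ _).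
  move=> s' y sP; rewrite -[RHS](v1P s') //; congr v1; apply/funext => t.
  have [tP|tP] := boolP (t \in P).
    by rewrite !(PRdisj r) // perm_closed.
  rewrite [s' t](out_perm sP) //; congr y; apply: (out_perm sP).
  have [rt|rt] := eqVneq (r t) t; first by rewrite rt.
  apply/negP => rtP; move: (PRdisj r rRP _ rtP) => /perm_inj rt'.
  by rewrite rt' eqxx in rt.
- move=> v1 P1 [Wv1 _] P1R; apply: Wk => //; apply: fintype.subset_trans P1R (finset.subsetDl _ _).
- by [].
- exact: vx.
exists v', (P :: bs); split=> //=; first by rewrite szb.
have Rj j : j \in R :\: P -> j \in R by rewrite inE => /andP[].
split=> //.
- rewrite lt0n; apply/eqP => P0.
  have [j jR] : exists j, j \in R by apply/card_gt0P; apply: leq_trans k0 Rk.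
  have okj : ok [set j]%SET.
    rewrite /ok finset.sub1set jR; apply/asboolP; exists v0 => //; split; last by exists x0.
    move=> s' y sj; congr v0; apply/funext => t.
    have [->|tj] := eqVneq t j; last by rewrite (out_perm sj) // inE.
    by apply: congr1; apply/eqP; rewrite -finset.in_set1 perm_closed // finset.set11.
  by have := Pmax _ okj; rewrite /= P0 cards1.
move=> j y jRP; pose w y := v' y + \sum_(i in P) v' (fun t => y (tperm i j t)).
have jP : j \notin P by move: jRP; rewrite inE => /andP[].
have wE z : w z = \sum_(i in j |: P) v' (fun t => z (tperm i j t)).
  rewrite big_setU1 //=; congr (_ + _); congr v'; apply/funext => t.
  by rewrite tperm1 perm1.
apply: contrapT => /eqP wy.
suff okw : ok (j |: P) by have := Pmax _ okw; rewrite /= cardsU1 jP add1n ltnn.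
rewrite /ok finset.subUset finset.sub1set Rj //= PR; apply/asboolP; exists w; last split.
- apply: (WD _ _ Wv').
  rewrite (_ : (fun _ => _) = (fun y => \sum_(i <- enum P) v' (fun t => y (tperm i j t)))); last first.
    by apply/funext => z; rewrite big_enum.
  have : {subset enum P <= P} by move=> i; rewrite mem_enum.
  elim: (enum P) => [_|i l IHl lP].
    rewrite (_ : (fun _ => _) = (fun y => 0 *: v' y)); last by apply/funext => z; rewrite big_nil scale0r.
    exact: WZ.
  rewrite (_ : (fun _ => _) = (fun y => v' (fun t => y (tperm i j t)) +
      \sum_(i <- l) v' (fun t => y (tperm i j t)))); last by apply/funext => z; rewrite big_cons.
  apply: WD; last by apply: IHl => i' il; apply: lP; rewrite inE il orbT.
  apply: WP => //; apply/fintype.subsetP => t; rewrite inE; case: tpermP => [->|->|]; rewrite ?eqxx //.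
    by move=> _; apply: (fintype.subsetP PR); apply: lP; apply: mem_head.
  by move=> _; apply: Rj.
- move=> s' z sP; rewrite !wE [RHS](reindex_inj (@perm_inj _ s')) /=.
  apply: eq_big => [i|i iP]; first by rewrite perm_closed.
  (* [r] fixes j, hence permutes P, where v' is invariant: [w] is a sum over cosets. *)
  pose r := (tperm i j * s' * tperm (s' i) j)%g.
  have rP : perm_on P r.
    have rjP : perm_on (j |: P) r.
      have tP i' : i' \in j |: P -> perm_on (j |: P) (tperm i' j).
        move=> i'P; apply/fintype.subsetP => t; rewrite inE; case: tpermP => [->|->|]; rewrite ?eqxx //.
        by move=> _; apply: finset.setU11.
      by apply: perm_onM; [apply: perm_onM => //|]; apply: tP; rewrite ?perm_closed.
    have rj : r j = j by rewrite !permM tpermR tpermL.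
    apply/fintype.subsetP => t; rewrite inE => rt; have tj : t != j by apply: contraNneq rt => ->; rewrite rj.
    by have := fintype.subsetP rjP t; rewrite !inE rt (negPf tj) /=; apply.
  rewrite -[RHS](v'P r) //; congr v'; apply/funext => t.
  by rewrite !permM tpermK.
by exists y.
Qed.

(** The analogue for Young diagrams: k^2 boxes force a row or a column of length k. Symmetrizations
    exclude blocks of size k or more, so k blocks fit into k^2 variables; a transversal of them is a
    k-subset, over which the alternation vanishes. *)
Theorem perm_sum_eq0 k Q v : (k * k <= #|Q|)%N -> (0 < k)%N ->
  (forall e P x, P \subset Q -> #|P| = k -> perm_sum e P v x = 0) -> forall x, v x = 0.
Proof.
move=> kQ k0 H x; apply: contrapT => /eqP vx.
pose W w := forall e P x, P \subset Q -> #|P| = k -> perm_sum e P w x = 0.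
have [||||||w [bs [Ww [y wy] szb rel]]] := @exists_blocks k k Q W v x kQ k0.
- by move=> v1 v2 W1 W2 e P z PQ Pk; rewrite perm_sumD W1 // W2 // addr0.
- move=> c v1 W1 e P z PQ Pk; rewrite /perm_sum.
  under eq_bigr do rewrite scalerA mulrC -scalerA.
  by rewrite -scaler_sumr -[\sum_(_ | _) _]/(perm_sum e P v1 z) W1 // scaler0.
- move=> v1 r rQ W1 e P z PQ Pk; rewrite perm_sum_translate; apply: W1.
    apply/fintype.subsetP => t; rewrite inE => /(fintype.subsetP PQ); rewrite perm_closed //.
  by rewrite card_preimset //; apply: perm_inj.
- move=> v1 P W1 PQ v1P kP; apply: (invariant_sym_eq0 v1P kP) => S z SP Sk.
  by apply: W1 => //; apply: fintype.subset_trans SP PQ.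
- by [].
- exact: vx.
move/eqP: wy; apply; apply: (alternate_transversal_eq0 rel) => ps tr z.
have [ups psQ] := transversal_mem rel tr.
rewrite alternateE // Ww //; first by apply/fintype.subsetP => t; rewrite inE => /psQ.
rewrite cardsE (card_uniqP ups) -szb.
by elim: (bs) (ps) tr {rel szb psQ ups} => [|P bs' IH] [|p ps'] //= [_ /IH ->].
Qed.

End PermSums.

(** * Grassmann envelopes *)

Section Grassmann.
Variables (F : fieldType) (A : algType F) (X : finType) (p : pred X).
Local Notation M := ({set X} -> A).
Implicit Types (x y : X) (S : {set X}) (m : M) (w : seq X).

Fact grassmann_unit_neq0 : (fun=> 1 : A) != 0 :> M.
Proof.
by apply/eqP => /(congr1 (fun m : M => m finset.set0))/eqP; rewrite -[_ == _]/(1 == 0 :> A) oner_eq0.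
Qed.

(* The tensor product of A with the superalgebra on square-zero generators x : X, odd when
   p x, is realized by its operators on itself; a function {set X} -> A lists coefficients. *)
Definition grassmann := endo grassmann_unit_neq0.
Local Notation E := grassmann.

Fact gr_const_linear (a : A) : linear (fun m : M => (fun S => a * m S) : M).
Proof. by move=> c m m'; apply/funext => S; rewrite -[LHS]/(a * (c *: m S + m' S)) mulrDr -scalerAr. Qed.
Definition gr_const (a : A) : E := LinearEndo (gr_const_linear a).

Definition gr_sign x S := p x && odd #|[set y in S | (enum_rank y < enum_rank x)%N && p y]|.

Fact gr_gen_linear x :
  linear (fun m : M => (fun S => if x \in S then (-1) ^+ gr_sign x S *: m (S :\ x) else 0) : M).
Proof.
move=> c m m'; apply/funext => S; rewrite -[RHS]/(c *: (if _ then _ else _) + (if _ then _ else _)).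
case: ifP => _; last by rewrite scaler0 addr0.
by rewrite -[_ (S :\ x)]/(c *: m (S :\ x) + m' (S :\ x)) scalerDr !scalerA mulrC.
Qed.
Definition gr_gen x : E := LinearEndo (gr_gen_linear x).

Lemma gr_constE a m S : gr_const a m S = a * m S. Proof. by []. Qed.
Lemma gr_genE x m S :
  gr_gen x m S = if x \in S then (-1) ^+ gr_sign x S *: m (S :\ x) else 0.
Proof. by []. Qed.

Lemma gr_constM a b : gr_const (a * b) = gr_const a * gr_const b.
Proof. by apply: endoP => m; apply/funext => S; rewrite endo_mulE !gr_constE mulrA. Qed.
Lemma gr_constD a b : gr_const (a + b) = gr_const a + gr_const b.
Proof. by apply: endoP => m; apply/funext => S; rewrite gr_constE mulrDl. Qed.
Lemma gr_constZ c a : gr_const (c *: a) = c *: gr_const a.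
Proof. by apply: endoP => m; apply/funext => S; rewrite gr_constE -scalerAl. Qed.
Lemma gr_const1 : gr_const 1 = 1.
Proof. by apply: endoP => m; apply/funext => S; rewrite gr_constE mul1r. Qed.
Lemma gr_const0 : gr_const 0 = 0.
Proof. by rewrite -(scale0r 0) gr_constZ scale0r. Qed.
Lemma gr_const_sum I (r : seq I) (P : pred I) (f : I -> A) :
  gr_const (\sum_(i <- r | P i) f i) = \sum_(i <- r | P i) gr_const (f i).
Proof. by elim/big_rec2: _ => [|i a b _ <-]; rewrite ?gr_const0 ?gr_constD. Qed.

Lemma gr_genC x a : gr_gen x * gr_const a = gr_const a * gr_gen x.
Proof.
apply: endoP => m; apply/funext => S; rewrite !endo_mulE gr_constE !gr_genE gr_constE.
by case: ifP => _; rewrite ?mulr0 // -scalerAr.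
Qed.

Lemma gr_sign_del x y S : x != y -> x \in S ->
  gr_sign y (S :\ x) = gr_sign y S (+) [&& p x, p y & (enum_rank x < enum_rank y)%N].
Proof.
move=> xy xS; rewrite /gr_sign; case: (p y); rewrite ?andbF //=.
set Z := [set z in S | _]; have -> : [set z in S :\ x | (enum_rank z < enum_rank y)%N && p z] = Z :\ x.
  by apply/finset.setP => z; rewrite !inE -!andbA.
rewrite (cardsD1 x Z) !inE xS /= oddD.
case: (enum_rank x < _)%N; case: (p x); case: (odd #|_|) => //.
Qed.

Lemma gr_gen_comm x y : gr_gen x * gr_gen y = (-1) ^+ (p x && p y) *: (gr_gen y * gr_gen x).
Proof.
apply: endoP => m; apply/funext => S.
rewrite endo_scaleE -[RHS]/((-1) ^+ (p x && p y) *: (gr_gen y * gr_gen x) m S) !endo_mulE !gr_genE.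
rewrite !inE; have [->|xy] := eqVneq x y.
  by rewrite /=; case: ifP => _; rewrite ?scaler0.
rewrite /=; case: ifP => xS; case: ifP => yS; rewrite ?scaler0 //.
rewrite !scalerA (gr_sign_del xy xS) (gr_sign_del (x := y)) 1?eq_sym //.
rewrite (_ : S :\ x :\ y = S :\ y :\ x); last by apply/finset.setP => z; rewrite !inE andbCA.
congr (_ *: _); rewrite -!signr_addb; congr (_ ^+ _).
have : (enum_rank x < enum_rank y)%N (+) (enum_rank y < enum_rank x)%N.
  have : enum_rank x != enum_rank y by rewrite (inj_eq enum_rank_inj).
  by rewrite -val_eqE /=; case: ltngtP.
move: (gr_sign x S) (gr_sign y S) (enum_rank x < enum_rank y)%N (enum_rank y < enum_rank x)%N.
by case: (p x) (p y) => -[] [] [] [] [].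
Qed.

Definition gr_word w : E := \prod_(x <- w) gr_gen x.
Definition gr_parity w : bool := foldr (fun x b => p x (+) b) false w.

Lemma gr_word_nil : gr_word [::] = 1. Proof. exact: big_nil. Qed.
Lemma gr_word_cons x w : gr_word (x :: w) = gr_gen x * gr_word w.
Proof. exact: big_cons. Qed.

Lemma gr_word_cat w w' : gr_word (w ++ w') = gr_word w * gr_word w'.
Proof. exact: big_cat. Qed.

Lemma gr_parity_cat w w' : gr_parity (w ++ w') = gr_parity w (+) gr_parity w'.
Proof. by elim: w => [|x w IH] //=; rewrite IH addbA. Qed.

Lemma gr_wordC w a : gr_word w * gr_const a = gr_const a * gr_word w.
Proof.
elim: w => [|x w IH]; first by rewrite gr_word_nil mul1r mulr1.
by rewrite /gr_word big_cons -mulrA IH !mulrA gr_genC.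
Qed.

Lemma gr_gen_word x w : gr_gen x * gr_word w = (-1) ^+ (p x && gr_parity w) *: (gr_word w * gr_gen x).
Proof.
elim: w => [|y w IH]; first by rewrite gr_word_nil mul1r mulr1 andbF scale1r.
rewrite gr_word_cons mulrA gr_gen_comm -scalerAl -[in LHS]mulrA IH.
by rewrite -scalerAr scalerA mulrA -signr_addb andb_addr.
Qed.

Lemma gr_word_comm w w' : gr_word w * gr_word w'
  = (-1) ^+ (gr_parity w && gr_parity w') *: (gr_word w' * gr_word w).
Proof.
elim: w => [|x w IH]; first by rewrite gr_word_nil mul1r mulr1 scale1r.
rewrite gr_word_cons -[in LHS]mulrA IH -scalerAr [in LHS]mulrA [in LHS]gr_gen_word.
by rewrite -scalerAl scalerA -signr_addb /= andb_addl addbC [in RHS]mulrA.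
Qed.

Lemma gr_gen_sq x : gr_gen x * gr_gen x = 0.
Proof.
apply: endoP => m; apply/funext => S; rewrite endo_mulE !gr_genE !inE eqxx /=.
by case: ifP => _; rewrite ?scaler0.
Qed.

Lemma gr_word_not_uniq w : ~~ uniq w -> gr_word w = 0.
Proof.
elim: w => //= x w IH; rewrite gr_word_cons negb_and negbK.
case/orP => [|/IH ->]; last by rewrite mulr0.
case/splitPr => w1 w2.
rewrite gr_word_cat gr_word_cons mulrA gr_gen_word -scalerAl.
by rewrite [in LHS]mulrA -(mulrA (gr_word w1)) gr_gen_sq mulr0 mul0r scaler0.
Qed.

Lemma gr_word_swap w1 w2 w3 x y : p x = p y ->
  gr_word (w1 ++ y :: w2 ++ x :: w3) = (-1) ^+ p x *: gr_word (w1 ++ x :: w2 ++ y :: w3).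
Proof.
move=> pxy; have h : gr_gen y * gr_word w2 * gr_gen x = (-1) ^+ p x *: (gr_gen x * gr_word w2 * gr_gen y).
  rewrite !gr_gen_word -!scalerAl -!(mulrA (gr_word w2)) (gr_gen_comm x y) -scalerAr !scalerA.
  congr (_ *: _); rewrite pxy andbb -!signr_addb; congr (_ ^+ _).
  by case: (p y); case: (gr_parity w2).
rewrite !(gr_word_cat, gr_word_cons) scalerAr; congr (_ * _).
by rewrite !mulrA h -scalerAl.
Qed.

(** A word without repetition moves the value at the empty set to its support. This reads off
    coefficients: a constant times such a word vanishes only if the constant does. *)
Lemma gr_word_eval w m : uniq w ->
  exists b : bool, gr_word w m [set:: w] = (-1) ^+ b *: m finset.set0.
Proof.
elim: w => [|x w IH] /=.
  by move=> _; exists false; rewrite gr_word_nil endo_1E scale1r; congr m; apply/finset.setP => z; rewrite !inE.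
move=> /andP[xw /IH[b wE]]; exists (gr_sign x [set:: x :: w] (+) b).
rewrite gr_word_cons endo_mulE gr_genE inE mem_head.
rewrite (_ : [set:: x :: w] :\ x = [set:: w]); last first.
  by apply/finset.setP => z; rewrite !inE; case: eqVneq => // ->; rewrite (negPf xw).
by rewrite wE scalerA signr_addb.
Qed.

Definition gr_part (b : bool) : set E :=
  comm_span [set gr_const a | a in [set: A]] [set gr_word w | w in [set w | gr_parity w = b]].

Lemma gr_const_subspace : is_subspace [set gr_const a | a in [set: A]].
Proof.
split; first by exists 0; rewrite ?gr_const0.
by move=> c _ _ [a _ <-] [b _ <-]; exists (c *: a + b); rewrite // gr_constD gr_constZ.
Qed.

Lemma gr_part_subspace b : is_subspace (gr_part b).
Proof. exact: span_subspace gr_const_subspace _. Qed.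

Lemma gr_part_mem a w : gr_part (gr_parity w) (gr_const a * gr_word w).
Proof.
exists [:: (gr_const a, gr_word w)]; last by rewrite big_seq1.
by move=> z; rewrite inE => /eqP ->; split; [exists a|exists w].
Qed.

Lemma gr_part_const a : gr_part false (gr_const a).
Proof. by have := gr_part_mem a [::]; rewrite gr_word_nil mulr1. Qed.

Lemma gr_partM b c u v : gr_part b u -> gr_part c v -> gr_part (b (+) c) (u * v).
Proof.
move=> [l lP ->] [l' lP' ->]; rewrite mulr_suml big_seq.
apply: subspace_sum => [|t /lP[[a _ aE] [w wb wE]]]; first exact: gr_part_subspace.
rewrite mulr_sumr big_seq; apply: subspace_sum => [|t' /lP'[[a' _ aE'] [w' wc wE']]].
  exact: gr_part_subspace.
rewrite -aE -wE -aE' -wE' -mulrA (mulrA (gr_word w)) gr_wordC !mulrA -gr_constM -mulrA.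
by rewrite -gr_word_cat -wb -wc -gr_parity_cat; apply: gr_part_mem.
Qed.

(** Even words commute with each other and with constants, so the even part is A with commuting
    coefficients and inherits the identity by [vanishes_comm_span]. *)
Lemma gr_part_nil (k : nat) : infinite_set [set: F] -> nil_commutators A k ->
  forall x y z : E, gr_part false x -> gr_part false y -> gr_part false z ->
  (lie_bracket x y * z) ^+ k = 0.
Proof.
move=> Finf Am x y z Bx By Bz.
pose b i : E := if i == 0%N then x else if i == 1%N then y else z.
rewrite -[LHS]/((lie_bracket (b 0%N) (b 1%N) * b 2%N) ^+ k) -commutator_power_polyE.
apply: (vanishes_comm_span Finf gr_const_subspace
  (K := [set gr_word w | w in [set w | gr_parity w = false]])); last first.
- by move=> [|[|i]].
- move=> c Wc; pose r i := s2val (cid2 (Wc i)).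
  have cE i : c i = gr_const (r i) by rewrite /r; case: cid2.
  rewrite commutator_power_polyE !cE /lie_bracket -!gr_constM -(scaleN1r (gr_const _)) -gr_constZ.
  rewrite -gr_constD -gr_constM scaleN1r.
  have expE a n : gr_const a ^+ n = gr_const (a ^+ n).
    by elim: n => [|n IH]; rewrite ?expr0 ?gr_const1 // !exprS IH gr_constM.
  by rewrite expE Am gr_const0.
- move=> _ _ [w pw <-] [w' pw' <-].
  by rewrite /GRing.comm gr_word_comm pw scale1r.
- by move=> _ _ [w pw <-] [a _ <-]; rewrite /GRing.comm gr_wordC.
Qed.

End Grassmann.

Definition lie_word (R : pzRingType) (x : 'I_5 -> R) : R :=
  lie_bracket (lie_bracket (lie_bracket (x 0) (x 1)) (lie_bracket (x 2%:R) (x 3%:R))) (x 4%:R).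

Definition lie_word_product (R : pzRingType) n (Q : {set 'I_n}) (y : 'I_n -> R)
    (x : 'I_5 -> 'I_n -> R) : R :=
  \prod_(i < n) (if i \in Q then lie_word (x^~ i) else y i).

Section FiveTuples.
Variable T : finType.
(** Nested like the brackets of [lie_word], so that four uses of [super_bracket_sum] produce a sum
    over this type. The default value in [entry] serves as the fifth entry. *)
Definition tup5 := (T * T * (T * T) * T)%type.
HB.instance Definition _ := Finite.on tup5.
Definition entry (t : tup5) (s : 'I_5) : T :=
  let: (((a, b), (c, d)), e) := t in nth e [:: a; b; c; d] s.
Definition mk_tup5 (g : 'I_5 -> T) : tup5 := (((g 0, g 1), (g 2%:R, g 3%:R)), g 4%:R).
Definition slots : seq 'I_5 := [:: 0; 1; 2%:R; 3%:R; 4%:R].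

Lemma mk_tup5K g s : entry (mk_tup5 g) s = g s.
Proof. by case: s => -[|[|[|[|[|]]]]] //= i; congr g; apply: val_inj. Qed.

Lemma entryK t : mk_tup5 (entry t) = t.
Proof. by case: t => [[[a b] [c d]] e]. Qed.

Lemma mem_slots s : s \in slots.
Proof. by case: s => -[|[|[|[|[|]]]]] //= i; rewrite !inE. Qed.

Lemma forall_slots (P : pred 'I_5) :
  [forall s, P s] = [&& P 0, P 1, P 2%:R, P 3%:R & P 4%:R].
Proof.
apply/forallP/idP => [H|]; first by rewrite !H.
case/and5P => ? ? ? ? ? s; have := mem_slots s.
by rewrite !inE => /or4P[/eqP ->|/eqP ->|/eqP ->|/orP[] /eqP ->].
Qed.

End FiveTuples.

(** * Super Lie words with Grassmann coefficients *)

Section GrassmannSigns.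
Variables (F : fieldType) (A : algType F) (T : finType) (p : 'I_5 -> bool).
Local Notation X := ('I_5 * T)%type.
Let px : pred X := fun z => p z.1.
Local Notation gw := (gr_word A px).
Local Notation L := (@gr_const F A X).
Implicit Types (w : seq X) (s : 'I_5) (r : {perm T}).

Lemma gr_mono_mul a a' w w' : L a * gw w * (L a' * gw w') = L (a * a') * gw (w ++ w').
Proof. by rewrite -mulrA (mulrA (gw w)) gr_wordC !mulrA -gr_constM -mulrA gr_word_cat. Qed.

Lemma gr_mono_prod I (l : seq I) (a : I -> A) (w : I -> seq X) :
  \prod_(i <- l) (L (a i) * gw (w i)) = L (\prod_(i <- l) a i) * gw (flatten (map w l)).
Proof.
elim: l => [|i l IH]; first by rewrite !big_nil gr_const1 gr_word_nil mul1r.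
by rewrite !big_cons IH gr_mono_mul.
Qed.

(** The sign of the super bracket cancels the one from exchanging the two Grassmann words, which
    leaves ordinary Lie brackets of the coefficients in A. *)
Lemma super_bracket_sum b c (I J : finType) (P : pred I) (Q : pred J)
    (a : I -> A) (w : I -> seq X) (a' : J -> A) (w' : J -> seq X) :
  (forall i, gr_parity px (w i) = b) -> (forall j, gr_parity px (w' j) = c) ->
  super_bracket b c (\sum_(i | P i) L (a i) * gw (w i)) (\sum_(j | Q j) L (a' j) * gw (w' j))
  = \sum_(t : I * J | P t.1 && Q t.2) L (lie_bracket (a t.1) (a' t.2)) * gw (w t.1 ++ w' t.2).
Proof.
move=> wb wc; rewrite /super_bracket !big_distrlr /= [X in _ - _ *: X]exchange_big /=.
rewrite !pair_big /= scaler_sumr -sumrB; apply: eq_bigr => -[i j] _ /=.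
rewrite !gr_mono_mul (gr_word_cat _ _ (w' j)) gr_word_comm wb wc andbC -gr_word_cat.
rewrite -scalerAr scalerA -signr_addb addbb scale1r -mulrBl; congr (_ * _).
by rewrite /lie_bracket -(scaleN1r (a' j * a i)) gr_constD gr_constZ scaleN1r.
Qed.

Definition word5 (t : tup5 T) : seq X := [seq (s, entry t s) | s <- slots].

Lemma super_word_sum (Q : {set T}) (x : 'I_5 -> T -> A) :
  super_word p (fun s => \sum_(i in Q) L (x s i) * gr_gen A px (s, i))
  = \sum_(t : tup5 T | [forall s, entry t s \in Q])
      L (lie_word (fun s => x s (entry t s))) * gw (word5 t).
Proof.
have e s : \sum_(i in Q) L (x s i) * gr_gen A px (s, i) = \sum_(i in Q) L (x s i) * gw [:: (s, i)].
  by apply: eq_bigr => i _; rewrite gr_word_cons gr_word_nil mulr1.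
rewrite /super_word !e; do 4![rewrite super_bracket_sum; try by move=> i; rewrite /px /= ?addbF ?addbA].
apply: eq_big => -[[[a b] [c d]] e'] //=.
by rewrite forall_slots /= -!andbA.
Qed.

Definition full w := uniq w /\ forall z, z \in w.

Lemma gr_word_tperm w x y : px x = px y -> x != y -> full w ->
  gw (map (tperm x y) w) = (-1) ^+ px x *: gw w.
Proof.
have key w1 w2 w3 x' y' : px x' = px y' -> uniq (w1 ++ x' :: w2 ++ y' :: w3) ->
    gw (map (tperm x' y') (w1 ++ x' :: w2 ++ y' :: w3)) = (-1) ^+ px x' *: gw (w1 ++ x' :: w2 ++ y' :: w3).
  move=> pxy u; rewrite -gr_word_swap // map_cat /= map_cat /= tpermL tpermR.
  have fix_ w' : x' \notin w' -> y' \notin w' -> map (tperm x' y') w' = w'.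
    move=> xw yw; apply: map_id_in => z zw.
    by rewrite tpermD //; [apply: contraNneq xw => ->|apply: contraNneq yw => ->].
  move: u; rewrite cat_uniq /= cat_uniq /= !mem_cat !has_cat /= !inE !negb_or.
  rewrite -!andbA => /and5P[_ xw1 _ yw1 /and5P[_ xw2 _ xw3 /and4P[_ yw2 _ /andP[yw3 _]]]].
  by rewrite !fix_.
move=> pxy xy [uw wX]; have xw := wX x; have yw := wX y.
case/splitPr: xw uw yw => w1 w' uw; rewrite mem_cat inE eq_sym (negPf xy) /=.
case/orP => yw; last by case/splitPr: yw uw => w2 w3 u; apply: key.
move: uw; case/splitPr: yw => w2 w3; rewrite -catA cat_cons => u.
by rewrite tpermC pxy; apply: key.
Qed.

Definition slot_perm s r (z : X) : X := if z.1 == s then (s, r z.2) else z.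

Lemma slot_permM s r r' z : slot_perm s (r * r')%g z = slot_perm s r' (slot_perm s r z).
Proof. by rewrite /slot_perm; case: ifP => /= zs; rewrite ?eqxx ?permM // zs. Qed.

Lemma slot_perm1 s z : slot_perm s 1%g z = z.
Proof. by rewrite /slot_perm; case: eqP => // <-; rewrite perm1; case: z. Qed.

Lemma slot_permK s r : cancel (slot_perm s r) (slot_perm s r^-1%g).
Proof. by move=> z; rewrite -slot_permM mulgV slot_perm1. Qed.

Lemma slot_permKV s r : cancel (slot_perm s r^-1%g) (slot_perm s r).
Proof. by move=> z; rewrite -slot_permM mulVg slot_perm1. Qed.

Lemma full_slot_perm s r w : full w -> full (map (slot_perm s r) w).
Proof.
move=> [uw wX]; split; first by rewrite map_inj_uniq //; apply: can_inj (slot_permK s r).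
by move=> z; rewrite -(slot_permKV s r z) map_f.
Qed.

(** [r] is a product of transpositions, each of which exchanges two generators of equal parity. *)
Lemma gr_word_slot_perm s r w : full w ->
  gw (map (slot_perm s r) w) = (-1) ^+ (p s && odd_perm r) *: gw w.
Proof.
have [ts -> _] := prod_tpermP r; elim: ts w => [|[a b] ts IH] w fw.
  by rewrite big_nil odd_perm1 andbF scale1r (eq_map (slot_perm1 s)) map_id.
rewrite big_cons (eq_map (slot_permM _ _ _)) map_comp IH; last exact: full_slot_perm.
rewrite odd_permM odd_tperm /=; have [->|ab] := eqVneq a b.
  by rewrite tperm1 (eq_map (slot_perm1 s)) map_id.
rewrite (_ : map _ w = map (tperm (s, a) (s, b)) w); last first.
  apply: eq_map => -[s' c]; rewrite /slot_perm /=; case: eqP => [->|ss'].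
    by rewrite !permE /= !xpair_eqE eqxx /=; case: ifP => //; case: ifP.
  by rewrite tpermD // xpair_eqE; apply/negP => /andP[/eqP/esym].
rewrite gr_word_tperm //; last by rewrite xpair_eqE eqxx.
rewrite scalerA -signr_addb /px /=; congr (_ ^+ nat_of_bool _ *: _).
by case: (p s); rewrite ?addbT.
Qed.

Lemma gr_word_perm (r : 'I_5 -> {perm T}) w : full w ->
  gw (map (fun z => (z.1, r z.1 z.2)) w) = (\prod_s (-1) ^+ (p s && odd_perm (r s))) *: gw w.
Proof.
move=> fw; pose f (D : seq 'I_5) z : X := if z.1 \in D then (z.1, r z.1 z.2) else z.
have H (D : seq 'I_5) : uniq D -> full (map (f D) w) /\
    gw (map (f D) w) = (\prod_(s <- D) (-1) ^+ (p s && odd_perm (r s))) *: gw w.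
  elim: D => [_|s D IH /= /andP[sD /IH[fD gD]]].
    by rewrite big_nil scale1r (eq_map (g := id)) ?map_id.
  have -> : map (f (s :: D)) w = map (slot_perm s (r s)) (map (f D) w).
    rewrite -map_comp; apply: eq_map => -[s' c]; rewrite /f /slot_perm /= inE.
    have [->|ss'] := eqVneq s' s; first by rewrite (negPf sD) /= eqxx.
    by case: ifP => /=; rewrite (negPf ss').
  split; first exact: full_slot_perm.
  by rewrite gr_word_slot_perm // gD big_cons scalerA.
have [_ <-] := H (index_enum _) (index_enum_uniq _); congr (gw _).
by apply: eq_map => z; rewrite /f mem_index_enum.
Qed.

End GrassmannSigns.

(** * Symmetrized and alternated products of Lie words *)

Section SignedSum.
Variables (F : fieldType) (A : algType F) (m n : nat).
Hypotheses (Finf : infinite_set [set: F]) (char0 : has_pchar0 F) (Am : nil_commutators A m).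
Local Notation T := 'I_n.
Local Notation X := ('I_5 * T)%type.

Definition perm_family := {ffun 'I_5 -> {perm 'I_n}}.
HB.instance Definition _ := Finite.on perm_family.

Definition family_on (R : 'I_5 -> {set T}) (r : perm_family) : bool :=
  [forall s, perm_on (R s) (r s)].

Definition family_sign (p : 'I_5 -> bool) (r : perm_family) : F :=
  \prod_s (-1) ^+ (p s && odd_perm (r s)).

Definition signed_sum p R (f : ('I_5 -> T -> A) -> A) (x : 'I_5 -> T -> A) : A :=
  \sum_(r | family_on R r) family_sign p r *: f (fun s i => x s (r s i)).

(* super_word is evaluated at a_s = sum_i x_s(i) g_(s,i), where the g_(s,i) are Grassmann
   generators; the factors y_j carry all five generators with second index j, so that every
   word surviving in the product contains each generator exactly once. *)
Lemma signed_sum_full_eq0 p (Q : {set T}) y x : (3 * odd_bound m <= #|Q|)%N ->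
  signed_sum p (fun=> Q) (lie_word_product Q y) x = 0.
Proof.
move=> Qm; pose px : pred X := fun z => p z.1.
pose L := @gr_const F A X; pose gw := gr_word A px.
pose a s := \sum_(i in Q) L (x s i) * gr_gen A px (s, i).
pose const i := mk_tup5 (fun=> i : T).
pose w5 := @word5 T.
have aP s : gr_part px (p s) (a s).
  apply: subspace_sum => [|i _]; first exact: gr_part_subspace.
  have := gr_part_mem px (x s i) [:: (s, i)].
  by rewrite gr_word_cons gr_word_nil mulr1 /= addbF.
have yP j : homogeneous (gr_part px) (L (y j) * gw (w5 (const j))).
  by exists (gr_parity px (w5 (const j))); apply: gr_part_mem.
have one_even : gr_part px false (1 : grassmann A X) by rewrite -gr_const1; apply: gr_part_const.
have := super_word_product Finf char0 (@gr_part_subspace F A X px)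
  one_even (@gr_partM F A X px) (@gr_part_nil F A X px m Finf Am) aP yP Qm.
pose ok (j : T) (t : tup5 T) := if j \in Q then [forall s, entry t s \in Q] else t == const j.
pose c j (t : tup5 T) := if j \in Q then lie_word (fun s => x s (entry t s)) else y j.
rewrite (eq_bigr (fun j => \sum_(t | ok j t) (L (c j t) * gw (w5 t)))) => [|j _]; last first.
  rewrite /ok /c; case: ifP => jQ; first by rewrite super_word_sum.
  by rewrite big_pred1_eq.
rewrite bigA_distr_big_dep /=.
pose base := [seq (s, j) | j <- index_enum T, s <- slots].
have fbase : full base.
  split; last first.
    by case=> s j; apply/allpairsPdep; exists j, s; rewrite mem_index_enum mem_slots.
  by apply: allpairs_uniq => //; [exact: index_enum_uniq|move=> [? ?] [? ?] _ _ [-> ->]].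
(* [f] chooses a term at each position, and [th f] sends (s, j) to the generator used there in slot
   s. Words with a repeated generator vanish; the remaining choices correspond to families of
   permutations through [h] and [h']. *)
pose th (f : {ffun T -> tup5 T}) (z : X) : X := (z.1, entry (f z.2) z.1).
have wE (f : {ffun T -> tup5 T}) : flatten [seq w5 (f j) | j <- index_enum T] = map (th f) base.
  by rewrite /base map_flatten -map_comp; congr flatten.
rewrite (eq_bigr (fun f : {ffun T -> tup5 T} =>
    L (\prod_(i < n) c i (f i)) * gw (map (th f) base))) => [|f _]; last first.
  by rewrite gr_mono_prod wE.
have uniqE f : uniq (map (th f) base) = injectiveb (th f).
  apply: perm_uniq; apply: perm_map; apply: uniq_perm; rewrite ?enum_uniq //; first by case: fbase.
  by move=> z; rewrite mem_enum; case: fbase => _ ->.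
rewrite (bigID (fun f => injectiveb (th f))) /= [X in _ + X]big1 ?addr0; last first.
  by move=> f /andP[_ fi]; rewrite /gw gr_word_not_uniq ?mulr0 // uniqE.
pose h (r : perm_family) : {ffun T -> tup5 T} := [ffun j => mk_tup5 (fun s => r s j)].
pose h' (f : {ffun T -> tup5 T}) : perm_family := 
  [ffun s => insubd (1%g : {perm T}) [ffun j => entry (f j) s]].
have thh r z : th (h r) z = (z.1, r z.1 z.2) by rewrite /th ffunE mk_tup5K.
have h'h r : h' (h r) = r.
  apply/ffunP => s; rewrite ffunE; apply: val_inj; rewrite val_insubd.
  rewrite (_ : [ffun j => _] = val (r s)) ?(valP (r s)) //.
  by apply/ffunP => j; rewrite !ffunE mk_tup5K pvalE.
rewrite (reindex_onto h h') => [|f /andP[_ /injectiveP fi]]; last first.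
  apply/ffunP => j; rewrite ffunE -[RHS]entryK; congr mk_tup5; apply/funext => s.
  rewrite ffunE -pvalE -[pval _]/(val _) insubdK ?ffunE //.
  apply/injectiveP => i i'; rewrite !ffunE => e.
  by have [] : (s, i) = (s, i') by apply: fi; rewrite /th /= e.
rewrite (eq_bigl (family_on (fun=> Q))) => [|r]; last first.
  rewrite h'h eqxx andbT; have -> : injectiveb (th (h r)).
    apply/injectiveP => -[s j] [s' j']; rewrite !thh /= => -[<-] /perm_inj <-.
    by [].
  rewrite andbT; apply/familyP/forallP => [H s|H j].
    apply/fintype.subsetP => j; rewrite inE; apply: contraNT => jQ.
    have := H j; rewrite ffunE unfold_in /ok (negPf jQ) => /eqP/(congr1 (fun t => entry t s)).
    by rewrite !mk_tup5K => ->.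
  rewrite ffunE unfold_in /ok; case: ifP => jQ.
    by apply/forallP => s; rewrite mk_tup5K perm_closed.
  by apply/eqP; congr mk_tup5; apply/funext => s; rewrite (out_perm (H s)) // jQ.
rewrite (eq_bigr (fun r : perm_family =>
    L (family_sign p r *: lie_word_product Q y (fun s i => x s (r s i))) * gw base)) => [|r _]; last first.
  rewrite /L gr_constZ -scalerAl scalerAr; congr (_ * _).
    by congr gr_const; apply: eq_bigr => i _; rewrite /c ffunE; case: ifP.
  by rewrite -gr_word_perm // (eq_map (thh r)).
(* Every surviving word is [base] up to sign, and its total coefficient is read off at the full set
   of generators. *)
rewrite -mulr_suml -gr_const_sum => /(congr1 (fun e : grassmann A X =>
  e (fun S => if S == finset.set0 then 1 else 0) [set:: base]%SET)).
rewrite endo_mulE gr_constE.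
have [b ->] := gr_word_eval px (fun S => if S == finset.set0 then 1 else 0 : A) fbase.1.
rewrite eqxx -scalerAr mulr1 => /eqP; rewrite scaler_eq0 signr_eq0 => /eqP.
exact.
Qed.

End SignedSum.

Section SlotElimination.
Variables (F : fieldType) (A : algType F).
Hypothesis char0 : has_pchar0 F.

Section FixedDegree.
Variable n : nat.
Local Notation T := 'I_n.
Implicit Types (R : 'I_5 -> {set T}) (f : ('I_5 -> T -> A) -> A) (x : 'I_5 -> T -> A).

Lemma family_signM p (r r' : perm_family n) :
  family_sign F p [ffun s => (r s * r' s)%g] = family_sign F p r * family_sign F p r'.
Proof.
rewrite /family_sign -big_split; apply: eq_bigr => s _.
by rewrite ffunE odd_permM andb_addr signr_addb.
Qed.

(** Composing the sum over the subgroup with the one over the whole group repeats the latter as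
    often as the order of the subgroup, a number invertible in characteristic 0. *)
Lemma signed_sum_sub_eq0 p R R' f : (forall s, R' s \subset R s) ->
  (forall x, signed_sum p R' f x = 0) -> forall x, signed_sum p R f x = 0.
Proof.
move=> R'R f0 x; apply: (@mulrn_eq0 F A char0 _ #|[pred r | family_on R' r]|).
  apply/card_gt0P; exists [ffun=> 1%g]; rewrite unfold_in /=; apply/forallP => s.
  by rewrite ffunE perm_on1.
have : signed_sum p R (signed_sum p R' f) x = 0 by apply: big1 => r _; rewrite f0 scaler0.
move=> <-; rewrite /signed_sum; under [RHS]eq_bigr do rewrite scaler_sumr.
rewrite exchange_big /= -sumr_const; apply: eq_bigr => r' /forallP r'R.
pose h (r : perm_family n) : perm_family n := [ffun s => (r' s * r s)%g].
have hinj : injective h.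
  move=> r1 r2 /ffunP e; apply/ffunP => s; apply: (mulgI (r' s)).
  by have := e s; rewrite !ffunE.
rewrite (reindex_inj hinj) /=; apply: eq_big => [r|r _].
  apply: eq_forallb => s; rewrite ffunE.
  have r's : perm_on (R s) (r' s) by apply: fintype.subset_trans (r'R s) (R'R s).
  apply/idP/idP => [rs|]; last exact: perm_onM.
  by rewrite -(mulKg (r' s) (r s)); apply: perm_onM => //; apply: perm_onV.
rewrite family_signM scalerA mulrC; congr (_ *: f _).
by apply/funext => s; apply/funext => i; rewrite ffunE permM.
Qed.

Definition set_slot (d : 'I_5) (z : T -> A) x : 'I_5 -> T -> A :=
  fun s => if s == d then z else x s.

(** With [R d] empty, slot d carries only the identity, so the outer sum can supply the permutations
    of that slot. *)
Lemma perm_sum_signed_sum e P p R f d x z : R d = finset.set0 ->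
  perm_sum e P (fun z => signed_sum p R f (set_slot d z x)) z
  = signed_sum (fun s => if s == d then e else p s) (fun s => if s == d then P else R s) f
      (set_slot d z x).
Proof.
move=> Rd; rewrite /perm_sum /signed_sum; under eq_bigr do rewrite scaler_sumr.
pose h (sr : {perm T} * perm_family n) : perm_family n :=
  [ffun s => if s == d then sr.1 else sr.2 s].
pose h' (r : perm_family n) : {perm T} * perm_family n :=
  (r d, [ffun s => if s == d then 1%g else r s]).
rewrite pair_big /= [RHS](reindex_onto h h') => [|r _]; last first.
  by apply/ffunP => s; rewrite !ffunE /=; case: eqP => [->|].
have r1 (sr : {perm T} * perm_family n) : family_on R sr.2 -> sr.2 d = 1%g.
  move=> /forallP/(_ d); rewrite Rd => s0; apply/permP => i.
  by rewrite perm1 (out_perm s0) // inE.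
apply: eq_big => [[s r]|[s r] /andP[/= sP rR]].
  apply/andP/andP => /= [[sP rR]|[/forallP H /eqP e1]]; split.
  - by apply/forallP => t; rewrite ffunE; case: eqP => // _; have /forallP := rR.
  - rewrite /h' ffunE eqxx; apply/eqP; congr pair; apply/ffunP => t; rewrite !ffunE.
    by case: eqP => // ->; rewrite (r1 (s, r) rR).
  - by have := H d; rewrite ffunE eqxx.
  - apply/forallP => t; have := H t; rewrite ffunE; case: eqP => // -> _ /=.
    by move: e1; rewrite /h' => -[_ <-]; rewrite ffunE eqxx perm_on1.
rewrite scalerA; congr (_ *: f _); last first.
  apply/funext => t; apply/funext => i; rewrite /set_slot ffunE /=; case: eqP => // ->.
  by rewrite (r1 (s, r) rR) perm1.
rewrite /family_sign [in LHS](bigD1 d) // [in RHS](bigD1 d) //= !ffunE !eqxx.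
rewrite (r1 (s, r) rR) odd_perm1 andbF mul1r; congr (_ * _).
by apply: eq_bigr => t /negPf td; rewrite ffunE !td.
Qed.

Lemma signed_sum_set0 p f x : signed_sum p (fun=> finset.set0) f x = f x.
Proof.
rewrite /signed_sum (big_pred1 [ffun=> 1%g]) => [|r].
  rewrite /family_sign big1 => [|s _]; last by rewrite ffunE odd_perm1 andbF.
  by rewrite scale1r; congr f; apply/funext => s; apply/funext => i; rewrite ffunE perm1.
apply/forallP/eqP => [H|-> s]; last by rewrite ffunE perm_on1.
apply/ffunP => s; rewrite ffunE; apply/permP => i.
by rewrite perm1 (out_perm (H s)) // inE.
Qed.

End FixedDegree.

(** The slots below d are already free of permutations; at d = 5 none are left and the product
    itself vanishes. *)
Definition slots_vanish d k := forall p n (Q : {set 'I_n}) y x, (k <= #|Q|)%N ->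
  signed_sum p (fun s => if (s < d)%N then finset.set0 else Q)
    (@lie_word_product A n Q y) x = 0.

(* Positions of Q outside P, where the permutations of the remaining slots are trivial, are
   absorbed into y. *)
Lemma slots_vanishS d k : (d < 5)%N -> (0 < k)%N -> slots_vanish d k -> slots_vanish d.+1 (k * k).
Proof.
move=> d5 k0 V p n Q y x kQ; pose d' := Ordinal d5.
set f := lie_word_product Q y.
pose R (s : 'I_5) := if (s < d.+1)%N then finset.set0 else Q.
have -> : x = set_slot d' (x d') x.
  by apply/funext => s; rewrite /set_slot; case: eqP => [->|].
apply: (perm_sum_eq0 char0 (v := fun z => signed_sum p R f (set_slot d' z x)) kQ k0).
move=> e P z PQ Pk; rewrite perm_sum_signed_sum; last by rewrite /R /= ltnSn.
set p' := fun s => _; apply: (@signed_sum_sub_eq0 _ _ _ (fun s : 'I_5 => if (s < d)%N then finset.set0 else P)).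
  by move=> s; rewrite /R ltnS -val_eqE /=; case: (ltngtP s d).
move=> x'; pose y' i := if i \in Q then lie_word (x'^~ i) else y i.
rewrite -[RHS](V p' n P y' x') ?Pk //; apply: eq_bigr => r /forallP rP.
congr (_ *: _); apply: eq_bigr => i _; rewrite /y'.
have [/(fintype.subsetP PQ) -> //|iP] := boolP (i \in P).
case: ifP => // _; congr (lie_word _); apply/funext => s.
by rewrite (out_perm (rP s)) //; case: ifP; rewrite ?inE.
Qed.

Theorem lie_word_product_eq0 m : infinite_set [set: F] -> nil_commutators A m ->
  exists k, forall n (Q : {set 'I_n}) y x, (k <= #|Q|)%N -> @lie_word_product A n Q y x = 0.
Proof.
move=> Finf Am.
have [k [k0 V]] : exists k, (0 < k)%N /\ slots_vanish 5 k.
  have : (5 <= 5)%N by []; elim: {1 3}5%N => [_|d IH d5].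
    (* This initial bound comes from the Grassmann envelope; each of the five slots squares it. *)
    by exists (3 * odd_bound m)%N; split=> // p n Q y x; apply: signed_sum_full_eq0.
  have [k [k0 V]] := IH (ltnW d5).
  by exists (k * k)%N; rewrite muln_gt0 k0; split=> //; apply: slots_vanishS.
exists k => n Q y x kQ; have := V (fun=> false) n Q y x kQ.
rewrite (_ : (fun s : 'I_5 => _) = fun=> finset.set0) ?signed_sum_set0 //.
by apply/funext => s; rewrite ltn_ord.
Qed.

End SlotElimination.

(** * Lie solvability *)

Lemma smallest_subspace (F : fieldType) (V : lmodType F) (S : set V) :
  is_subspace (smallest (@is_subspace F V) S).
Proof.
split=> [W [[W0 _] _] //|c u v Su Sv W WS].
by have [[_ WD] _] := WS; apply: WD; [apply: Su|apply: Sv].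
Qed.

Section LieWordIdeal.
Variables (F : fieldType) (A : algType F).

Definition lie_letter : Type := (('I_5 -> A) + A)%type.
Definition lie_letter_val (l : lie_letter) : A :=
  match l with inl x => lie_word x | inr y => y end.
Definition is_lie_letter (l : lie_letter) : bool := if l is inl _ then true else false.

(* The elements of the k-th power of the ideal generated by the values of lie_word. *)
Definition lie_word_ideal (k : nat) : set A :=
  [set a | exists2 ws : seq (seq lie_letter),
     all (fun w => (k <= count is_lie_letter w)%N) ws &
     a = \sum_(w <- ws) \prod_(l <- w) lie_letter_val l].
Local Notation J := lie_word_ideal.

Lemma lie_word_idealT a : J 0 a.
Proof. by exists [:: [:: inr a]]; rewrite ?big_seq1. Qed.

Lemma lie_word_ideal_mem x : J 1 (lie_word x).
Proof. by exists [:: [:: inl x]]; rewrite ?big_seq1. Qed.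

Lemma lie_word_idealM j k a b : J j a -> J k b -> J (j + k) (a * b).
Proof.
move=> [ws wsj ->] [ws' wsk ->]; exists [seq w ++ w' | w <- ws, w' <- ws'].
  elim: ws wsj => //= w ws IH /andP[wj /IH wsj]; rewrite all_cat wsj andbT all_map.
  by apply: sub_all wsk => w' w'k /=; rewrite count_cat leq_add.
rewrite big_allpairs_dep mulr_suml; apply: eq_bigr => w _.
by rewrite mulr_sumr; apply: eq_bigr => w' _; rewrite big_cat.
Qed.

Lemma lie_word_idealMl k a b : J k b -> J k (a * b).
Proof. by move=> Jb; apply: (lie_word_idealM (lie_word_idealT a) Jb). Qed.

Lemma lie_word_idealMr k a b : J k a -> J k (a * b).
Proof. by move=> Ja; rewrite -[k]addn0; apply: lie_word_idealM (lie_word_idealT b). Qed.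

Lemma lie_word_ideal_subspace k : is_subspace (J k).
Proof.
split; first by exists [::]; rewrite ?big_nil.
move=> c a b Ja [ws' wsk ->]; have [ws wsj cE] : J k (c *: a).
  by rewrite -mulr_algl; apply: lie_word_idealMl.
by exists (ws ++ ws'); rewrite ?all_cat ?wsj // cE big_cat.
Qed.

Lemma lie_word_ideal_bracket j k a b : J j a -> J k b -> J (j + k) (lie_bracket a b).
Proof.
move=> Ja Jb; apply: subspaceB; first exact: lie_word_ideal_subspace.
  exact: lie_word_idealM.
by rewrite addnC; apply: lie_word_idealM.
Qed.

Lemma lie_word_ideal_eq0 k a :
  (forall n (Q : {set 'I_n}) y x, (k <= #|Q|)%N -> @lie_word_product A n Q y x = 0) ->
  J k a -> a = 0.
Proof.
move=> H [ws wsk ->]; elim: ws wsk => [|w ws IH] /=; first by rewrite big_nil.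
case/andP => wk /IH; rewrite big_cons => ->; rewrite addr0.
pose t := in_tuple w; pose Q := [set i | is_lie_letter (tnth t i)]%SET.
rewrite big_tnth -[RHS](H _ Q (fun i => if tnth t i is inr y then y else 0)
  (fun s i => if tnth t i is inl x then x s else 0)); last first.
  rewrite -sum1_card; move: wk; rewrite -sum1_count big_tnth => wk.
  by rewrite (eq_bigl (fun i => is_lie_letter (tnth t i))) // => i; rewrite inE.
by apply: eq_bigr => i _; rewrite inE; case: (tnth t i).
Qed.

Lemma lie_derived_subspace k : is_subspace (lie_derived A k).
Proof. by case: k => [|k]; [split|apply: smallest_subspace]. Qed.

Lemma mem_lie_derivedS k x y : lie_derived A k x -> lie_derived A k y ->
  lie_derived A k.+1 (lie_bracket x y).
Proof. by move=> Lx Ly W [_]; apply; exists x, y. Qed.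

Lemma lie_derivedS_sub k (W : set A) : is_subspace W ->
  (forall x y, lie_derived A k x -> lie_derived A k y -> W (lie_bracket x y)) ->
  lie_derived A k.+1 `<=` W.
Proof. by move=> subW H; apply: smallest_sub => // _ [x [y [Lx Ly ->]]]; apply: H. Qed.

Lemma lie_bracketDl (R : algType F) c (x y z : R) :
  lie_bracket (c *: x + y) z = c *: lie_bracket x z + lie_bracket y z.
Proof.
by rewrite /lie_bracket mulrDl mulrDr -scalerAl -scalerAr opprD addrACA scalerBr.
Qed.

Lemma lie_bracketDr (R : algType F) c (x y z : R) :
  lie_bracket z (c *: x + y) = c *: lie_bracket z x + lie_bracket z y.
Proof.
by rewrite /lie_bracket mulrDl mulrDr -scalerAl -scalerAr opprD addrACA scalerBr.
Qed.

Lemma lie_bracket0l (R : pzRingType) (x : R) : lie_bracket 0 x = 0.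
Proof. by rewrite /lie_bracket mul0r mulr0 subrr. Qed.

Lemma lie_bracket0r (R : pzRingType) (x : R) : lie_bracket x 0 = 0.
Proof. by rewrite /lie_bracket mul0r mulr0 subrr. Qed.

Lemma bracketl_subspace (W : set A) y : is_subspace W -> is_subspace [set x | W (lie_bracket x y)].
Proof.
move=> subW; split=> [|c u v Wu Wv] /=; first by rewrite lie_bracket0l; apply: subspace0.
by rewrite lie_bracketDl; apply: subspaceD => //; apply: subspaceZ.
Qed.

Lemma bracketr_subspace (W : set A) y : is_subspace W -> is_subspace [set x | W (lie_bracket y x)].
Proof.
move=> subW; split=> [|c u v Wu Wv] /=; first by rewrite lie_bracket0r; apply: subspace0.
by rewrite lie_bracketDr; apply: subspaceD => //; apply: subspaceZ.
Qed.

Lemma lie_derived2_bracket x y a : lie_derived A 1 x -> lie_derived A 1 y ->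
  J 1 (lie_bracket (lie_bracket x y) a).
Proof.
have subJ := lie_word_ideal_subspace 1; have subJa := bracketl_subspace a subJ.
move=> + Ly; apply: (lie_derivedS_sub (bracketl_subspace y subJa)) => x1 x2 _ _ /=.
move: y Ly; apply: (lie_derivedS_sub (bracketr_subspace _ subJa)) => y1 y2 _ _ /=.
(* Index 4 runs past the list and returns the default [a], the last entry of the Lie word. *)
by have := lie_word_ideal_mem (nth a [:: x1; x2; y1; y2]).
Qed.

Lemma lie_derived_word_ideal k : lie_derived A (3 + k) `<=` J (2 ^ k).
Proof.
elim: k => [|k IH].
  have subJ := lie_word_ideal_subspace 1.
  apply: (lie_derivedS_sub subJ) => x y + _; move: x.
  by apply: (lie_derivedS_sub (bracketl_subspace _ subJ)) => x1 x2; apply: lie_derived2_bracket.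
rewrite addnS; apply: (lie_derivedS_sub (lie_word_ideal_subspace _)) => x y /IH Jx /IH Jy.
by rewrite expnS mul2n -addnn; apply: lie_word_ideal_bracket.
Qed.

Lemma lie_word_ideal_leq j k : (j <= k)%N -> J k `<=` J j.
Proof.
move=> jk a [ws wsk ->]; exists ws => //.
by apply: sub_all wsk => w; apply: leq_trans.
Qed.

Theorem lie_word_ideal_lie_solvable k : J k `<=` [set 0] -> lie_solvable A.
Proof.
move=> Jk; exists (3 + k)%N; apply/seteqP; split=> [a /lie_derived_word_ideal Ja|_ ->].
  by apply: Jk; apply: lie_word_ideal_leq Ja; apply/ltnW/ltn_expl.
exact: (subspace0 (lie_derived_subspace _)).
Qed.

End LieWordIdeal.

(** * Solvability of the group of units *)

Section TruncatedExponential.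
Variables (F : fieldType) (E : algType F).
Hypothesis char0 : has_pchar0 F.
Implicit Types (x y : E).

Definition truncated_exp N x : E := \sum_(i < N) (i`!%:R^-1 : F) *: x ^+ i.
Local Notation exp := truncated_exp.

Lemma fact_neq0 n : n`!%:R != 0 :> F.
Proof. by rewrite -(prednK (fact_gt0 n)) natr_neq0. Qed.

(** The vanishing hypothesis removes the terms of total degree at least N, by which the product of
    two truncated series exceeds a truncated one. *)
Lemma truncated_expD N x y : GRing.comm x y ->
  (forall i j, (N <= i + j)%N -> x ^+ i * y ^+ j = 0) -> exp N (x + y) = exp N x * exp N y.
Proof.
move=> cxy xy0; pose a i : E := (i`!%:R^-1 : F) *: x ^+ i; pose b i : E := (i`!%:R^-1 : F) *: y ^+ i.
have expE k : (k`!%:R^-1 : F) *: (x + y) ^+ k = \sum_(i < k.+1) a (k - i)%N * b i.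
  rewrite exprDn_comm // scaler_sumr; apply: eq_bigr => i _.
  rewrite -scaler_nat scalerA /a /b -scalerAl -scalerAr scalerA; congr (_ *: _).
  have ik : (i <= k)%N by rewrite -ltnS.
  have := congr1 (fun n => n%:R : F) (bin_fact ik); rewrite !natrM => <-.
  have := fact_neq0 i; have := fact_neq0 (k - i).
  have : ('C(k, i)%:R : F) != 0 by rewrite -(@prednK 'C(k, i)) ?bin_gt0 // natr_neq0.
  move: (_%:R) (_%:R) (_%:R) => p q r p0 q0 r0.
  by rewrite !invfM mulrAC mulrA; field; rewrite p0 q0 r0.
rewrite /truncated_exp (eq_bigr (fun k : 'I_N => \sum_(i < N | (i <= k)%N) a (k - i)%N * b i)) => [|k _].
  rewrite big_distrlr /= [RHS]exchange_big [LHS](exchange_big_dep predT) //=; apply: eq_bigr => i _.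
  have -> : \sum_(k < N | (i <= k)%N) a (k - i)%N * b i = \sum_(i <= k < N) a (k - i)%N * b i.
    exact/esym/(big_geq_mkord i N predT (fun k => a (k - i)%N * b i)).
  rewrite -[X in \big[_/_]_(X <= _ < _) _]add0n big_addn.
  rewrite -[RHS](big_mkord predT (fun j => a j * b i)) [RHS](big_cat_nat (n := N - i)) ?leq_subr //=.
  rewrite [X in _ = _ + X](_ : _ = 0); last first.
    rewrite big_nat big1 // => j /andP[ij _].
    by rewrite /a /b -scalerAl -scalerAr xy0 ?scaler0 // addnC -leq_subLR.
  by rewrite addr0; apply: eq_bigr => j _; rewrite addnK.
by rewrite expE (big_ord_widen N (fun i => a (k - i)%N * b i)).
Qed.

Lemma truncated_exp_stable N M x : (N <= M)%N -> x ^+ N = 0 -> exp M x = exp N x.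
Proof.
move=> /subnKC <- xN; rewrite /truncated_exp big_split_ord /= [X in _ + X]big1 ?addr0 // => i _.
by rewrite exprD xN mul0r scaler0.
Qed.

Lemma truncated_exp0 N : (0 < N)%N -> exp N 0 = 1.
Proof.
case: N => // N _; rewrite /truncated_exp big_ord_recl big1 => [|i _].
  by rewrite addr0 expr0 invr1 scale1r.
by rewrite expr0n scaler0.
Qed.

Lemma truncated_expNK N x : (0 < N)%N -> x ^+ N = 0 -> exp N x * exp N (- x) = 1.
Proof.
move=> N0 xN; rewrite -truncated_expD ?subrr ?truncated_exp0 //; first exact: commrN.
by move=> i j /subnKC ij; rewrite exprNn mulrA commr_sign -mulrA -exprD -ij exprD xN mul0r mulr0.
Qed.

Lemma truncated_exp_mem (S : set E) N x : is_subspace S -> S 1 ->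
  (forall u v, S u -> S v -> S (u * v)) -> S x -> S (exp N x).
Proof.
move=> subS S1 SM Sx; apply: subspace_sum => // i _; apply: subspaceZ => //.
by elim: (i : nat) => [//|k IH]; rewrite exprS; apply: SM.
Qed.

End TruncatedExponential.

(** * Conjugation by exponentials *)

Section AdjointExponential.
Variables (F : fieldType) (A : algType F).
Hypothesis char0 : has_pchar0 F.
Local Notation E := (endo (oner_neq0 A)).
Implicit Types (x c : A).

Fact lmul_linear x : linear (fun c => x * c).
Proof. by move=> k c d; rewrite mulrDr scalerAr. Qed.
Fact rmul_linear x : linear (fun c => c * x).
Proof. by move=> k c d; rewrite mulrDl scalerAl. Qed.
Definition lmul x : E := LinearEndo (lmul_linear x).
Definition rmul x : E := LinearEndo (rmul_linear x).
Definition ad x : E := rmul x - lmul x.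

Lemma adE x c : ad x c = lie_bracket c x. Proof. by []. Qed.

Lemma lmul_exp x i c : (lmul x ^+ i) c = x ^+ i * c.
Proof.
elim: i => [|i IH]; first by rewrite !expr0 endo_1E mul1r.
by rewrite exprS endo_mulE IH exprS -mulrA.
Qed.

Lemma rmul_exp x i c : (rmul x ^+ i) c = c * x ^+ i.
Proof.
elim: i => [|i IH]; first by rewrite !expr0 endo_1E mulr1.
by rewrite exprS endo_mulE IH exprSr mulrA.
Qed.

Lemma lmul_rmulC x : GRing.comm (lmul x) (rmul x).
Proof. by apply: endoP => c; rewrite !endo_mulE /= mulrA. Qed.

Lemma ad_nilpotent x N i : x ^+ N = 0 -> (N + N <= i)%N -> ad x ^+ i = 0.
Proof.
move=> xN iN; rewrite /ad exprDn_comm; last exact/commrN/commr_sym/lmul_rmulC.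
apply: big1 => j _; rewrite exprNn mulrA commr_sign -mulrA.
have x0 k : (N <= k)%N -> x ^+ k = 0 by move=> /subnKC <-; rewrite exprD xN mul0r.
have [jN|jN] := leqP N j.
  rewrite (_ : lmul x ^+ j = 0) ?mulr0 ?mul0rn //.
  by apply: endoP => c; rewrite lmul_exp x0 // mul0r.
rewrite (_ : rmul x ^+ (i - j) = 0) ?mul0r ?mulr0 ?mul0rn //.
by apply: endoP => c; rewrite rmul_exp x0 ?mulr0 //; lia.
Qed.

(** Right multiplication by x is the sum of the commuting operators left multiplication and ad x, so
    its exponential is the product of theirs. As x^N = 0 and (ad x)^(2N) = 0, terms of total degree
    at least 3N vanish, hence the truncation at 3N. *)
Lemma truncated_exp_conj x N c : (0 < N)%N -> x ^+ N = 0 ->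
  truncated_exp N (- x) * c * truncated_exp N x = truncated_exp (3 * N) (ad x) c.
Proof.
move=> N0 xN; have N3 : (N <= 3 * N)%N by rewrite leq_pmull.
have xN' : (- x) ^+ N = 0 by rewrite exprNn xN mulr0.
rewrite -(truncated_exp_stable N3 xN) -(truncated_exp_stable N3 xN').
have lE M d : truncated_exp M (lmul x) d = truncated_exp M x * d.
  rewrite endo_sumE mulr_suml; apply: eq_bigr => i _.
  by rewrite endo_scaleE lmul_exp scalerAl.
have rE M d : truncated_exp M (rmul x) d = d * truncated_exp M x.
  rewrite endo_sumE mulr_sumr; apply: eq_bigr => i _.
  by rewrite endo_scaleE rmul_exp scalerAr.
rewrite -mulrA; have -> : c * truncated_exp (3 * N) x = truncated_exp (3 * N) x * truncated_exp (3 * N) (ad x) c.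
  rewrite -rE -lE -endo_mulE -truncated_expD //; first by rewrite /ad addrC subrK.
    by apply: commrB; [exact: lmul_rmulC|exact: commr_refl].
  move=> i j ij; have [iN|iN] := leqP N i.
    rewrite (_ : lmul x ^+ i = 0) ?mul0r //.
    by apply: endoP => d; rewrite lmul_exp -(subnKC iN) exprD xN !mul0r.
  by rewrite (ad_nilpotent (i := j) xN) ?mulr0 //; lia.
rewrite mulrA -[RHS]mul1r; congr (_ * _).
have := truncated_expNK char0 (x := - x) (N := 3 * N).
rewrite opprK; apply; first by rewrite muln_gt0.
by rewrite exprNn mulSn [x ^+ _]exprD xN mul0r mulr0.
Qed.

End AdjointExponential.

(** * The action of units on subspaces by conjugation *)

Section UnitConjugation.
Variables (F : fieldType) (A : unitAlgType F).
Local Notation G := (unit_group A).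
Local Notation "# g" := (unit_val g) (at level 2, format "# g").
Implicit Types (g h : G) (a b c : A) (L W I : set A) (P Q : set G).

Lemma unitK g c : (#g)^-1 * (#g * c) = c.
Proof. by rewrite mulKr ?unit_valP. Qed.
Lemma unitVK g c : #g * ((#g)^-1 * c) = c.
Proof. by rewrite mulVKr ?unit_valP. Qed.
Lemma unit_mulV g : #g * (#g)^-1 = 1.
Proof. by rewrite divrr ?unit_valP. Qed.
Lemma unit_mulVl g : (#g)^-1 * #g = 1.
Proof. by rewrite mulVr ?unit_valP. Qed.
Lemma unit_valM g h : #(g * h)%g = #g * #h. Proof. by []. Qed.
Lemma unit_val1 : #(1%g : G) = 1. Proof. by []. Qed.

Definition unit_conj g c : A := (#g)^-1 * c * #g.
Local Notation cj := unit_conj.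

Lemma unit_conjM g h c : cj (g * h)%g c = cj h (cj g c).
Proof. by rewrite /cj unit_valM invrM ?unit_valP // !mulrA. Qed.
Lemma unit_conj1 c : cj 1%g c = c.
Proof. by rewrite /cj unit_val1 invr1 mul1r mulr1. Qed.
Lemma unit_conjK g c : cj g^-1%g (cj g c) = c.
Proof. by rewrite -unit_conjM mulgV unit_conj1. Qed.
Lemma unit_conjVK g c : cj g (cj g^-1%g c) = c.
Proof. by rewrite -unit_conjM mulVg unit_conj1. Qed.
Lemma unit_conjD g a b : cj g (a + b) = cj g a + cj g b.
Proof. by rewrite /cj mulrDr mulrDl. Qed.
Lemma unit_conjZ g k a : cj g (k *: a) = k *: cj g a.
Proof. by rewrite /cj -scalerAr -scalerAl. Qed.
Lemma unit_conjB g a b : cj g (a - b) = cj g a - cj g b.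
Proof. by rewrite unit_conjD -scaleN1r unit_conjZ scaleN1r. Qed.
Lemma unit_conj_mul g a b : cj g (a * b) = cj g a * cj g b.
Proof. by rewrite /cj !mulrA -(mulrA _ #g) unit_mulV mulr1. Qed.
Lemma unit_conj_bracket g a b : cj g (lie_bracket a b) = lie_bracket (cj g a) (cj g b).
Proof. by rewrite unit_conjB !unit_conj_mul. Qed.
Lemma unit_conj_subE g c : cj g c - c = (#g)^-1 * lie_bracket c #g.
Proof. by rewrite /cj /lie_bracket mulrBr mulrA unitK. Qed.

Lemma is_subgroup_mulV P : P 1%g -> (forall g h, P g -> P h -> P (g * h)%g) ->
  (forall g, P g -> P g^-1%g) -> is_subgroup P.
Proof. by move=> P1 PM PV; split=> // g h Pg Ph; apply: PM => //; apply: PV. Qed.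

Lemma subgroupV P g : is_subgroup P -> P g -> P g^-1%g.
Proof. by move=> [P1 PM] Pg; rewrite -[(g^-1)%g]mul1g; apply: PM. Qed.

Lemma subgroupM P g h : is_subgroup P -> P g -> P h -> P (g * h)%g.
Proof. by move=> sP Pg Ph; rewrite -[h]invgK; apply: sP.2 => //; apply: subgroupV. Qed.

Lemma smallest_subgroup P : is_subgroup (smallest (@is_subgroup G) P).
Proof.
split=> [Q [[Q1 _] _] //|g h Pg Ph Q QP].
by have [[_ QM] _] := QP; apply: QM; [apply: Pg|apply: Ph].
Qed.

Lemma derived_groupS_sub k P Q : derived_group G k `<=` P -> is_subgroup Q ->
  (forall g h, P g -> P h -> Q [~ g, h]%g) -> derived_group G k.+1 `<=` Q.
Proof.
by move=> kP sQ PQ; apply: smallest_sub => // _ [g [h [/kP Pg /kP Ph ->]]]; apply: PQ.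
Qed.

Definition conj_stable W := forall g c, W c -> W (cj g c).

Definition fixing L W : set G := [set g | forall c, L c -> W (cj g c - c)].

Lemma fixing_subgroup L W : is_subspace W -> conj_stable L -> conj_stable W ->
  is_subgroup (fixing L W).
Proof.
move=> subW sL sW; apply: is_subgroup_mulV => [c _|g h fg fh c Lc|g fg c Lc] /=.
- by rewrite unit_conj1 subrr; apply: subspace0.
- rewrite unit_conjM -(subrK (cj h c) (cj h _)) -addrA -unit_conjB.
  by apply: subspaceD => //; [apply: sW; apply: fg|apply: fh].
rewrite -opprB; apply: subspaceN => //.
by have := fg _ (sL g^-1%g c Lc); rewrite unit_conjVK.
Qed.

(** As g h = h g [g,h], writing c as the conjugate of c' by h g turns the claim into a comparison of
    the two orders of conjugation on c'. *)
Lemma fixing_commutator L W g h : conj_stable L ->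
  (forall c, L c -> W (cj h (cj g c) - cj g (cj h c))) -> fixing L W [~ g, h]%g.
Proof.
move=> sL H c Lc; have [c' Lc' ->] : exists2 c', L c' & c = cj (h * g)%g c'.
  by exists (cj (h * g)^-1%g c); [apply: sL|rewrite unit_conjVK].
by rewrite /= -unit_conjM -commgC !unit_conjM; apply: H.
Qed.

Lemma unit_val_commutator g h : unit_val [~ g, h]%g - 1 = (#g)^-1 * (#h)^-1 * lie_bracket #g #h.
Proof.
have -> : [~ g, h]%g = (g^-1 * h^-1 * (g * h))%g by rewrite commgEl conjgE !mulgA.
by rewrite mulrBr -[_ * (#h * #g)]mulrA unitK unit_mulVl.
Qed.

Definition one_plus I : set G := [set g | I (#g - 1)].

Lemma one_plus_subgroup I : is_ideal I -> is_subgroup (one_plus I).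
Proof.
move=> II; rewrite /one_plus; apply: is_subgroup_mulV => [|g h Ig Ih|g Ig]; rewrite /mkset.
- by rewrite unit_val1 subrr; apply: ideal0.
- have -> : #g * #h - 1 = (#g - 1) * #h + (#h - 1) by rewrite mulrBl mul1r addrA subrK.
  by apply: idealD => //; apply: ideal_mulr.
- have -> : (#g)^-1 - 1 = - ((#g)^-1 * (#g - 1)) by rewrite mulrBr unit_mulVl mulr1 opprB.
  by apply: idealN => //; apply: ideal_mull.
Qed.

Lemma one_plus_commutator I g h : is_ideal I -> I (lie_bracket #g #h) -> one_plus I [~ g, h]%g.
Proof. by move=> II Igh; rewrite /one_plus /= unit_val_commutator; apply: ideal_mull. Qed.

End UnitConjugation.

(** * Generation of 1 + B by exponentials *)

Section ExponentialGeneration.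
Variables (F : fieldType) (A : unitAlgType F).
Hypothesis char0 : has_pchar0 F.
Local Notation G := (unit_group A).
Local Notation "# g" := (unit_val g) (at level 2, format "# g").
Variable B : set A.
Hypotheses (idB : is_ideal B) (nilB : B `<=` nilpotents A).

Definition exponentials : set G :=
  [set g | exists x N, [/\ B x, (0 < N)%N, x ^+ N = 0 & #g = truncated_exp N x]].

Lemma exponential_exists x N : (0 < N)%N -> x ^+ N = 0 -> exists g : G, #g = truncated_exp N x.
Proof.
move=> N0 xN; have xN' : (- x) ^+ N = 0 by rewrite exprNn xN mulr0.
suff u : truncated_exp N x \is a GRing.unit by exists (UnitGroup u).
apply/unitrP; exists (truncated_exp N (- x)); rewrite truncated_expNK //.
by have := truncated_expNK char0 N0 xN'; rewrite opprK.
Qed.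

Lemma truncated_exp_split N x : exists t : A, truncated_exp N.+2 x = 1 + x + x * x * t /\
  forall z, GRing.comm z x -> GRing.comm z t.
Proof.
exists (\sum_(i < N) ((i.+2)`!%:R^-1 : F) *: x ^+ i); split.
  rewrite /truncated_exp !big_ord_recl /= expr0 expr1 !invr1 !scale1r addrA; congr (_ + _).
  by rewrite mulr_sumr; apply: eq_bigr => i _; rewrite -scalerAr !exprS mulrA.
move=> z zx; apply: commr_sum => i _; rewrite /GRing.comm -scalerAr -scalerAl.
by congr (_ *: _); apply: commrX.
Qed.

(* Multiplying 1 + y by exp(- y) replaces y by a multiple of y^2. *)
Lemma one_plus_exponentials : one_plus B `<=` smallest (@is_subgroup G) exponentials.
Proof.
move=> g0 Bg0; set K := smallest _ _; have sK : is_subgroup K by apply: smallest_subgroup.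
set n := #g0 - 1; have [M nM] := nilB Bg0.
have nM' k : (M <= k)%N -> n ^+ k = 0 by move=> /subnKC <-; rewrite exprD nM mul0r.
(* Induction on d, a bound for M - j: each round raises the power of n dividing g - 1, and n^M =
   0. *)
suff H d j g r : (M <= j + d)%N -> (0 < j)%N -> GRing.comm n r -> #g = 1 + n ^+ j * r -> K g.
  apply: (H M 1%N g0 1); rewrite ?leq_addl //; first exact: commr1.
  by rewrite expr1 mulr1 addrC subrK.
elim: d j g r => [|d IH] j g r Mj j0 nr gE.
  have -> : g = 1%g by apply: val_inj; rewrite /= gE nM' ?mul0r ?addr0 // -(addn0 j).
  by case: sK.
set y := n ^+ j * r in gE; have ny : GRing.comm n y by apply: commrM => //; apply: commrX.
(* M + 2 terms, so that [truncated_exp_split] can separate the constant and the linear one. *)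
have yM : (- y) ^+ M.+2 = 0.
  rewrite exprNn /y exprMn_comm; last exact/commr_sym/commrX/commr_sym.
  by rewrite -exprM nM' ?mul0r ?mulr0 //; nia.
have [e eE] := exponential_exists (ltn0Sn _) yM; have [t [tE ct]] := truncated_exp_split M (- y).
have Ke : K e.
  move=> P [_]; apply; exists (- y), M.+2; split=> //; apply: idealN => //.
  by apply: ideal_mulr => //; case: (j) j0 => // j' _; rewrite exprS; apply: ideal_mulr.
have nt : GRing.comm n t by apply: ct; apply: commrN.
have yt : GRing.comm y t by apply: ct; apply/commrN/commr_refl.
have Kge : K (g * e)%g.
  apply: (IH j.+1 _ (n ^+ j.-1 * r * r * (- 1 + (1 + y) * t))).
  - by rewrite addSnnS.
  - by [].
  - have n1y : GRing.comm n (1 + y) by apply: commrD; [apply: commr1|].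
    apply: commrM; last by apply: commrD; [exact: commrN1|exact: commrM].
    by do 2![apply: commrM => //]; apply/commrX/commr_refl.
  have yy : n ^+ j.+1 * (n ^+ j.-1 * r * r) = y * y.
    rewrite /y !mulrA -exprD -(mulrA _ r (n ^+ j)) (commrX j (commr_sym nr)) mulrA -exprD.
    by congr (n ^+ _ * r * r); case: (j) j0 => // j' _; rewrite addnS addSn.
  rewrite unit_valM gE eE tE [n ^+ j.+1 * _]mulrA yy.
  rewrite mulrNN mulrDr (_ : (1 + y) * (1 - y) = 1 - y * y); last first.
    by rewrite mulrDl mul1r mulrBr mulr1 addrA subrK.
  by rewrite -addrA; congr (_ + _); rewrite mulrDr mulrN1; congr (_ + _); rewrite !mulrDl !mul1r mulrDr !mulrA.
by rewrite -[g](mulgK e); apply: (sK.2).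
Qed.

End ExponentialGeneration.

Lemma lie_jacobi (R : pzRingType) (x y z : R) :
  lie_bracket (lie_bracket z y) x - lie_bracket (lie_bracket z x) y
  = lie_bracket z (lie_bracket y x).
Proof.
have zmodE (V : zmodType) (p q r s t u : V) : p - q - (r - s) - (t - r - (q - u)) = p - t - (u - s).
  by rewrite !opprB addrACA [p - q + _]addrA subrK [s - r + _]addrA subrK addrACA (addrC (- u)) -addrACA.
by rewrite /lie_bracket !mulrBl !mulrBr !mulrA zmodE.
Qed.

Lemma lie_bracket_subr1 (R : pzRingType) (x y : R) : lie_bracket x (y - 1) = lie_bracket x y.
Proof. by rewrite /lie_bracket mulrBr mulrBl mul1r mulr1 opprB addrA subrK. Qed.

Lemma lie_bracket_subl1 (R : pzRingType) (x y : R) : lie_bracket (x - 1) y = lie_bracket x y.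
Proof. by rewrite /lie_bracket mulrBr mulrBl mul1r mulr1 opprB addrA subrK. Qed.

(** * The derived series of the unit group modulo I *)

Section UnitGroupChain.
Variables (F : fieldType) (A : unitAlgType F).
Hypothesis char0 : has_pchar0 F.
Local Notation G := (unit_group A).
Local Notation "# g" := (unit_val g) (at level 2, format "# g").
Local Notation cj := unit_conj.
Local Notation E := (endo (oner_neq0 A)).
Implicit Types (g h : G) (a c d x y : A) (T U V : E).
Variables (B I : set A).
Hypotheses (idB : is_ideal B) (nilB : B `<=` nilpotents A) (commB : forall x y, B (lie_bracket x y)).
Hypotheses (idI : is_ideal I).
Local Notation L := (lie_derived A 1).
Hypothesis commI : forall x y a, L x -> L y -> I (lie_bracket (lie_bracket x y) a).
(** Z is the centre of A modulo I, and D is the centralizer of L modulo I. *)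
Let Z : set A := [set z | forall a, I (lie_bracket z a)].
Let D : set A := [set d | forall c, L c -> I (lie_bracket c d)].

Let subI : is_subspace I. Proof. exact: ideal_subspace. Qed.
Let subZ : is_subspace Z.
Proof.
split=> [a|c u v Zu Zv a] /=; first by rewrite lie_bracket0l; apply: ideal0.
by rewrite lie_bracketDl; apply: subspaceD => //; apply: subspaceZ.
Qed.
Let Lbracket x y : L (lie_bracket x y). Proof. exact: mem_lie_derivedS. Qed.
Let Ibracketl x a : I x -> I (lie_bracket x a).
Proof. by move=> Ix; apply: idealB => //; [apply: ideal_mulr|apply: ideal_mull]. Qed.
Let IZ x : I x -> Z x. Proof. by move=> Ix a; apply: Ibracketl. Qed.
Let stableI : conj_stable I.
Proof. by move=> g c Ic; apply: ideal_mulr => //; apply: ideal_mull. Qed.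

Let bracket_conj g x a : lie_bracket (cj g x) a = cj g (lie_bracket x (cj g^-1%g a)).
Proof. by rewrite unit_conj_bracket unit_conjVK. Qed.

Let stableZ : conj_stable Z.
Proof. by move=> g c Zc a; rewrite bracket_conj; apply: stableI; apply: Zc. Qed.

Let stableL : conj_stable L.
Proof.
have subL := lie_derived_subspace A 1.
move=> g c; apply: (lie_derivedS_sub (k := 0) (W := [set c | L (cj g c)])) => [|x y _ _]; rewrite /mkset.
  split=> [|k u v Lu Lv]; first by rewrite -(scale0r 0) unit_conjZ scale0r; apply: subspace0.
  by rewrite unit_conjD unit_conjZ; apply: (subspaceD subL) => //; apply: (subspaceZ subL).
by rewrite unit_conj_bracket.
Qed.

Let stableD : conj_stable D.
Proof.
move=> g d Dd c Lc; rewrite -[c](unit_conjVK g) -unit_conj_bracket.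
by apply: stableI; apply: Dd; apply: stableL.
Qed.

Let endo_appB (U : E) c d : U (c - d) = U c - U d.
Proof. by rewrite -[- d](@scaleN1r F) endo_appD endo_appZ scaleN1r. Qed.

(** Stability of L and Z is included to make the set closed under products, so that it contains
    truncated exponentials. *)
Definition commuting_operators (T : E) : set E :=
  [set U | [/\ forall c, L c -> L (U c), forall c, Z c -> Z (U c) &
               forall c, L c -> Z (T (U c) - U (T c))]].

Lemma commuting_operators_subspace T : is_subspace (commuting_operators T).
Proof.
have subL := lie_derived_subspace A 1; split.
  split=> c _; rewrite ?endo_0E; [exact: (subspace0 subL)|exact: (subspace0 subZ)|].
  by rewrite endo_app0 subrr; apply: (subspace0 subZ).
move=> k U V [UL UZ UC] [VL VZ VC]; split=> c Wc; rewrite ?endo_addE ?endo_scaleE.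
- by apply: (subspaceD subL); [apply: (subspaceZ subL); apply: UL|apply: VL].
- by apply: (subspaceD subZ); [apply: (subspaceZ subZ); apply: UZ|apply: VZ].
rewrite endo_appD endo_appZ opprD addrACA -scalerBr.
by apply: (subspaceD subZ); [apply: (subspaceZ subZ); apply: UC|apply: VC].
Qed.

Lemma commuting_operatorsM (T U V : E) : (forall c, L c -> L (T c)) ->
  commuting_operators T U -> commuting_operators T V -> commuting_operators T (U * V).
Proof.
move=> TL [UL UZ UC] [VL VZ VC]; split=> c Wc; rewrite ?endo_mulE.
- exact: UL (VL _ Wc).
- exact: UZ (VZ _ Wc).
rewrite -(subrK (U (T (V c))) (T _)) -addrA -endo_appB.
by apply: (subspaceD subZ); [apply: UC (VL _ Wc)|apply: UZ (VC _ Wc)].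
Qed.

Lemma commuting_operators1 (T : E) : commuting_operators T 1.
Proof. by split=> c Wc; rewrite ?endo_1E // subrr; apply: subspace0. Qed.

Lemma commuting_operators_exp (T U : E) N : (forall c, L c -> L (T c)) ->
  commuting_operators T U -> commuting_operators T (truncated_exp N U).
Proof.
move=> TL TU; apply: truncated_exp_mem => //; first exact: commuting_operators_subspace.
  exact: commuting_operators1.
by move=> V V'; apply: commuting_operatorsM.
Qed.

Lemma commuting_operatorsC (T U : E) : (forall c, L c -> L (T c)) -> (forall c, Z c -> Z (T c)) ->
  commuting_operators T U -> commuting_operators U T.
Proof. by move=> TL TZ [UL UZ UC]; split=> // c /UC; rewrite -opprB => /(subspaceN subZ); rewrite opprK. Qed.

(** By the Jacobi identity the two orders differ at c by [c,[y,x]], a bracket of elements of L,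
    which is central modulo I. *)
Lemma ad_commuting x y : commuting_operators (ad x) (ad y).
Proof.
split=> c Wc; rewrite ?adE; first exact: Lbracket.
  by apply: IZ; apply: Wc.
by rewrite lie_jacobi => a; apply: commI => //; apply: Lbracket.
Qed.

Definition conj_commute g h := forall c, L c -> Z (cj h (cj g c) - cj g (cj h c)).

Lemma conj_commuteC g h : conj_commute g h -> conj_commute h g.
Proof. by move=> gh c /gh; rewrite -opprB => /(subspaceN subZ); rewrite opprK. Qed.

Lemma conj_commute_subgroup h : is_subgroup [set g | conj_commute g h].
Proof.
apply: is_subgroup_mulV => [c _|g g' gh gh' c Lc|g gh c Lc].
- by rewrite !unit_conj1 subrr; apply: (subspace0 subZ).
- rewrite !unit_conjM -(subrK (cj g' (cj h (cj g c))) (cj h _)) -addrA -unit_conjB.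
  apply: (subspaceD subZ); first exact: gh' (stableL g Lc).
  exact: stableZ (gh _ Lc).
have := stableZ g^-1%g (gh _ (stableL g^-1%g Lc)); rewrite unit_conjB unit_conjK unit_conjVK -opprB.
by move/(subspaceN subZ); rewrite opprK.
Qed.

Lemma exponentials_conj_commute g h : exponentials B g -> exponentials B h -> conj_commute g h.
Proof.
have cjE (x : A) N (k : G) c : (0 < N)%N -> x ^+ N = 0 -> #k = truncated_exp N x ->
    cj k c = truncated_exp (3 * N) (ad x) c.
  move=> N0 xN kE; rewrite -truncated_exp_conj // /cj kE; congr (_ * _ * _).
  have u : truncated_exp N x \is a GRing.unit by rewrite -kE unit_valP.
  by apply: (mulrI u); rewrite divrr // truncated_expNK.
move=> [x [N [Bx N0 xN gE]]] [y [M [By M0 yM hE]]] c Lc.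
rewrite !(cjE x N g) // !(cjE y M h) //.
have [adL adZ _] := ad_commuting x x.
have yE := commuting_operators_exp (3 * M) adL (ad_commuting x y).
have [EL _ _] := yE.
have [_ _ H] := commuting_operators_exp (3 * N) EL (commuting_operatorsC adL adZ yE).
exact: H.
Qed.

Lemma one_plus_conj_commute g h : one_plus B g -> one_plus B h -> conj_commute g h.
Proof.
move=> /(one_plus_exponentials char0 idB nilB) Kg /(one_plus_exponentials char0 idB nilB) Kh.
have H k : exponentials B k -> conj_commute g k.
  move=> Xk; apply: (Kg [set g | conj_commute g k]); split; first exact: conj_commute_subgroup.
  by move=> x Xx; apply: exponentials_conj_commute.
apply/conj_commuteC; apply: (Kh [set h | conj_commute h g]); split; first exact: conj_commute_subgroup.
by move=> k Xk; apply/conj_commuteC/H.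
Qed.

(** Conjugation by g adds to c an element z central modulo I, and conjugation by h fixes z modulo I.
    So conjugating by g and then h gives, modulo I, the sum of the two single conjugates minus c,
    which is symmetric in g and h. *)
Lemma fixing_conj_commute g h c : fixing L Z g -> fixing L Z h -> L c ->
  I (cj h (cj g c) - cj g (cj h c)).
Proof.
move=> fg fh Lc.
have central k z : Z z -> I (cj k z - z) by move=> Zz; rewrite unit_conj_subE; apply: ideal_mull => //; apply: Zz.
have cjE k k' : fixing L Z k -> fixing L Z k' -> I (cj k' (cj k c) - (cj k' c + cj k c - c)).
  move=> fk fk'; have := central k' _ (fk _ Lc); rewrite unit_conjB.
  move: (cj k' (cj k c)) (cj k' c) (cj k c) => u v w.
  by rewrite -[v + w - c]addrA [- (v + _)]opprD addrA.
have := idealB idI (cjE _ _ fg fh) (cjE _ _ fh fg).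
rewrite [cj g c + cj h c]addrC; move: (_ + _ - c) => u.
by rewrite opprB addrA subrK.
Qed.

(** The derivation [-, y] has square zero modulo I because y centralizes L; its square applied to x
    z leaves 2 [x,y][z,y]. *)
Lemma bracket_square x y z : D x -> D y -> D z -> I (lie_bracket x y * lie_bracket z y).
Proof.
move=> Dx Dy Dz.
have IL a b : I (lie_bracket (lie_bracket a b) y) by apply: Dy.
suff : I (2%:R *: (lie_bracket x y * lie_bracket z y)).
  move/(subspaceZ subI (2%:R^-1)); rewrite scalerA mulVf ?scale1r //.
  exact: natr_neq0.
have -> : 2%:R *: (lie_bracket x y * lie_bracket z y)
    = lie_bracket (lie_bracket (x * z) y) y - x * lie_bracket (lie_bracket z y) y
      - lie_bracket (lie_bracket x y) y * z.
  have Ml (a b : A) : lie_bracket (a * b) y = a * lie_bracket b y + lie_bracket a y * b.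
    by rewrite /lie_bracket mulrBr mulrBl !mulrA addrA subrK.
  have Dl (a b : A) : lie_bracket (a + b) y = lie_bracket a y + lie_bracket b y.
    by have := lie_bracketDl 1 a b y; rewrite !scale1r.
  rewrite Ml Dl !Ml scaler_nat mulr2n.
  move: (x * _) (lie_bracket x y * _) (_ * z) => p q r.
  by rewrite [RHS]addrAC [in RHS]addrA addrK -[p + q + q]addrA [p + _]addrC addrK.
by apply: idealB => //; [apply: idealB => //; apply: ideal_mull|apply: ideal_mulr].
Qed.

Lemma fixing_unitP g : fixing L I g <-> D #g.
Proof.
split=> fg c Lc; last by rewrite /= unit_conj_subE; apply: ideal_mull => //; apply: fg.
by rewrite -[lie_bracket _ _](unitVK g) -unit_conj_subE; apply: ideal_mull => //; apply: fg.
Qed.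

Let fixingI : is_subgroup (fixing L I). Proof. exact: fixing_subgroup. Qed.

(** [g,x] = g [x,g^-1] g, and g commutes with [x,g^-1] modulo I; this leaves the product
    [d,g^-1][x,g^-1] of [bracket_square]. *)
Lemma unit_bracket_inv g d x : D d -> fixing L I g -> D x ->
  I (lie_bracket d (#g)^-1 * lie_bracket #g x).
Proof.
move=> Dd fg Dx; have /fixing_unitP DV := subgroupV fixingI fg; have /fixing_unitP Dg := fg.
set l := lie_bracket x (#g)^-1; have -> : lie_bracket #g x = (l * #g - lie_bracket l #g) * #g.
  rewrite /lie_bracket subKr /l /lie_bracket mulrBr mulrBl !mulrA.
  by rewrite unit_mulV mul1r -!mulrA unit_mulVl mulr1.
rewrite mulrA mulrBr mulrA; apply: ideal_mulr => //; apply: idealB => //.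
  by apply: ideal_mulr => //; apply: bracket_square.
by apply: ideal_mull => //; apply: Dg; apply: Lbracket.
Qed.

(** The group commutator is 1 + g^-1 h^-1 c with c the Lie bracket of g and h. In the expansion of
    [d, g^-1 h^-1 c], the term with [d,c] lies in I because c is in L; the other two fall under
    [unit_bracket_inv], one of them after moving c past h^-1. *)
Lemma fixing_commutator_centralizer g h : fixing L I g -> fixing L I h -> fixing D I [~ g, h]%g.
Proof.
move=> fg fh d Dd; rewrite /= unit_conj_subE; apply: ideal_mull => //.
rewrite -lie_bracket_subr1 unit_val_commutator; set c := lie_bracket #g #h.
have Mr (a b : A) : lie_bracket d (a * b) = lie_bracket d a * b + a * lie_bracket d b.
  by rewrite /lie_bracket mulrBr mulrBl !mulrA addrA subrK.
have /fixing_unitP Dg := fg; have /fixing_unitP Dh := fh.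
have /fixing_unitP DhV := subgroupV fixingI fh.
have bN (a b : A) : lie_bracket a b = - lie_bracket b a by rewrite opprB.
have Lc : L c by apply: Lbracket.
rewrite !Mr mulrDl; apply: idealD => //; last first.
  by rewrite bN; apply: ideal_mull => //; apply: idealN => //; apply: Dd.
apply: idealD => //; last first.
  by rewrite -mulrA /c [lie_bracket #g _]bN mulrN; apply: ideal_mull => //; apply: idealN => //; apply: unit_bracket_inv.
have -> : lie_bracket d (#g)^-1 * (#h)^-1 * c
    = lie_bracket d (#g)^-1 * c * (#h)^-1 - lie_bracket d (#g)^-1 * lie_bracket c (#h)^-1.
  by rewrite -!mulrA -mulrBr /lie_bracket subKr.
apply: idealB => //; last by apply: ideal_mull => //; apply: DhV.
by apply: ideal_mulr => //; apply: unit_bracket_inv.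
Qed.

(** The derived groups lie successively in 1 + B, in the units acting trivially on L modulo Z, in
    those acting trivially on L modulo I, in those acting trivially also on D modulo I, and in 1 +
    I. At the last step the units themselves lie in D, so they commute modulo I. *)
Theorem derived_group_one_plus : derived_group G 5 `<=` one_plus I.
Proof.
have sD : is_subgroup (fixing D I) by apply: fixing_subgroup stableD stableI.
have d1 : derived_group G 1 `<=` one_plus B.
  apply: (derived_groupS_sub (k := 0) (P := setT)) => //; first exact: one_plus_subgroup.
  by move=> g h _ _; apply: one_plus_commutator.
have d2 : derived_group G 2 `<=` fixing L Z.
  apply: (derived_groupS_sub d1); first exact: fixing_subgroup.
  by move=> g h Bg Bh; apply: fixing_commutator => //; apply: one_plus_conj_commute.
have d3 : derived_group G 3 `<=` fixing L I.
  apply: (derived_groupS_sub d2) => // g h fg fh.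
  by apply: fixing_commutator => // c; apply: fixing_conj_commute.
have d4 : derived_group G 4 `<=` fixing L I `&` fixing D I.
  apply: (derived_groupS_sub d3) => [|g h fg fh].
    split=> [|g h [g1 g2] [h1 h2]]; first by case: fixingI sD => ? _ [].
    by split; [case: fixingI => _; apply|case: sD => _; apply].
  split; last exact: fixing_commutator_centralizer.
  have M g1 h1 := @subgroupM _ _ _ g1 h1 fixingI; have V g1 := @subgroupV _ _ _ g1 fixingI.
  by rewrite commgEl conjgE; exact: (M _ _ (V _ fg) (M _ _ (V _ fh) (M _ _ fg fh))).
apply: (derived_groupS_sub d4); first exact: one_plus_subgroup.
move=> g h [/fixing_unitP Dg fDg] [/fixing_unitP Dh fDh]; apply: one_plus_commutator => //.
have := fDh _ Dg; rewrite unit_conj_subE => /(ideal_mull #h idI).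
by rewrite unitVK.
Qed.

End UnitGroupChain.

Section SolvableUnits.
Variables (F : fieldType) (A : unitAlgType F) (m : nat).
Hypotheses (Finf : infinite_set [set: F]) (char0 : has_pchar0 F) (Am : nil_commutators A m).
Local Notation J := (@lie_word_ideal F A).

Lemma lie_word_ideal_ideal k : is_ideal (J k).
Proof.
have subJ := @lie_word_ideal_subspace F A k; split.
- exact: (subspace0 subJ).
- by move=> x y Jx Jy; apply: (subspaceB subJ).
- by move=> a x Jx; split; [apply: lie_word_idealMl|apply: lie_word_idealMr].
Qed.

Lemma derived_group_word_ideal k : derived_group (unit_group A) (5 + k) `<=` one_plus (J (2 ^ k)).
Proof.
elim: k => [|k IH].
  have [NB idB _ _ _] := prime_radical_structure Finf Am.
  apply: (@derived_group_one_plus _ _ char0 (prime_radical A)) => //.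
  - by rewrite NB.
  - by move=> x y; apply: commutator_prime_radical Finf Am _ _.
  - exact: lie_word_ideal_ideal.
  - exact: lie_derived2_bracket.
rewrite addnS; apply: (derived_groupS_sub IH) => [|g h Jg Jh].
  exact/one_plus_subgroup/lie_word_ideal_ideal.
apply: one_plus_commutator; first exact: lie_word_ideal_ideal.
(* The Lie bracket of g and h is that of g - 1 and h - 1, so the power of the ideal doubles. *)
rewrite -lie_bracket_subr1 -lie_bracket_subl1.
by rewrite expnS mul2n -addnn; apply: lie_word_ideal_bracket.
Qed.

Theorem nil_commutators_lie_solvable : lie_solvable A.
Proof.
have [k Ak] := lie_word_product_eq0 char0 Finf Am.
by apply: (@lie_word_ideal_lie_solvable _ _ k) => a /(lie_word_ideal_eq0 Ak).
Qed.

Theorem nil_commutators_group_solvable : solvable_group (unit_group A).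
Proof.
have [k Ak] := lie_word_product_eq0 char0 Finf Am.
exists (5 + k)%N; apply/seteqP; split=> [g /derived_group_word_ideal Jg|_ ->].
  apply: val_inj; apply/eqP; rewrite -subr_eq0; apply/eqP.
  apply: (lie_word_ideal_eq0 Ak); apply: lie_word_ideal_leq Jg.
  exact/ltnW/ltn_expl.
by rewrite addSn; have [] := smallest_subgroup [set z | exists x y : unit_group A,
  [/\ derived_group _ (4 + k) x, derived_group _ (4 + k) y & z = [~ x, y]%g]].
Qed.

End SolvableUnits.

Theorem proposition1p1 (F : fieldType) (p : nat) (A : unitAlgType F)
    (Finf : infinite_set [set: F]) (charF : has_characteristic F p)
    (Aalg : algebraic_algebra A) :
  [<-> GI_algebra A;
       (p = 0%N -> solvable_group (unit_group A)) /\
       ((0 < p)%N -> exists t : nat, forall x y : unit_group A,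
          ([~ x, y] ^+ (p ^ t) = 1)%g);
       satisfies_nonmatrix_identity A;
       (p = 0%N -> lie_solvable A) /\
       ((0 < p)%N -> exists t : nat, forall x y z : A,
          (lie_bracket x y * z) ^+ (p ^ t)%N = 0)]
  /\
  (GI_algebra A ->
   [/\ nilpotents A = prime_radical A,
       is_ideal (prime_radical A),
       locally_nilpotent (prime_radical A),
       forall q r : prime_quotient A, q * r = r * q
     & reduced_ring (prime_quotient A)]).
Proof.
have GI_nil : GI_algebra A -> exists m, nil_commutators A m.
  by move=> /(GI_nonmatrix Finf Aalg) /(nonmatrix_nil_commutators Finf).
split; last by move=> /GI_nil[m Am]; apply: prime_radical_structure Finf Am.
have group_part m : nil_commutators A m ->
    (p = 0%N -> solvable_group (unit_group A)) /\
    ((0 < p)%N -> exists t : nat, forall x y : unit_group A, ([~ x, y] ^+ (p ^ t) = 1)%g).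
  move=> Am; case: p charF => [|q] charF'; split=> // _.
    exact: nil_commutators_group_solvable Finf charF' Am.
  exact: (nil_commutators_group_power charF' Am).
have p_gt0 t : (0 < p)%N -> (0 < p ^ t)%N by move=> p0; rewrite expn_gt0 p0.
have group_GI : (p = 0%N -> solvable_group (unit_group A)) /\
    ((0 < p)%N -> exists t : nat, forall x y : unit_group A, ([~ x, y] ^+ (p ^ t) = 1)%g) ->
    GI_algebra A.
  move=> [p0 pp]; have [/p0|p1] := posnP p; first exact: solvable_GI.
  by have [t] := pp p1; apply: commutator_power_GI; apply: p_gt0.
tfae.
- by move=> /GI_nil[m /group_part].
- by move=> /group_GI; apply: GI_nonmatrix.
- move=> /(nonmatrix_nil_commutators Finf)[m Am].
  case: p charF {p_gt0 group_part group_GI} => [|q] charF'; split=> // _.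
    exact: nil_commutators_lie_solvable Finf charF' Am.
  exact: (nil_commutators_power charF' Am).
- move=> [p0 pp]; apply: group_GI.
  (* In positive characteristic the fourth condition is [nil_commutators] with m = p^t; in
     characteristic 0 it passes through a non-matrix identity. *)
  have [m /group_part //] : exists m, nil_commutators A m.
  have [p00|p1] := posnP p; last by have [t] := pp p1; exists (p ^ t)%N.
  apply: nonmatrix_nil_commutators Finf _.
  by apply: lie_solvable_nonmatrix (p0 p00); move: charF; rewrite p00.
Qed.
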